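(* Let $A$ be a non-zero trace-class operator on $L^2(\mathbb{R}_+)$. The following are equivalent: 1) $\mathcal{F}_W(A\mathcal{D}^{-1})\in L^2_r(\mathrm{Aff})$. 2) $A\mathcal{D}^{-1}$ extends from $\mathrm{dom}(\mathcal{D}^{-1})$ to a Hilbert-Schmidt operator on $L^2(\mathbb{R}_+)$. 3) $A^*A$ is admissible.
   Context: $\mathrm{Aff}=\mathbb{R}\times\mathbb{R}_+$, $\mathbb{R}_+=(0,\infty)$, is the affine group with $(x,a)\cdot(y,b)=(ay+x,ab)$; $L^2_r(\mathrm{Aff})=L^2(\mathrm{Aff},a^{-1}dx\,da)$. $L^2(\mathbb{R}_+)=L^2(\mathbb{R}_+,r^{-1}dr)$, with unitary representation $U(x,a)\psi(r)=e^{2\pi i xr}\psi(ar)$. $\mathcal{D}\psi(r)=r^{1/2}\psi(r)$ and $\mathcal{D}^{-1}\psi(r)=r^{-1/2}\psi(r)$ are multiplication operators on $L^2(\mathbb{R}_+)$ with their maximal domains. A non-zero bounded operator $S$ on $L^2(\mathbb{R}_+)$ mapping $\mathrm{dom}(\mathcal{D})$ into $\mathrm{dom}(\mathcal{D}^{-1})$ is admissible if $\mathcal{D}^{-1}S\mathcal{D}^{-1}$ is bounded on $\mathrm{dom}(\mathcal{D}^{-1})$ and extends to a trace-class operator. For trace-class $A$, the notation $\mathcal{F}_W(A\mathcal{D}^{-1})$ denotes the function $\mathcal{F}_W(A\mathcal{D}^{-1})(x,a):=\mathrm{tr}(AU(x,a))$ on $\mathrm{Aff}$. (This agrees with the affine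 Fourier-Wigner transform of $A\mathcal{D}^{-1}$ when $A\mathcal{D}^{-1}$ extends to a Hilbert-Schmidt operator.) *)

(* Defs.v *)
From HB Require Import structures.
From mathcomp Require Import all_boot all_order all_algebra.
From mathcomp Require Import complex.
From mathcomp Require Import all_classical all_reals all_analysis.

Set Implicit Arguments.
Unset Strict Implicit.
Unset Printing Implicit Defensive.

Import Order.TTheory GRing.Theory Num.Theory.
Import numFieldNormedType.Exports.

Local Open Scope classical_set_scope.
Local Open Scope ring_scope.
Local Open Scope complex_scope.

(* Measures with a density (dr/r on R_+, dx da/a on the affine group) are encoded
   as Lebesgue measure together with a weight, restricted to a domain; the
   values of a function outside that domain are irrelevant.

   Vectors of a (weighted) L^2 space are represented by functions and operators
   by maps between functions; all identities between vectors are stated almost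
   everywhere. A map that is additive, homogeneous (a.e.) and bounded for the
   seminorm respects a.e. equality, hence is the same thing as a bounded
   operator on the space of classes. *)

Section WeightedL2.
Context {R : realType} {d : measure_display} {T : measurableType d}.

Definition normc_sq (z : R[i]) : R := complex.Re z ^+ 2 + complex.Im z ^+ 2.

Definition cmeasurable (D : set T) (f : T -> R[i]) : Prop :=
  measurable_fun D (fun t => complex.Re (f t)) /\
  measurable_fun D (fun t => complex.Im (f t)).

(* complex-valued L^2(D, w dmu) *)
Definition weighted_L2 (mu : {measure set T -> \bar R}) (D : set T) (w : T -> R)
    : set (T -> R[i]) :=
  [set f | cmeasurable D f /\
           (\int[mu]_(t in D) (w t * normc_sq (f t))%:E < +oo)%E].

End WeightedL2.

Section AffineGroup.
Context {R : realType}.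

Local Notation leb := (@lebesgue_measure R).

Definition Rplus : set R := `]0, +oo[.

Definition Aff : set (R * R) := setT `*` Rplus.

Definition L2r_Aff : set (R * R -> R[i]) :=
  weighted_L2 (leb \x leb)%E Aff (fun p => p.2^-1).

Definition L2 : set (R -> R[i]) := weighted_L2 leb Rplus (fun r => r^-1).

Definition L2eq (f g : R -> R[i]) : Prop := ae_eq leb Rplus f g.

Definition inner (f g : R -> R[i]) : R[i] :=
  Complex
    (\int[leb]_(r in Rplus) (r^-1 * complex.Re (f r * (g r)^*)))
    (\int[leb]_(r in Rplus) (r^-1 * complex.Im (f r * (g r)^*))).

Definition norm2 (f : R -> R[i]) : R :=
  Num.sqrt (\int[leb]_(r in Rplus) (r^-1 * normc_sq (f r))).

Definition operator : Type := (R -> R[i]) -> (R -> R[i]).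

Definition bounded_operator (A : operator) : Prop :=
  [/\ forall f, L2 f -> L2 (A f),
      forall (c : R[i]) f g, L2 f -> L2 g ->
        L2eq (A (fun r => c * f r + g r)) (fun r => c * A f r + A g r) &
      exists M : R, forall f, L2 f -> norm2 (A f) <= M * norm2 f].

Definition nonzero_operator (A : operator) : Prop :=
  ~ (forall f, L2 f -> L2eq (A f) (fun=> 0)).

(* [adjoint A g] is the (a.e. unique) vector representing f |-> <A f, g>. *)
Definition adjoint (A : operator) : operator := fun g =>
  xget (fun=> 0)
    [set h | L2 h /\ forall f, L2 f -> inner (A f) g = inner f h].

(* [0 <= z] in R[i] means that z is real and nonnegative. *)
Definition positive_operator (P : operator) : Prop :=
  forall f, L2 f -> 0 <= inner (P f) f.

(* P = |A|, the positive square root of A^* A *)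
Definition is_abs (A P : operator) : Prop :=
  [/\ bounded_operator P, positive_operator P &
      forall f, L2 f -> L2eq (P (P f)) (adjoint A (A f))].

Definition orthonormal_basis (e : nat -> R -> R[i]) : Prop :=
  [/\ forall n, L2 (e n),
      forall m n, inner (e m) (e n) = (m == n)%:R &
      forall f, L2 f -> (forall n, inner f (e n) = 0) -> L2eq f (fun=> 0)].

Definition trace_class (A : operator) : Prop :=
  bounded_operator A /\
  exists P e, [/\ is_abs A P, orthonormal_basis e &
    (\sum_(0 <= n <oo) (complex.Re (inner (P (e n)) (e n)))%:E < +oo)%E].

Definition Hilbert_Schmidt (A : operator) : Prop :=
  bounded_operator A /\
  exists e, orthonormal_basis e /\
    (\sum_(0 <= n <oo) (norm2 (A (e n)) ^+ 2)%:E < +oo)%E.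

(* meaningful for trace-class A: the common value over all orthonormal bases *)
Definition trace (A : operator) : R[i] :=
  xget 0 [set t : R[i] | forall e, orthonormal_basis e ->
    (fun n => \sum_(0 <= k < n) inner (A (e k)) (e k) : R[i]^o) @ \oo
      --> (t : R[i]^o)].

Definition expi (t : R) : R[i] := Complex (cos t) (sin t).

(* U (x, a), for a > 0 *)
Definition U (p : R * R) : operator := fun psi r =>
  expi (2 * pi * p.1 * r) * psi (p.2 * r).

Definition Dop : operator := fun psi r => (Num.sqrt r)%:C * psi r.
Definition Dinv : operator := fun psi r => ((Num.sqrt r)^-1)%:C * psi r.

Definition dom_D : set (R -> R[i]) := [set psi | L2 psi /\ L2 (Dop psi)].
Definition dom_Dinv : set (R -> R[i]) := [set psi | L2 psi /\ L2 (Dinv psi)].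

(* For f in dom_Dinv, [Dinv f] lies in dom_D, so that D^-1 S D^-1 f is defined
   as soon as S maps dom_D into dom_Dinv. *)
Definition admissible (S : operator) : Prop :=
  [/\ bounded_operator S, nonzero_operator S,
      forall f, dom_D f -> dom_Dinv (S f),
      exists M : R, forall f, dom_Dinv f ->
        norm2 (Dinv (S (Dinv f))) <= M * norm2 f &
      exists T : operator, trace_class T /\
        forall f, dom_Dinv f -> L2eq (T f) (Dinv (S (Dinv f)))].

(* the function denoted F_W(A D^-1), for A trace class *)
Definition FW_Dinv (A : operator) (p : R * R) : R[i] :=
  trace (fun f => A (U p f)).

End AffineGroup.
Arguments operator : clear implicits.

(* Main.v *)
Require Import Defs.
From HB Require Import structures.
From mathcomp Require Import all_boot all_order all_algebra.
From mathcomp Require Import complex.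
From mathcomp Require Import all_classical all_reals all_analysis.
From mathcomp Require Import measurable_realfun.
From mathcomp Require Import ring lra.

Set Implicit Arguments.
Unset Strict Implicit.
Unset Printing Implicit Defensive.

Import Order.TTheory GRing.Theory Num.Theory.
Import numFieldNormedType.Exports.

Local Open Scope classical_set_scope.
Local Open Scope ring_scope.
Local Open Scope complex_scope.

(** A trace-class operator is an integral operator, and each of the three conditions says that the
    kernel of A D^-1 is square integrable.

    Functions are transported to Lebesgue measure by passing to the half-density r^(-1/2) f(r).
    Orthonormalizing a basis for the form <|A| x, y> writes A as a sum of rank-one operators
    x |-> sum_j <x, w_j> u_j with sum_j |u_j|^2 and sum_j |w_j|^2 finite
    ([trace_class_factor]). After a modification on null sets the series
    k(r, s) = sum_j u_j(r) conj(w_j(s)) converges absolutely at every point, and A is integration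
    against k ([lift_knl]). As D^-1 multiplies by s^(-1/2), the kernel of A D^-1 is s^(-1/2) k(r, s),
    and the quantity in question is [knl_norm],
<<
      K = \int \int |k(r, s)|^2 s^-1 ds dr.
>>
    First, K is exactly the squared norm of F_W in L^2_r(Aff) ([FW_fun_norm]). The trace of a sum of
    rank-one operators may be computed in any basis ([trace_cvg]), which gives
<<
      tr (A U(x, a)) = \int e^(2 pi i x s) a^(1/2) k(a s, s) ds.
>>
    For fixed a this is the Fourier transform of an integrable function of s, so that the Plancherel
    formula in x and the substitution r = a s in a turn the integral of |F_W|^2 dx da / a into K.

    Second, if K is finite, then integration against s^(-1/2) k(r, s) is a Hilbert-Schmidt operator
    that extends A D^-1, by Parseval in s for almost every r ([Hilbert_Schmidt_norm]).

    Third, if a Hilbert-Schmidt operator B extends A D^-1, then D^-1 A^* = B^* ([Dinv_adjoint]), so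
    that D^-1 A^* A D^-1 is a restriction of B^* B, which is trace class because B is
    Hilbert-Schmidt.

    Finally, let T be a trace-class extension of D^-1 A^* A D^-1. For f supported in a window
    [1/N, N], where D^-1 is bounded, <T f, f> = |A D^-1 f|^2. The compressions of T to the windows
    have traces bounded independently of N ([compressed_trace_bounded]), and by Parseval those traces
    are the integrals of |k(r, s)|^2 / s over the s in the window; letting N grow shows that K is
    finite ([admissible_knl_norm]).

    The Plancherel formula for integrable functions is obtained from the identity, for real u,
<<
      \int_0^oo e^(-e x) |u^(x)|^2 dx = \int \int u(s) u(t) p_e(s - t) ds dt,
>>
    where p_e is the Poisson kernel, by letting e tend to 0 ([pairing_half_le] and
    [half_le_pairing]). *)

(** * Squared moduli and complex limits *)

Section ComplexModulus.
Context {R : realType}.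
Implicit Types x y z : R[i].

Lemma normc_sqE z : (normc_sq z)%:C = z * z^*.
Proof.
case: z => a b; rewrite /normc_sq /=; apply/eqP; rewrite eq_complex /=.
by apply/andP; split; apply/eqP; ring.
Qed.

Lemma normc_sqM x y : normc_sq (x * y) = normc_sq x * normc_sq y.
Proof. by case: x y => [a b] [c d]; rewrite /normc_sq /=; ring. Qed.

Lemma normc_sqJ x : normc_sq x^* = normc_sq x.
Proof. by case: x => a b; rewrite /normc_sq /=; ring. Qed.

Lemma normc_sqN x : normc_sq (- x) = normc_sq x.
Proof. by case: x => a b; rewrite /normc_sq /=; ring. Qed.

Lemma normc_sqR (a : R) : normc_sq a%:C = a ^+ 2.
Proof. by rewrite /normc_sq /=; ring. Qed.

Lemma normc_sq_ge0 x : 0 <= normc_sq x.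
Proof. by rewrite addr_ge0 ?sqr_ge0. Qed.

Lemma normc_sq0 : normc_sq (0 : R[i]) = 0.
Proof. by rewrite /normc_sq /=; ring. Qed.

Lemma normc_sq_eq0 x : normc_sq x = 0 -> x = 0.
Proof.
case: x => a b; rewrite /normc_sq /= => /eqP; rewrite paddr_eq0 ?sqr_ge0//.
by rewrite !sqrf_eq0 => /andP[/eqP -> /eqP ->].
Qed.

Lemma normc_sqD_le x y : normc_sq (x + y) <= 2 * normc_sq x + 2 * normc_sq y.
Proof.
case: x y => [a b] [c d]; rewrite /normc_sq /=.
by have := sqr_ge0 (a - c); have := sqr_ge0 (b - d); nra.
Qed.

Lemma ReD x y : complex.Re (x + y) = complex.Re x + complex.Re y.
Proof. by case: x y => [a b] [c d]. Qed.

Lemma ImD x y : complex.Im (x + y) = complex.Im x + complex.Im y.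
Proof. by case: x y => [a b] [c d]. Qed.

Lemma ReN x : complex.Re (- x) = - complex.Re x.
Proof. by case: x. Qed.

Lemma ImN x : complex.Im (- x) = - complex.Im x.
Proof. by case: x. Qed.

Lemma ReM x y : complex.Re (x * y) =
  complex.Re x * complex.Re y - complex.Im x * complex.Im y.
Proof. by case: x y => [a b] [c d]. Qed.

Lemma ImM x y : complex.Im (x * y) =
  complex.Re x * complex.Im y + complex.Im x * complex.Re y.
Proof. by case: x y => [a b] [c d]. Qed.

Lemma ReJ x : complex.Re x^* = complex.Re x.
Proof. by case: x. Qed.

Lemma ImJ x : complex.Im x^* = - complex.Im x.
Proof. by case: x. Qed.

Lemma complexP x y :
  complex.Re x = complex.Re y -> complex.Im x = complex.Im y -> x = y.
Proof. by case: x y => [a b] [c d] /= -> ->. Qed.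

Lemma Re_sum (I : Type) (s : seq I) (P : pred I) (F : I -> R[i]) :
  complex.Re (\sum_(i <- s | P i) F i) = \sum_(i <- s | P i) complex.Re (F i).
Proof. by apply: (big_morph (@complex.Re R)) => // x y; exact: ReD. Qed.

Lemma Im_sum (I : Type) (s : seq I) (P : pred I) (F : I -> R[i]) :
  complex.Im (\sum_(i <- s | P i) F i) = \sum_(i <- s | P i) complex.Im (F i).
Proof. by apply: (big_morph (@complex.Im R)) => // x y; exact: ImD. Qed.

Lemma Re_le_normc_sq x : complex.Re x ^+ 2 <= normc_sq x.
Proof. by rewrite /normc_sq lerDl sqr_ge0. Qed.

Lemma ReM_le x y : complex.Re (x * y) <= normc_sq x + normc_sq y.
Proof.
case: x y => [a b] [c d]; rewrite /normc_sq /=.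
have := sqr_ge0 (a - c); have := sqr_ge0 (b + d).
have := sqr_ge0 (a + c); have := sqr_ge0 (b - d); nra.
Qed.

Definition cvg0c (z : nat -> R[i]) := normc_sq (z n) @[n --> \oo] --> (0 : R).

Lemma cvg0c_le (z : nat -> R[i]) (r : nat -> R) :
  (forall n, normc_sq (z n) <= r n) -> r n @[n --> \oo] --> (0 : R) -> cvg0c z.
Proof.
move=> zr r0; apply: (@squeeze_cvgr _ _ _ _ (cst 0) r) => //; last exact: cvg_cst.
by apply: nearW => n /=; rewrite normc_sq_ge0 zr.
Qed.

Lemma cvg0c_eq (z w : nat -> R[i]) :
  (forall n, normc_sq (z n) = normc_sq (w n)) -> cvg0c z -> cvg0c w.
Proof. by move=> /funext; rewrite /cvg0c => ->. Qed.

Lemma cvg0cD (z w : nat -> R[i]) : cvg0c z -> cvg0c w -> cvg0c (fun n => z n + w n).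
Proof.
move=> z0 w0; apply: cvg0c_le (fun n => normc_sqD_le (z n) (w n)) _.
rewrite -[X in _ --> X](_ : 2 * 0 + 2 * 0 = 0); last by ring.
by apply: cvgD; apply: cvgM => //; exact: cvg_cst.
Qed.

Lemma cvg0c_sum m (z : nat -> nat -> R[i]) : (forall k, cvg0c (z k)) ->
  cvg0c (fun n => \sum_(k < m) z k n).
Proof.
move=> z0; elim: m => [|m IH].
  rewrite /cvg0c; under eq_fun do rewrite big_ord0 normc_sq0; exact: cvg_cst.
by under eq_fun do rewrite big_ord_recr /=; exact: cvg0cD.
Qed.

Lemma cvg0c_bound (z : nat -> R[i]) (k : R) x : 0 <= k -> cvg0c (fun n => x - z n) ->
  (forall n, normc_sq (z n) <= k) -> normc_sq x <= 2 * k.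
Proof.
move=> k0 zx zk; rewrite -subr_le0.
have h : 2 * normc_sq (x - z n) @[n --> \oo] --> (0 : R).
  by rewrite -(mulr0 2); apply: cvgM => //; exact: cvg_cst.
apply: (cvgr_to_ge h); apply: nearW => n.
have := normc_sqD_le (x - z n) (z n); rewrite subrK; have := zk n; lra.
Qed.

Lemma cvg0c_Re_le (z : nat -> R[i]) (k : R) x : cvg0c (fun n => x - z n) ->
  (forall n, complex.Re (z n) <= k) -> complex.Re x <= k.
Proof.
move=> zx zk; rewrite leNgt; apply/negP => kx.
have : (complex.Re x - k) ^+ 2 <= 0.
  apply: (cvgr_to_ge zx); apply: nearW => n.
  apply: le_trans (Re_le_normc_sq _); rewrite ReD ReN.
  by rewrite ler_pXn2r// ?nnegrE; have := zk n; lra.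
by rewrite leNgt exprn_gt0// subr_gt0.
Qed.

(** By induction on [n]: the cross term is at most 2 sqrt(A q) sqrt(B p), hence at most
    A q + B p, where A, B are the partial sums and p, q the new terms. *)
Lemma CauchySchwarz_sum (z : nat -> R[i]) (a b : nat -> R) n :
  (forall k, 0 <= a k) -> (forall k, 0 <= b k) ->
  (forall k, normc_sq (z k) <= a k * b k) ->
  normc_sq (\sum_(k < n) z k) <= (\sum_(k < n) a k) * (\sum_(k < n) b k).
Proof.
move=> a0 b0 zab; elim: n => [|n IH].
  by rewrite !big_ord0 normc_sq0 mul0r.
rewrite !big_ord_recr /=.
set S := \sum_(k < n) z k in IH *; set A := \sum_(k < n) a k in IH *.
set B := \sum_(k < n) b k in IH *.
have A0 : 0 <= A by exact: sumr_ge0.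
have B0 : 0 <= B by exact: sumr_ge0.
have := zab n; move: (a0 n) (b0 n); move: (a n) (b n) (z n) => p q w p0 q0 wpq.
have -> : normc_sq (S + w) = normc_sq S + normc_sq w + 2 * complex.Re (S * w^*).
  by case: S {IH} w {wpq} => [? ?] [? ?]; rewrite /normc_sq /=; ring.
have cross : 2 * complex.Re (S * w^*) <= A * q + B * p.
  have Aq0 : 0 <= A * q by exact: mulr_ge0.
  have Bp0 : 0 <= B * p by exact: mulr_ge0.
  have [|c0] := ltP 0 (complex.Re (S * w^*)); last first.
    by rewrite (le_trans (mulr_ge0_le0 _ c0))// addr_ge0.
  move=> c0.
  rewrite -(@ler_pXn2r _ 2)// ?nnegrE; [|lra|lra].
  have : (complex.Re (S * w^*)) ^+ 2 <= (A * B) * (p * q).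
    apply: (le_trans (Re_le_normc_sq _)); rewrite normc_sqM normc_sqJ.
    by apply: ler_pM => //; exact: normc_sq_ge0.
  have : 0 <= (A * q - B * p) ^+ 2 by exact: sqr_ge0.
  nra.
nra.
Qed.

End ComplexModulus.

(** * Semi-inner products *)

Section SemiInner.
Context {R : realType} {H : lmodType R[i]}.

(** Only semi-definite: vectors will be functions, and functions that agree almost everywhere
    are at distance zero. *)
Record semi_inner := SemiInner {
  ip :> H -> H -> R[i];
  ip_linear : forall a x y z, ip (a *: x + y) z = a * ip x z + ip y z;
  ipJ : forall x y, (ip x y)^* = ip y x;
  ip_ge0 : forall x, 0 <= ip x x }.

Variable b : semi_inner.
Implicit Types x y z : H.

Definition qn x : R := complex.Re (b x x).

Lemma ip_qn x : b x x = (qn x)%:C.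
Proof.
have := ip_ge0 b x; rewrite /qn; case: (b x x) => p q.
by rewrite lecE /= => /andP[/eqP -> _].
Qed.

Lemma qn_ge0 x : 0 <= qn x.
Proof. by have := ip_ge0 b x; rewrite ip_qn ler0c. Qed.

Lemma ip0l y : b 0 y = 0.
Proof.
have := ip_linear b 1 0 0 y; rewrite scale1r addr0 mul1r => h.
by apply: (@addrI _ (b 0 y)); rewrite addr0 -h.
Qed.

Lemma ipDl x y z : b (x + y) z = b x z + b y z.
Proof. by rewrite -[x in LHS]scale1r ip_linear mul1r. Qed.

Lemma ipZl a x z : b (a *: x) z = a * b x z.
Proof. by rewrite -[_ *: _]addr0 ip_linear ip0l addr0. Qed.

Lemma ipNl x z : b (- x) z = - b x z.
Proof. by rewrite -scaleN1r ipZl mulN1r. Qed.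

Lemma ipBl x y z : b (x - y) z = b x z - b y z.
Proof. by rewrite ipDl ipNl. Qed.

Lemma ip0r y : b y 0 = 0.
Proof. by rewrite -ipJ ip0l conjc0. Qed.

Lemma ipDr x y z : b z (x + y) = b z x + b z y.
Proof. by rewrite -ipJ ipDl rmorphD /= !ipJ. Qed.

Lemma ipZr a x z : b z (a *: x) = a^* * b z x.
Proof. by rewrite -ipJ ipZl rmorphM /= ipJ. Qed.

Lemma ipZrR (a : R) x z : b z (a%:C *: x) = a%:C * b z x.
Proof. by rewrite ipZr; congr (_ * _); apply: complexP; rewrite /= ?oppr0. Qed.

Lemma ipNr x z : b z (- x) = - b z x.
Proof. by rewrite -ipJ ipNl rmorphN /= ipJ. Qed.

Lemma ipBr x y z : b z (x - y) = b z x - b z y.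
Proof. by rewrite ipDr ipNr. Qed.

Lemma ip_suml n (F : nat -> H) z : b (\sum_(k < n) F k) z = \sum_(k < n) b (F k) z.
Proof. by apply: (big_morph (b^~ z)) => [x y|]; [exact: ipDl|exact: ip0l]. Qed.

Lemma ip_sumr n (F : nat -> H) z : b z (\sum_(k < n) F k) = \sum_(k < n) b z (F k).
Proof. by apply: (big_morph (b z)) => [x y|]; [exact: ipDr|exact: ip0r]. Qed.

Lemma qn0 : qn 0 = 0.
Proof. by rewrite /qn ip0l. Qed.

Lemma qnN x : qn (- x) = qn x.
Proof. by rewrite /qn ipNl ipNr opprK. Qed.

Lemma qnZ a x : qn (a *: x) = normc_sq a * qn x.
Proof.
apply: complexI; rewrite -ip_qn ipZl ipZr ip_qn mulrA -normc_sqE.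
by rewrite rmorphM.
Qed.

Lemma qnD x y : qn (x + y) = qn x + qn y + 2 * complex.Re (b x y).
Proof.
rewrite /qn ipDl !ipDr !ReD -(ipJ b x y) ReJ; ring.
Qed.

Lemma qnB x y : qn (x - y) = qn x + qn y - 2 * complex.Re (b x y).
Proof. by rewrite qnD qnN ipNr ReN mulrN. Qed.

Lemma qnD_le x y : qn (x + y) <= 2 * qn x + 2 * qn y.
Proof. by have := qn_ge0 (x - y); rewrite qnB qnD; lra. Qed.

Lemma qnBC x y : qn (x - y) = qn (y - x).
Proof. by rewrite -qnN opprB. Qed.

(** The quadratic polynomial |x - t <x, y> y|^2 in the real variable t is nonnegative. *)
Lemma CauchySchwarz x y : normc_sq (b x y) <= qn x * qn y.
Proof.
have h (t : R) : 0 <= qn x - 2 * t * normc_sq (b x y) +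
    t ^+ 2 * normc_sq (b x y) * qn y.
  have := qn_ge0 (x - (t%:C * b x y) *: y).
  rewrite qnB qnZ ipZr normc_sqM normc_sqR.
  suff -> : complex.Re ((t%:C * b x y)^* * b x y) = t * normc_sq (b x y) by lra.
  by case: (b x y) => p q; rewrite /normc_sq /=; ring.
have := qn_ge0 x; have := qn_ge0 y; have := normc_sq_ge0 (b x y).
move: (qn x) (qn y) (normc_sq _) h => p q c h c0 q0 p0.
(* For q > 0, evaluate at the minimum; for q = 0 the polynomial is affine in t. *)
have [q_gt0|] := ltP 0 q.
  have := h q^-1; rewrite -(@ler_pM2r _ q)// mul0r.
  suff -> : (p - 2 * q^-1 * c + q^-1 ^+ 2 * c * q) * q = p * q - c by lra.
  by field; rewrite gt_eqF.
move=> q_le0; have {q_le0 q0} q0 : q = 0 by apply/eqP; rewrite eq_le q_le0.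
rewrite q0 mulr0; rewrite leNgt; apply/negP => c_gt0.
have := h ((p + 1) / (2 * c)); rewrite q0 mulr0 addr0.
suff -> : p - 2 * ((p + 1) / (2 * c)) * c = - 1 by lra.
by field; rewrite gt_eqF.
Qed.

Lemma ip_null_l x y : qn x = 0 -> b x y = 0.
Proof.
move=> x0; apply: normc_sq_eq0; apply/eqP; rewrite eq_le normc_sq_ge0 andbT.
by have := CauchySchwarz x y; rewrite x0 mul0r.
Qed.

Lemma ip_null_r x y : qn y = 0 -> b x y = 0.
Proof. by move=> y0; rewrite -ipJ ip_null_l ?conjc0. Qed.

Lemma qn_ext x : (forall z, b x z = 0) -> qn x = 0.
Proof. by move=> h; rewrite /qn h. Qed.

Lemma qnD_null x y : qn x = 0 -> qn y = 0 -> qn (x + y) = 0.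
Proof. by move=> x0 y0; rewrite qnD x0 y0 ip_null_l//= mulr0 !addr0. Qed.

Lemma qn_eq_null x y : qn (x - y) = 0 -> qn x = qn y.
Proof.
move=> xy; rewrite -[x](subrK y) qnD xy add0r (ip_null_l _ xy) /=; ring.
Qed.

Lemma ip_eq_null x y z : qn (x - y) = 0 -> b x z = b y z.
Proof. by move=> xy; apply/eqP; rewrite -subr_eq0 -ipBl ip_null_l. Qed.

(** * Systems that are orthonormal up to null vectors *)

(** Null vectors are admitted, so that Gram-Schmidt need not discard a vector that depends on
    the preceding ones. *)
Definition subon (y : nat -> H) := forall i j, b (y i) (y j) = 0 \/
  (i = j /\ b (y i) (y j) = 1).

Definition proj (y : nat -> H) n x := \sum_(k < n) b x (y k) *: y k.

Section Projection.
Variable y : nat -> H.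
Hypothesis yon : subon y.

Lemma proj_ip n x k : (k < n)%N -> b (proj y n x) (y k) = b x (y k).
Proof.
move=> kn; rewrite /proj (ip_suml n (fun k => b x (y k) *: y k)).
rewrite (bigD1 (Ordinal kn)) //= big1 => [|i ik]; last first.
  rewrite ipZl; have [->|[ei _]] := yon i k; first by rewrite mulr0.
  by move/eqP: ik; case; apply: val_inj.
rewrite addr0 ipZl; have [e|[_ ->]] := yon k k; last by rewrite mulr1.
by rewrite ip_null_r ?mul0r// /qn e.
Qed.

Lemma proj_orth n x k : (k < n)%N -> b (x - proj y n x) (y k) = 0.
Proof. by move=> kn; rewrite ipBl proj_ip// subrr. Qed.

Lemma proj_linear n a x z : proj y n (a *: x + z) = a *: proj y n x + proj y n z.
Proof.
rewrite /proj scaler_sumr -big_split /=; apply: eq_bigr => k _.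
by rewrite ip_linear scalerDl scalerA.
Qed.

Lemma projB n x z : proj y n (x - z) = proj y n x - proj y n z.
Proof.
have := proj_linear n (-1) z x; rewrite !scaleN1r addrC => ->.
by rewrite addrC.
Qed.

Lemma qn_proj n x : qn (proj y n x) = \sum_(k < n) normc_sq (b x (y k)).
Proof.
apply: complexI; rewrite -ip_qn {2}/proj.
rewrite (ip_sumr n (fun k => b x (y k) *: y k)) rmorph_sum /=.
by apply: eq_bigr => k _; rewrite ipZr proj_ip// normc_sqE mulrC.
Qed.

Lemma qn_resid n x :
  qn (x - proj y n x) = qn x - \sum_(k < n) normc_sq (b x (y k)).
Proof.
rewrite qnB qn_proj; set s := \sum_(k < n) _.
have -> : b x (proj y n x) = s%:C.
  rewrite /proj (ip_sumr n (fun k => b x (y k) *: y k)) rmorph_sum /=.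
  by apply: eq_bigr => k _; rewrite ipZr normc_sqE mulrC.
by rewrite /=; lra.
Qed.

Lemma Bessel n x : \sum_(k < n) normc_sq (b x (y k)) <= qn x.
Proof. by rewrite -subr_ge0 -qn_resid qn_ge0. Qed.

Lemma qn_resid_le m n x : (m <= n)%N ->
  qn (x - proj y n x) <= qn (x - proj y m x).
Proof.
move=> mn; rewrite !qn_resid lerD2l lerN2.
rewrite -(subnKC mn) big_split_ord /= lerDl.
by apply: sumr_ge0 => i _; exact: normc_sq_ge0.
Qed.

End Projection.

Definition hilbert_complete := forall x : nat -> H,
  (forall e : R, 0 < e -> exists N, forall m n, (N <= m)%N -> (N <= n)%N ->
    qn (x m - x n) <= e) ->
  exists l, qn (x n - l) @[n --> \oo] --> (0 : R).

Definition onb (e : nat -> H) :=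
  (forall i j, b (e i) (e j) = (i == j)%:R) /\
  (forall x, (forall n, b x (e n) = 0) -> qn x = 0).

Lemma onb_subon e : onb e -> subon e.
Proof.
move=> [h _] i j; rewrite h; case: eqP => [->|_]; last by left.
by right.
Qed.

Lemma ip_cvg0 (u : nat -> H) z : qn (u n) @[n --> \oo] --> (0 : R) ->
  normc_sq (b (u n) z) @[n --> \oo] --> (0 : R).
Proof.
move=> u0.
apply: (@squeeze_cvgr _ _ _ _ (cst 0) (fun n => qn (u n) * qn z)).
- by apply: nearW => n /=; rewrite normc_sq_ge0 CauchySchwarz.
- exact: cvg_cst.
- by rewrite -(mul0r (qn z)); apply: cvgM => //; exact: cvg_cst.
Qed.

Lemma cst_cvg0 (c : R) (u : nat -> R) : u n @[n --> \oo] --> (0 : R) ->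
  0 <= c -> (\forall n \near \oo, c <= u n) -> c = 0.
Proof.
move=> u0 c0 cu; apply/eqP; rewrite eq_le c0 andbT.
by apply: (cvgr_to_ge u0); exact: cu.
Qed.

(** * Complete spaces *)

Section Complete.
Hypothesis bC : hilbert_complete.
Variable e : nat -> H.
Hypothesis eON : onb e.

(** The partial sums are Cauchy, by Pythagoras and the summability of the squared
    coordinates. *)
Lemma cvg_coords (c : nat -> R[i]) (M : R) :
  (forall n, \sum_(k < n) normc_sq (c k) <= M) ->
  exists2 l, qn (\sum_(k < n) c k *: e k - l) @[n --> \oo] --> (0 : R) &
    forall k, b l (e k) = c k.
Proof.
move=> cM; pose x n := \sum_(k < n) c k *: e k.
have on := onb_subon eON.
have xk n k : b (x n) (e k) = if (k < n)%N then c k else 0.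
  rewrite /x (ip_suml n (fun k => c k *: e k)).
  under eq_bigr do rewrite ipZl eON.1.
  case: ifPn => [kn|nk].
    rewrite (bigD1 (Ordinal kn))//= eqxx mulr1 big1 ?addr0// => i ik.
    by rewrite (_ : (_ == _) = false) ?mulr0//; apply/negbTE.
  rewrite big1// => i _; case: eqP => [ik|]; last by rewrite mulr0.
  by rewrite -ik ltn_ord in nk.
have qx m n : (m <= n)%N -> qn (x n - x m) =
    \sum_(k < n) normc_sq (c k) - \sum_(k < m) normc_sq (c k).
  move=> mn; have xm : x m = proj e m (x n).
    by rewrite /x /proj; apply: eq_bigr => k _; rewrite xk (leq_trans _ mn).
  rewrite {1}xm (qn_resid on).
  have xn : x n = proj e n (x n).
    by rewrite {1}/x /proj; apply: eq_bigr => k _; rewrite xk ltn_ord.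
  rewrite {1}xn (qn_proj on); congr (_ - _); apply: eq_bigr => k _.
    by rewrite xk ltn_ord.
  by rewrite xk (leq_trans _ mn).
pose s n := \sum_(k < n) normc_sq (c k).
have snd : nondecreasing_seq s.
  apply/nondecreasing_seqP => n; rewrite /s big_ord_recr /= lerDl.
  exact: normc_sq_ge0.
have scvg : cvgn s.
  apply: nondecreasing_is_cvgn => //; exists M => _ [n _ <-]; exact: cM.
have [l xl] : exists l, qn (x n - l) @[n --> \oo] --> (0 : R).
  apply: bC => eps eps0.
  have /cvgrPdist_le/(_ (eps / 2)) := scvg.
  case; [by rewrite divr_gt0|move=> N _ hN; exists N].
  move=> m n Nm Nn; wlog mn : m n Nm Nn / (m <= n)%N.
    move=> h; have [mn|/ltnW nm] := leqP m n; first exact: h.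
    by rewrite qnBC; exact: h.
  rewrite qnBC qx// -/(s n) -/(s m).
  have := hN m Nm; have := hN n Nn; rewrite /= !ler_norml; lra.
exists l => [//|k]; apply/eqP; rewrite -subr_eq0; apply/eqP/normc_sq_eq0.
apply: (cst_cvg0 (ip_cvg0 (e k) xl)); first exact: normc_sq_ge0.
near=> n; rewrite ipBl xk ifT; last by near: n; exact: nbhs_infty_gt.
by rewrite -normc_sqN opprB.
Unshelve. all: by end_near. Qed.

Lemma qn_resid_cvg0 x : qn (x - proj e n x) @[n --> \oo] --> (0 : R).
Proof.
have on := onb_subon eON.
have [l xl lk] := @cvg_coords (fun k => b x (e k)) _ (fun n => Bessel on n x).
have x_l : qn (x - l) = 0 by apply: eON.2 => n; rewrite ipBl lk subrr.
apply: cvg_trans xl; apply: near_eq_cvg; apply: nearW => n /=.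
rewrite -[RHS]qnBC; apply: qn_eq_null.
by rewrite opprB addrC subrKA.
Qed.

Lemma Parseval_cvg x :
  \sum_(k < n) normc_sq (b x (e k)) @[n --> \oo] --> qn x.
Proof.
have on := onb_subon eON.
have -> : (fun n => \sum_(k < n) normc_sq (b x (e k))) =
    (fun n => qn x - qn (x - proj e n x)).
  by apply/funext => n; rewrite qn_resid//; lra.
rewrite -[X in _ --> X]subr0; apply: cvgB; first exact: cvg_cst.
exact: qn_resid_cvg0.
Qed.

Lemma Parseval x :
  (\sum_(0 <= k <oo) (normc_sq (b x (e k)))%:E = (qn x)%:E)%E.
Proof.
apply/cvg_lim => //.
under eq_fun do rewrite sumEFin big_mkord.
by apply: cvg_EFin; [exact: nearW|exact: Parseval_cvg].
Qed.

(** The representing vector has the coordinates conj(phi(e_k)). They are square summable because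
    phi sends their n-th partial sum x to |x|^2, and |phi(x)|^2 <= M |x|^2. *)
Lemma Riesz (phi : H -> R[i]) (M : R) :
  (forall a x y, phi (a *: x + y) = a * phi x + phi y) ->
  (forall x, normc_sq (phi x) <= M * qn x) ->
  exists y, forall x, phi x = b x y.
Proof.
move=> phiL phiM; have on := onb_subon eON.
have phi0 : phi 0 = 0.
  have := phiM 0; rewrite qn0 mulr0 => h; apply: normc_sq_eq0; apply/eqP.
  by rewrite eq_le h normc_sq_ge0.
have phi_sum n (c : nat -> R[i]) :
    phi (\sum_(k < n) c k *: e k) = \sum_(k < n) c k * phi (e k).
  elim: n => [|n IH]; first by rewrite !big_ord0.
  by rewrite !big_ord_recr /= addrC phiL IH addrC.
have M0 : 0 <= M.
  have := phiM (e 0%N); rewrite /qn eON.1 eqxx /= mulr1.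
  exact: le_trans (normc_sq_ge0 _).
have bd n : \sum_(k < n) normc_sq (phi (e k))^* <= M.
  set s := \sum_(k < n) _; pose x := \sum_(k < n) (phi (e k))^* *: e k.
  have s0 : 0 <= s by apply: sumr_ge0 => *; exact: normc_sq_ge0.
  have px : phi x = s%:C.
    rewrite /x (phi_sum n (fun k => (phi (e k))^*)) rmorph_sum /=.
    by apply: eq_bigr => k _; rewrite normc_sqJ normc_sqE mulrC.
  have qx : qn x = s.
    have xk k : (k < n)%N -> b x (e k) = (phi (e k))^*.
      move=> kn; rewrite /x (ip_suml n (fun k => (phi (e k))^* *: e k)).
      rewrite (bigD1 (Ordinal kn))//= ipZl eON.1 eqxx mulr1.
      rewrite big1 ?addr0// => i ik; rewrite ipZl eON.1.
      by rewrite (_ : (_ == _) = false) ?mulr0//; apply/negbTE.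
    have xp : x = proj e n x.
      by rewrite {1}/x /proj; apply: eq_bigr => k _; rewrite xk.
    rewrite xp (qn_proj on); apply: eq_bigr => k _; by rewrite xk.
  have := phiM x; rewrite px qx normc_sqR expr2.
  have [->//|s_gt0] := eqVneq s 0; rewrite ler_pM2r// lt_def s_gt0//.
have [y _ yk] := @cvg_coords (fun k => (phi (e k))^*) _ bd; exists y => x.
apply/eqP; rewrite -subr_eq0; apply/eqP/normc_sq_eq0.
pose r n := x - proj e n x.
apply: (@cst_cvg0 _ (fun n => 2 * (M * qn (r n)) + 2 * (qn (r n) * qn y))).
- rewrite -[X in _ --> X](_ : 2 * (M * 0) + 2 * (0 * qn y) = 0); last by ring.
  have rc := qn_resid_cvg0 x.
  apply: cvgD; apply: cvgM; try exact: cvg_cst.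
    by apply: cvgM => //; exact: cvg_cst.
  by apply: cvgM => //; exact: cvg_cst.
- exact: normc_sq_ge0.
- apply: nearW => n.
  have -> : phi x - b x y = phi (r n) - b (r n) y.
    have pr : phi (proj e n x) = b (proj e n x) y.
      rewrite /proj (phi_sum n (fun k => b x (e k))).
      rewrite (ip_suml n (fun k => b x (e k) *: e k)).
      by apply: eq_bigr => k _; rewrite ipZl -(ipJ b y) yk conjcK.
    have xrp : x = 1 *: r n + proj e n x by rewrite scale1r subrK.
    rewrite [in LHS]xrp phiL ip_linear pr !mul1r.
    by rewrite opprD addrACA subrr addr0.
  apply: (le_trans (normc_sqD_le _ _)); rewrite normc_sqN.
  by rewrite lerD// ler_pM2l// CauchySchwarz.
Qed.

End Complete.

End SemiInner.

Arguments semi_inner {R} H.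

(** * Factorization of trace-class operators *)

Section Factorization.
Context {R : realType} {H : lmodType R[i]} (b : semi_inner H).

(** Operators are linear only up to null vectors, which no inner product can detect. *)
Definition wlinear (T : H -> H) :=
  forall a x y z, b (T (a *: x + y)) z = a * b (T x) z + b (T y) z.

Lemma wlinear_null (T : H -> H) : wlinear T -> forall a x y,
  qn b (T (a *: x + y) - (a *: T x + T y)) = 0.
Proof.
by move=> TL a x y; apply: qn_ext => z; rewrite ipBl ip_linear TL subrr.
Qed.

Lemma wlinearB (T : H -> H) : wlinear T -> forall x y z,
  b (T (x - y)) z = b (T x) z - b (T y) z.
Proof.
move=> TL x y z; have := TL (-1) y x z.
by rewrite scaleN1r addrC mulN1r addrC => ->; rewrite addrC.
Qed.

Lemma wlinear_sum (T : H -> H) : wlinear T -> forall n (c : nat -> R[i]) (u : nat -> H) z,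
  b (T (\sum_(k < n) c k *: u k)) z = \sum_(k < n) c k * b (T (u k)) z.
Proof.
move=> TL n c u z; elim: n => [|n IH].
  by rewrite !big_ord0 -[0]subr0 wlinearB// subrr.
by rewrite !big_ord_recr /= addrC TL IH addrC.
Qed.

(** Polarization: <P z, z> is real for z = x + y and for z = i x + y. *)
Lemma positive_hermitian (P : H -> H) : wlinear P ->
  (forall x, 0 <= b (P x) x) -> forall x y, (b (P x) y)^* = b (P y) x.
Proof.
move=> PL P0 x y.
have Im0 z : complex.Im (b (P z) z) = 0.
  by have := P0 z; rewrite lecE /= => /andP[/eqP].
have h1 := Im0 (1 *: x + y); rewrite PL !ipDr !ipZr in h1.
have h2 := Im0 ('i%C *: x + y); rewrite PL !ipDr !ipZr in h2.
have := Im0 x; have := Im0 y; move: h1 h2.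
case: (b (P x) x) => a1 a2; case: (b (P x) y) => c1 c2.
case: (b (P y) x) => d1 d2; case: (b (P y) y) => f1 f2 /=.
move=> h1 h2 f20 a20.
have e1 : c2 = - d2 by lra.
have e2 : c1 = d1 by lra.
by rewrite e1 e2 opprK.
Qed.

(** In this section P is the absolute value of A, and K bounds its trace. *)
Section TraceClass.
Variables (A P : H -> H) (M K : R) (e : nat -> H).
Hypotheses (bC : hilbert_complete b) (eON : onb b e).
Hypotheses (PL : wlinear P) (AL : wlinear A).
Hypothesis P_bounded : forall x, qn b (P x) <= M * qn b x.
Hypothesis P_ge0 : forall x, 0 <= b (P x) x.
Hypothesis PPA : forall x y, b (P (P x)) y = b (A x) (A y).
Hypothesis P_trace : forall n, \sum_(k < n) complex.Re (b (P (e k)) (e k)) <= K.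

(** The form <P x, y> is <P^(1/2) x, P^(1/2) y>, so that orthonormalizing for it does the work of
    the square root of P, which is never constructed. *)
Definition abs_form : semi_inner H := @SemiInner R H (fun x y => b (P x) y)
  PL (positive_hermitian PL P_ge0) P_ge0.
Local Notation bP := abs_form.

Lemma bPE x y : bP x y = b x (P y).
Proof. by rewrite -(ipJ bP) -(ipJ b). Qed.

Lemma M_ge0 : 0 <= M.
Proof.
have := P_bounded (e 0%N); rewrite [qn b (e 0%N)]/qn eON.1 eqxx /= mulr1.
exact/le_trans/qn_ge0.
Qed.

Lemma qn_abs_form_le z : qn bP z <= (M + 1) * qn b z.
Proof.
have := CauchySchwarz b (P z) z; have := P_bounded z; have := M_ge0.
have := Re_le_normc_sq (b (P z) z); rewrite -/(qn bP z).
have := qn_ge0 bP z; have := qn_ge0 b z.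
move: (qn bP z) (qn b z) (qn b (P z)) (normc_sq _) => q p r c.
move=> p0 q0 qc m0 rM cr; rewrite -(@ler_pXn2r _ 2)// ?nnegrE//; last first.
  by rewrite mulr_ge0// addr_ge0.
apply: (le_trans qc); apply: (le_trans cr).
apply: (@le_trans _ _ (M * p * p)); first by rewrite ler_wpM2r.
have -> : ((M + 1) * p) ^+ 2 = M * p * p + (M ^+ 2 + M + 1) * p ^+ 2 by ring.
by rewrite lerDl mulr_ge0 ?sqr_ge0// !addr_ge0 ?sqr_ge0.
Qed.

(** |P x|^2 is the value of the form at (x, P x): Cauchy-Schwarz for the form applies. *)
Lemma qnP_le x : qn b (P x) <= (M + 1) * qn bP x.
Proof.
have cs := CauchySchwarz bP x (P x).
have e1 : bP x (P x) = (qn b (P x))%:C by rewrite -ip_qn.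
rewrite e1 normc_sqR in cs.
have h2 := qn_abs_form_le (P x).
have := qn_ge0 bP x; have := qn_ge0 b (P x); have := M_ge0.
move: cs h2; move: (qn b (P x)) (qn bP x) (qn bP (P x)) => p q r.
move=> cs h2 m0 p0 q0.
have [->|pn0] := eqVneq p 0; first by rewrite mulr_ge0// addr_ge0.
rewrite -(@ler_pM2r _ p); last by rewrite lt_def pn0.
rewrite -expr2 (le_trans cs)// mulrAC [_ * q]mulrC mulrC; nra.
Qed.

Lemma qnPA x : qn b (A x) = qn b (P x).
Proof. by rewrite /qn -PPA; congr complex.Re; exact: (bPE (P x) x). Qed.

(** Gram-Schmidt for the form [bP]. A null residue is normalized to the zero vector, because the
    inverse of 0 is 0. *)
Fixpoint gs_seq n : seq H := if n is m.+1 then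
    let s := gs_seq m in
    let z := e m - \sum_(y <- s) bP (e m) y *: y in
    rcons s (((Num.sqrt (qn bP z))^-1)%:C *: z)
  else [::].

Definition gs n : H := nth 0 (gs_seq n.+1) n.

Lemma size_gs_seq n : size (gs_seq n) = n.
Proof. by elim: n => //= n IH; rewrite size_rcons IH. Qed.

Lemma nth_gs_seq n k : (k < n)%N -> nth 0 (gs_seq n) k = gs k.
Proof.
elim: n => // n IH; rewrite ltnS leq_eqVlt => /predU1P[->//|kn].
by rewrite /= nth_rcons size_gs_seq kn IH.
Qed.

Definition gs_res n := e n - proj bP gs n (e n).

Lemma gsE n : gs n = ((Num.sqrt (qn bP (gs_res n)))^-1)%:C *: gs_res n.
Proof.
have E : e n - \sum_(y <- gs_seq n) bP (e n) y *: y = gs_res n.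
  rewrite /gs_res; congr (_ - _); rewrite (big_nth 0) size_gs_seq big_mkord.
  by apply: eq_bigr => k _; rewrite nth_gs_seq.
by rewrite /gs /= nth_rcons size_gs_seq ltnn eqxx E.
Qed.

Lemma gs_self n : bP (gs n) (gs n) = 0 \/ bP (gs n) (gs n) = 1.
Proof.
rewrite ip_qn gsE qnZ normc_sqR exprVn sqr_sqrtr ?qn_ge0//.
have [->|q0] := eqVneq (qn bP (gs_res n)) 0; first by left; rewrite mulr0.
by right; rewrite mulVf.
Qed.

Lemma gs_subon_lt n : forall i j, (i < n)%N -> (j < n)%N ->
  bP (gs i) (gs j) = 0 \/ (i = j /\ bP (gs i) (gs j) = 1).
Proof.
elim: n => // n IH i j.
pose g k := if (k < n)%N then gs k else 0.
have gon : subon bP g.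
  move=> k l; rewrite /g; case: ifPn => [kn|_]; last by left; rewrite ip0l.
  case: ifPn => [ln|_]; last by left; rewrite ip0r.
  exact: IH.
have gsn k : (k < n)%N -> bP (gs n) (gs k) = 0.
  move=> kn; rewrite gsE ipZl.
  have -> : gs_res n = e n - proj bP g n (e n).
    by congr (_ - _); apply: eq_bigr => l _; rewrite /g ltn_ord.
  by have := proj_orth gon (e n) kn; rewrite {2}/g kn => ->; rewrite mulr0.
rewrite ltnS leq_eqVlt => /predU1P[->|i_n];
  rewrite ltnS leq_eqVlt => /predU1P[->|jn].
- by have [->|->] := gs_self n; [left|right].
- by left; exact: gsn.
- by left; rewrite -(ipJ bP) gsn// conjc0.
- exact: IH.
Qed.

Lemma gs_subon : subon bP gs.
Proof.
by move=> i j; apply: (@gs_subon_lt (i + j).+1); rewrite ltnS ?leq_addr ?leq_addl.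
Qed.

(** Replacing a null residue by zero loses nothing: e_m then already is, up to a null vector, a
    combination of the preceding vectors. *)
Lemma gs_exhausts n m : (m < n)%N -> qn bP (e m - proj bP gs n (e m)) = 0.
Proof.
move=> mn; apply/eqP; rewrite eq_le qn_ge0 andbT.
apply: (le_trans (qn_resid_le gs_subon (e m) mn)).
have -> : e m - proj bP gs m.+1 (e m) = gs_res m - bP (e m) (gs m) *: gs m.
  by rewrite /proj big_ord_recr /= opprD addrA.
have -> : bP (e m) (gs m) = bP (gs_res m) (gs m).
  rewrite [in RHS]/gs_res ipBl [X in _ - X](_ : _ = 0) ?subr0//.
  rewrite /proj (ip_suml bP m (fun k => bP (e m) (gs k) *: gs k)) big1// => k _.
  rewrite ipZl; have [->|[km _]] := gs_subon k m; first by rewrite mulr0.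
  by have := ltn_ord k; rewrite km ltnn.
rewrite gsE; set q := qn bP (gs_res m); set z := gs_res m.
have q0 : 0 <= q by exact: qn_ge0.
have [q_0|qn_0] := eqVneq q 0.
  by rewrite q_0 sqrtr0 invr0 scale0r ip0r scale0r subr0 -/q q_0.
rewrite ipZrR ip_qn -/q scalerA mulrAC -!rmorphM /= -invfM -expr2.
by rewrite sqr_sqrtr// mulVf// scale1r subrr qn0.
Qed.

(** Finite combinations of the basis [e] are eventually reproduced exactly, and they approximate
    x for the form, which the original inner product dominates. *)
Lemma gs_resid_cvg0 x : qn bP (x - proj bP gs n x) @[n --> \oo] --> (0 : R).
Proof.
pose S m := proj b e m x.
have S0 m n : (m <= n)%N -> qn bP (S m - proj bP gs n (S m)) = 0.
  move=> mn; rewrite /S {1 3}/proj; elim: m mn => [|m IH] mn.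
    by rewrite !big_ord0 -[proj _ _ _ _](_ : 0 = _) ?subr0 ?qn0// /proj big1// => k _; rewrite ip0l scale0r.
  rewrite big_ord_recr /=; set s := \sum_(k < m) _ in IH *.
  rewrite [s + _]addrC proj_linear opprD addrACA -scalerBr.
  apply: qnD_null; last by exact/IH/ltnW.
  by rewrite qnZ gs_exhausts// mulr0.
apply/cvgrPdist_le => eps eps0.
have M1 : 0 < M + 1 by have := M_ge0; lra.
have := qn_resid_cvg0 bC eON x.
move/cvgrPdist_le/(_ (eps / (2 * (M + 1)))); case.
  by rewrite divr_gt0// mulr_gt0.
move=> N _ /(_ N (leqnn N)) /=; rewrite sub0r normrN ger0_norm ?qn_ge0// => hN.
near=> n; rewrite sub0r normrN ger0_norm ?qn_ge0//.
have Nn : (N <= n)%N by near: n; exact: nbhs_infty_ge.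
have -> : x - proj bP gs n x = ((x - S N) - proj bP gs n (x - S N)) +
    (S N - proj bP gs n (S N)).
  by rewrite projB addrACA subrK -opprD subrK.
apply: (le_trans (qnD_le _ _ _)); rewrite S0// mulr0 addr0.
apply: (@le_trans _ _ (2 * qn bP (x - S N))).
  rewrite ler_pM2l//; rewrite qn_resid; last exact: gs_subon.
  by rewrite gerBl sumr_ge0// => k _; exact: normc_sq_ge0.
apply: (@le_trans _ _ (2 * ((M + 1) * qn b (x - S N)))).
  by rewrite ler_pM2l// qn_abs_form_le.
move: hN; rewrite ler_pdivlMr ?mulr_gt0//; rewrite -/(S N); lra.
Unshelve. all: by end_near. Qed.

Lemma nneseries_le_EFin (f : nat -> R) (c : R) : (forall k, 0 <= f k) ->
  (forall n, \sum_(k < n) f k <= c) -> (\sum_(0 <= k <oo) (f k)%:E <= c%:E)%E.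
Proof.
move=> f0 fc; apply: lime_le.
  by apply: is_cvg_nneseries => n _ _; rewrite lee_fin.
by apply: nearW => n; rewrite sumEFin big_mkord lee_fin.
Qed.

Definition summable_sq (u : nat -> H) :=
  (\sum_(0 <= k <oo) (qn b (u k))%:E < +oo)%E.

Definition rank_one_sum (T : H -> H) (u w : nat -> H) := forall x,
  qn b (T x - \sum_(j < n) b x (w j) *: u j) @[n --> \oo] --> (0 : R).

(** With (g_j) orthonormal for the form, x = sum_j <P x, g_j> g_j with respect to the form, so
    that A x = sum_j <x, P g_j> A g_j. Here |A g_j| = |P g_j|, and sum_j |P g_j|^2, which equals
    sum_k sum_j |<P e_k, g_j>|^2, is at most the trace sum_k <P e_k, e_k> by Bessel. *)
Lemma trace_class_factor :
  exists u w, [/\ summable_sq u, summable_sq w & rank_one_sum A u w].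
Proof.
pose w j := P (gs j); pose u j := A (gs j).
have w_sum : summable_sq w.
  apply: (@le_lt_trans _ _ K%:E); last by rewrite ltry.
  rewrite (eq_eseriesr (fun j _ => esym (Parseval bC eON (w j)))).
  rewrite nneseries_interchange; last by move=> i j; rewrite lee_fin normc_sq_ge0.
  apply: (@le_trans _ _ (\sum_(0 <= k <oo) (qn bP (e k))%:E)%E).
    apply: lee_nneseries => k _.
      by move=> _; apply: nneseries_ge0 => j _ _; rewrite lee_fin normc_sq_ge0.
    have E j : (normc_sq (b (w j) (e k)))%:E = (normc_sq (bP (e k) (gs j)))%:E.
      by rewrite -(ipJ bP) normc_sqJ.
    rewrite (eq_eseriesr (fun j _ => E j)); apply: nneseries_le_EFin => [j|n]; first exact: normc_sq_ge0.
    exact: (Bessel gs_subon).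
  by apply: nneseries_le_EFin => // k; exact: (qn_ge0 bP).
have uw j : qn b (u j) = qn b (w j) by exact: qnPA.
exists u, w; split => //.
  by rewrite /summable_sq (eq_eseriesr (fun j _ => congr1 EFin (uw j))).
move=> x.
apply: (@squeeze_cvgr _ _ _ _ (cst 0)
  (fun n => (M + 1) * qn bP (x - proj bP gs n x))); last 2 first.
- exact: cvg_cst.
- rewrite -(mulr0 (M + 1)); apply: cvgM; first exact: cvg_cst.
  exact: gs_resid_cvg0.
apply: nearW => n /=; rewrite qn_ge0 /=.
apply: le_trans (qnP_le _); rewrite -qnPA le_eqVlt; apply/orP; left; apply/eqP.
apply: qn_eq_null; apply: qn_ext => z.
rewrite !ipBl wlinearB// /proj.
rewrite (wlinear_sum AL n (fun k => bP x (gs k)) gs).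
rewrite (ip_suml b n (fun j => b x (w j) *: u j)).
apply/eqP; rewrite subr_eq0; apply/eqP; congr (_ - _).
by apply: eq_bigr => k _; rewrite ipZl bPE.
Qed.

End TraceClass.

(** * Traces of sums of rank-one operators *)

Section RankOneSums.
Variables (e : nat -> H) (bC : hilbert_complete b) (eON : onb b e).
Variables (A : H -> H) (u w : nat -> H).
Hypotheses (u_sum : summable_sq u) (w_sum : summable_sq w).
Hypothesis Auw : rank_one_sum A u w.

Lemma summable_sq_bound (v : nat -> H) : summable_sq v ->
  exists2 K, 0 <= K & forall J, \sum_(j < J) qn b (v j) <= K.
Proof.
move=> v_sum; have v0 : (0 <= \sum_(0 <= k <oo) (qn b (v k))%:E)%E.
  by apply: nneseries_ge0 => k _ _; rewrite lee_fin qn_ge0.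
exists (fine (\sum_(0 <= k <oo) (qn b (v k))%:E)); first exact: fine_ge0.
move=> J; rewrite -lee_fin fineK ?ge0_fin_numE//.
rewrite -sumEFin -(big_mkord xpredT (fun j => (qn b (v j))%:E)).
by apply: nneseries_lim_ge => k _ _; rewrite lee_fin qn_ge0.
Qed.

(** The left-hand side is at most the tail, from k = n on, of the convergent double series of
    |<u_j, e_k>|^2. *)
Lemma resid_uniform (eps : R) : 0 < eps -> exists N, forall n J, (N <= n)%N ->
  \sum_(j < J) qn b (u j - proj b e n (u j)) <= eps.
Proof.
move=> eps0.
pose c k := (\sum_(0 <= j <oo) (normc_sq (b (u j) (e k)))%:E)%E.
have c0 k : (0 <= c k)%E.
  by apply: nneseries_ge0 => j _ _; rewrite lee_fin normc_sq_ge0.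
have c_sum : (\sum_(0 <= k <oo) c k < +oo)%E.
  rewrite /c nneseries_interchange; last first.
    by move=> i j; rewrite lee_fin normc_sq_ge0.
  by rewrite (eq_eseriesr (fun j _ => Parseval bC eON (u j))).
have /fine_cvgP[_] := nneseries_tail_cvg c_sum (fun k _ => c0 k).
move/cvgrPdist_le/(_ _ eps0) => [N _ hN]; exists N => n J Nn.
have := hN n Nn; rewrite /= sub0r normrN.
have tail_fin : (\sum_(n <= k <oo) c k)%E \is a fin_num.
  rewrite ge0_fin_numE; last by apply: nneseries_ge0.
  apply: le_lt_trans c_sum; rewrite (nneseries_split 0 n) ?add0n//.
  by rewrite leeDr// sume_ge0.
rewrite ger0_norm; last by apply: fine_ge0; exact: nneseries_ge0.
apply: le_trans; rewrite -lee_fin fineK// -sumEFin.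
have E j : ((qn b (u j - proj b e n (u j)))%:E =
    \sum_(n <= k <oo) (normc_sq (b (u j) (e k)))%:E)%E.
  rewrite (qn_resid (onb_subon eON)) EFinB -(Parseval bC eON (u j)).
  rewrite (nneseries_split 0 n) ?add0n//; last first.
    by move=> k _; rewrite lee_fin normc_sq_ge0.
  by rewrite sumEFin big_mkord addeAC subee// add0e.
rewrite (eq_bigr _ (fun (j : 'I_J) _ => E j)).
rewrite -nneseries_sum; last by move=> i j _; rewrite lee_fin normc_sq_ge0.
apply: lee_nneseries => k _.
  by move=> _; apply: sume_ge0 => j _; rewrite lee_fin normc_sq_ge0.
rewrite -(big_mkord xpredT (fun j => (normc_sq (b (u j) (e k)))%:E)).
by apply: nneseries_lim_ge => j _ _; rewrite lee_fin normc_sq_ge0.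
Qed.

Lemma rank_one_sum_ip x y :
  cvg0c (fun n => b (A x) y - \sum_(j < n) b x (w j) * b (u j) y).
Proof.
have h := @ip_cvg0 _ _ b _ y (Auw x).
apply: cvg0c_eq h => n.
rewrite ipBl (ip_suml b n (fun j => b x (w j) *: u j)).
by congr (normc_sq (_ - _)); apply: eq_bigr => j _; rewrite ipZl.
Qed.

(** The n-th partial trace in the basis [e] is sum_j <U E_n u_j, w_j>, where E_n projects onto the
    first n basis vectors. Cauchy-Schwarz over j and [resid_uniform] compare it with
    sum_j <U u_j, w_j>, which is why the limit does not depend on the basis. *)
Lemma trace_cvg (U : H -> H) t : wlinear U ->
  (forall x, qn b (U x) <= qn b x) ->
  cvg0c (fun n => t - \sum_(j < n) b (U (u j)) (w j)) ->
  cvg0c (fun n => t - \sum_(k < n) b (A (U (e k))) (e k)).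
Proof.
move=> UL U1 tU; have [K K0 wK] := summable_sq_bound w_sum.
apply/cvgrPdist_le => eps eps0.
(* K + 1 only keeps the denominator positive; the factor 2 is lost in [cvg0c_bound]. *)
have [|N hN] := @resid_uniform (eps / (2 * (K + 1))).
  by rewrite divr_gt0// mulr_gt0// ltr_wpDl.
exists N => // n /= Nn; rewrite sub0r normrN ger0_norm ?normc_sq_ge0//.
pose z J := \sum_(j < J) b (U (u j - proj b e n (u j))) (w j).
have zK J : normc_sq (z J) <= eps / 2.
  apply: (@le_trans _ _ (eps / (2 * (K + 1)) * K)).
    apply: le_trans (ler_pM _ _ (hN n J Nn) (wK J)); last 2 first.
    - by apply: sumr_ge0 => *; exact: qn_ge0.
    - by apply: sumr_ge0 => *; exact: qn_ge0.
    apply: (@CauchySchwarz_sum _ (fun j => b (U (u j - proj b e n (u j))) (w j))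
      (fun j => qn b (u j - proj b e n (u j))) (fun j => qn b (w j))) => [k|k|k].
    - exact: qn_ge0.
    - exact: qn_ge0.
    - by apply: (le_trans (CauchySchwarz _ _ _)); rewrite ler_wpM2r// qn_ge0.
  have K1 : 0 < K + 1 by lra.
  rewrite invfM mulrA -mulrA ler_piMr//; first by rewrite divr_ge0// ltW.
  by rewrite mulrC ler_pdivrMr// mul1r lerDl.
rewrite (_ : eps = 2 * (eps / 2)); last by field.
apply: (cvg0c_bound _ _ zK); first by rewrite divr_ge0// ltW.
pose Aj k J := b (A (U (e k))) (e k) - \sum_(j < J) b (U (e k)) (w j) * b (u j) (e k).
have h : cvg0c (fun J => \sum_(k < n) - Aj k J).
  apply: (@cvg0c_sum _ n (fun k J => - Aj k J)) => k.
  rewrite /cvg0c; under eq_fun do rewrite normc_sqN.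
  exact: rank_one_sum_ip.
have := cvg0cD tU h; apply: cvg0c_eq => J; congr normc_sq.
rewrite /z /Aj sumrN sumrB exchange_big /= opprB.
have -> : \sum_(j < J) \sum_(i < n) b (U (e i)) (w j) * b (u j) (e i) =
    \sum_(j < J) b (U (proj b e n (u j))) (w j).
  apply: eq_bigr => j _.
  rewrite /proj (wlinear_sum UL n (fun k => b (u j) (e k)) e).
  by apply: eq_bigr => k _; rewrite mulrC.
have -> : \sum_(j < J) b (U (u j - proj b e n (u j))) (w j) =
    \sum_(j < J) b (U (u j)) (w j) -
    \sum_(j < J) b (U (proj b e n (u j))) (w j).
  by rewrite -sumrB; apply: eq_bigr => j _; rewrite wlinearB.
by ring.
Qed.

(** The trace of X A X is sum_j sum_n <X e_n, w_j> <u_j, X e_n>, which Bessel bounds by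
    sum_j (|X w_j|^2 + |X u_j|^2), uniformly in the contraction X. *)
Lemma compressed_trace_bounded : exists K, forall X : H -> H,
  (forall x y, b (X x) y = b x (X y)) -> (forall x, qn b (X x) <= qn b x) ->
  forall m, \sum_(n < m) complex.Re (b (A (X (e n))) (X (e n))) <= K.
Proof.
have [Ku Ku0 uK] := summable_sq_bound u_sum.
have [Kw Kw0 wK] := summable_sq_bound w_sum.
exists (Kw + Ku) => X Xsa X1 m; rewrite -Re_sum.
pose z J := \sum_(n < m) \sum_(j < J) b (X (e n)) (w j) * b (u j) (X (e n)).
apply: (@cvg0c_Re_le _ z).
  rewrite /z; under [X in cvg0c X]eq_fun do rewrite -sumrB.
  apply: (@cvg0c_sum _ m (fun k J => b (A (X (e k))) (X (e k)) -
    \sum_(j < J) b (X (e k)) (w j) * b (u j) (X (e k)))) => k.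
  exact: rank_one_sum_ip.
move=> J; rewrite /z exchange_big /= Re_sum.
apply: (@le_trans _ _ (\sum_(j < J) (qn b (w j) + qn b (u j)))); last first.
  by have := wK J; have := uK J; rewrite big_split /=; lra.
apply: ler_sum => j _; rewrite Re_sum.
apply: (@le_trans _ _ (\sum_(n < m) (normc_sq (b (X (w j)) (e n)) +
                                     normc_sq (b (X (u j)) (e n))))).
  apply: ler_sum => n _; apply: (le_trans (ReM_le _ _)).
  by rewrite Xsa -(ipJ b) normc_sqJ -Xsa.
rewrite big_split /=; have on := onb_subon eON.
by apply: lerD; [apply: le_trans (X1 (w j))|apply: le_trans (X1 (u j))];
  exact: Bessel.
Qed.

End RankOneSums.
End Factorization.

(** * Substitution and Fubini for Lebesgue integrals *)

Section IntegralTools.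
Context {R : realType}.
Local Notation leb := (@lebesgue_measure R).
Local Notation RT := (measurableTypeR R).
Local Notation L1 f := (leb.-integrable setT (EFin \o f)).

Lemma measurable_affine (a c : R) :
  measurable_fun setT (fun x : measurableTypeR R => a * x + c : measurableTypeR R).
Proof.
by apply: measurable_funD => //; exact: measurable_funM.
Qed.

Lemma ge0_integral_affine (f : R -> \bar R) (a c : R) : 0 < a ->
  measurable_fun [set: RT] f -> (forall x, 0 <= f x)%E ->
  (a%:E * \int[leb]_x f (a * x + c)%R = \int[leb]_x f x)%E.
Proof.
move=> a0 mf f0; pose phi := fun x : measurableTypeR R => a * x + c : measurableTypeR R.
have mphi : measurable_fun setT phi by exact: measurable_affine.
have E1 := ge0_integral_pushforward mphi leb measurableT mf (fun y _ => f0 y).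
rewrite preimage_setT in E1.
rewrite -[X in (_ * X)%E]/(\int[leb]_x (f \o phi) x)%E -E1.
have E2 := @ge0_integral_mscale _ _ _ (pushforward leb phi) _ measurableT
  (NngNum (ltW a0)) _ mf (fun x _ => f0 x).
rewrite -[a%:E]/((NngNum (ltW a0))%:num%:E) -E2.
apply: eq_measure_integral => A mA _.
apply/esym/lebesgue_measure_unique => //= _ [[p q]] _ <-.
rewrite /mscale /=.
rewrite [pushforward _ _ _](_ : _ = leb `](p - c) / a, (q - c) / a]%classic); last first.
  rewrite /pushforward; congr (leb _); apply/seteqP; split => x /=; rewrite !in_itv /= /phi ltr_pdivrMr// ler_pdivlMr//
    ltrBlDr lerBrDr [x * a]mulrC//.
rewrite !lebesgue_measure_itv /= !lte_fin ltr_pM2r ?invr_gt0// ltrD2r.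
case: ifPn => pq; last by rewrite mule0.
by rewrite -!EFinB -EFinM; congr EFin; field; rewrite gt_eqF.
Qed.

Lemma ge0_integral_reflect (f : R -> \bar R) :
  measurable_fun [set: RT] f -> (forall x, 0 <= f x)%E ->
  (\int[leb]_x f (- x)%R = \int[leb]_x f x)%E.
Proof.
move=> mf f0.
have := @ge0_integral_pushforward _ _ _ _ _ (-%R : measurableTypeR R -> measurableTypeR R)
   _ leb setT f.
rewrite preimage_setT => <-//.
by apply: eq_measure_integral => //= A mA AS; exact: lebesgue_measureN.
Qed.

Section Param.
Context d (T : measurableType d) d' (T' : measurableType d').
Variable m : {sigma_finite_measure set T' -> \bar R}.

Lemma measurable_Rintegral (G : T * T' -> R) : measurable_fun setT G ->
  measurable_fun setT (fun x => \int[m]_y G (x, y))%R.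
Proof.
move=> mG; apply: measurableT_comp => //.
pose g := EFin \o G; have mg : measurable_fun setT g by exact/measurable_EFinP.
rewrite (_ : (fun x => _) =
    (fun x => \int[m]_y g^\+ (x, y) - \int[m]_y g^\- (x, y))%E); last first.
  apply/funext => x; rewrite [LHS]integralE.
  by congr (_ - _)%E; apply: eq_integral => y _; rewrite ?funeposE ?funenegE.
apply: emeasurable_funB.
  by apply: (measurable_fun_fubini_tonelli_F (fun p => g^\+ p)%E) => //; exact: measurable_funepos.
by apply: (measurable_fun_fubini_tonelli_F (fun p => g^\- p)%E) => //; exact: measurable_funeneg.
Qed.

End Param.

Lemma L1_measurable (u : R -> R) : L1 u -> measurable_fun [set: RT] u.
Proof. by case/integrableP => /measurable_EFinP. Qed.

Lemma L1_bounded_mul (u K : R -> R) (M : R) : L1 u -> measurable_fun [set: RT] K ->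
  (forall x, `|K x| <= M) -> L1 (fun x => u x * K x).
Proof.
move=> iu mK KM.
apply: (@le_integrable _ _ _ leb _ _ _ (fun x => M%:E * (u x)%:E)%E) => //.
- apply/measurable_EFinP; apply: measurable_funM => //.
  exact: L1_measurable.
- move=> x _ /=; rewrite lee_fin !normrM mulrC ler_wpM2r//.
  by rewrite (le_trans (KM x))// ler_norm.
- exact: integrableZl.
Qed.

Lemma L1_norm (u : R -> R) : L1 u -> L1 (fun x => `|u x|).
Proof. exact: integrable_norm. Qed.

Lemma EFin_Rintegral (u : R -> R) : L1 u ->
  (\int[leb]_x u x)%R%:E = (\int[leb]_x (u x)%:E)%E.
Proof. by move=> iu; rewrite /Rintegral fineK//; exact: integrable_fin_num. Qed.

Lemma L1_Rintegral_bound (w u : R -> R) (K : R * R -> R) (M : R) :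
  L1 w -> L1 u -> measurable_fun [set: RT * RT] K -> (forall p, `|K p| <= M) ->
  (leb \x leb)%E.-integrable setT (fun p => (w p.1 * (u p.2 * K p))%:E).
Proof.
move=> iw iu mK KM.
have mw : measurable_fun [set: RT] w by exact: L1_measurable.
have mu : measurable_fun [set: RT] u by exact: L1_measurable.
have mF : measurable_fun [set: RT * RT] (fun p => (w p.1 * (u p.2 * K p))%:E).
  apply/measurable_EFinP; apply: measurable_funM; first exact: measurableT_comp.
  by apply: measurable_funM => //; exact: measurableT_comp.
apply: (iffRL (@integrable12ltyP _ _ _ _ _ leb leb _ mF)).
have M0 : 0 <= M by rewrite (le_trans _ (KM (0, 0))).
have ifin : (\int[leb]_y `|(u y)%:E| < +oo)%E by case/integrableP : iu.
have I0 : (0 <= \int[leb]_y `|(u y)%:E|)%E by exact: integral_ge0.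
pose I := fine (\int[leb]_y `|(u y)%:E|)%E.
have IE : (\int[leb]_y `|(u y)%:E| = I%:E)%E by rewrite fineK// ge0_fin_numE.
apply: (@le_lt_trans _ _ (\int[leb]_x ((M * I)%:E * `|(w x)%:E|))%E).
  apply: ge0_le_integral => //.
  - by move=> x _; exact: integral_ge0.
  - apply: (@measurable_fun_fubini_tonelli_F _ _ RT RT R leb (fun p => `|(w p.1 * (u p.2 * K p))%:E|)%E) => //.
    exact: measurableT_comp.
  - by apply: measurable_funeM; apply: measurableT_comp => //; exact/measurable_EFinP.
  - move=> x _; rewrite EFinM -IE muleAC [X in (X * _)%E]muleC.
    have mau : measurable_fun [set: RT] (fun y => `|(u y)%:E|%E).
      by apply: measurableT_comp => //; exact/measurable_EFinP.
    have wM0 : (0 <= `|(w x)%:E| * M%:E)%E by rewrite mule_ge0.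
    rewrite -ge0_integralZl//; apply: ge0_le_integral => //.
    + apply: measurableT_comp => //; apply/measurable_EFinP; apply: measurable_funM => /=; first exact: measurable_cst.
      by apply: measurable_funM => //; exact: measurableT_comp mK (measurable_pair1 _).
    + by apply: measurable_funeM; apply: measurableT_comp => //; exact/measurable_EFinP.
    + move=> y _; rewrite -EFinM lee_fin !normrM -mulrA ler_wpM2l//.
      by rewrite mulrC ler_wpM2r.
rewrite ge0_integralZl//; last 2 first.
- by apply: measurableT_comp => //; exact/measurable_EFinP.
- by rewrite lee_fin mulr_ge0// fine_ge0.
by rewrite lte_mul_pinfty// ?lee_fin ?mulr_ge0 ?fine_ge0//; case/integrableP : iw.
Qed.

Lemma Fubini_bounded_kernel (w u : R -> R) (K : R * R -> R) (M : R) :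
  L1 w -> L1 u -> measurable_fun [set: RT * RT] K -> (forall p, `|K p| <= M) ->
  (\int[leb]_x (w x * \int[leb]_y (u y * K (x, y))) =
   \int[leb]_y (u y * \int[leb]_x (w x * K (x, y))))%R.
Proof.
move=> iw iu mK KM; have iF := L1_Rintegral_bound iw iu mK KM.
have := Fubini iF => /(congr1 fine) /= E.
have K1 x : measurable_fun [set: RT] (fun y => K (x, y)).
  by apply: measurableT_comp mK _; exact: measurable_pair1.
have K2 y : measurable_fun [set: RT] (fun x => K (x, y)).
  by apply: measurableT_comp mK _; exact: measurable_pair2.
have i1 x : L1 (fun y => u y * K (x, y)) by exact: L1_bounded_mul (K1 x) _.
have i2 y : L1 (fun x => w x * K (x, y)) by exact: L1_bounded_mul (K2 y) _.
transitivity (fine (\int[leb]_x \int[leb]_y (w x * (u y * K (x, y)))%:E)%E).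
  congr fine; apply: eq_integral => x _; rewrite EFinM EFin_Rintegral//.
  by rewrite -integralZl//; exact: i1.
rewrite E; congr fine; apply: eq_integral => y _; rewrite EFinM EFin_Rintegral//.
rewrite -integralZl//; last exact: i2.
by apply: eq_integral => x _; rewrite -EFinM mulrCA.
Qed.

(** * The Poisson kernel *)

(** The factor that makes the integral of a squared Fourier transform converge, so that Fubini
    applies; it is removed by monotone convergence. Only a half-line is used, and all masses below
    are therefore 1/2 instead of 1. *)
Definition laplace_weight (e : R) : R -> R :=
  (fun x : R => expR (- (e * x))) \_ `[0, +oo[.

(** The cosine transform of [laplace_weight e] at 2 pi y. *)
Definition poisson (e y : R) : R := e / (e ^+ 2 + (2 * pi * y) ^+ 2).

Lemma cvg_expRN_mul (e : R) : 0 < e -> expR (- (e * x)) @[x --> +oo] --> 0.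
Proof.
move=> e0; apply: (cvg_comp (fun x => e * x) (fun x => expR (- x))); last exact: cvgr_expR.
exact: gt0_cvgMry.
Qed.

Lemma ge0_FTC2y (f F : R -> R) (a l : R) : (forall x, a <= x -> 0 <= f x) ->
  continuous f -> (forall x : R, is_derive x 1 F (f x)) -> F x @[x --> +oo] --> l ->
  (\int[leb]_(x in `[a, +oo[) (f x)%:E = l%:E - (F a)%:E)%E.
Proof.
move=> f0 cf dF Fl.
have dF1 x : derivable F x 1 by case: (dF x).
apply: ge0_continuous_FTC2y => //.
- exact: continuous_subspaceT.
- apply: cvg_at_right_filter.
  by have /derivable1_diffP/differentiable_continuous := dF1 a.
- by move=> x _; rewrite derive1E derive_val.
Qed.

Lemma integral_exp (e : R) : 0 < e ->
  (\int[leb]_(x in `[0%R, +oo[) (expR (- (e * x)))%:E = (e^-1)%:E)%E.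
Proof.
move=> e0; pose F x := - (expR (- (e * x)) * e^-1).
have dF (x : R) : is_derive x 1 F (expR (- (e * x))).
  rewrite /F; apply: is_derive_eq.
  by rewrite /GRing.scale /=; field; rewrite gt_eqF.
rewrite (ge0_FTC2y (l := 0) _ _ dF).
- by rewrite /F mulr0 oppr0 expR0 sub0e -EFinN opprK mul1r.
- by move=> x _; exact: expR_ge0.
- move=> x; apply: continuous_comp; last exact: continuous_expR.
  by apply: continuousN; apply: mulrl_continuous.
- rewrite /F -oppr0; apply: cvgN; rewrite -(mul0r e^-1).
  by apply: cvgM; [exact: cvg_expRN_mul|exact: cvg_cst].
Qed.

(** The summand 1 keeps the integrand nonnegative, as the fundamental theorem of calculus on a
    half-line requires. *)
Lemma integral_exp_cos (e c : R) : 0 < e ->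
  (\int[leb]_(x in `[0%R, +oo[) (expR (- (e * x)) * (1 + cos (c * x)))%:E =
   (e^-1 + e / (e ^+ 2 + c ^+ 2))%:E)%E.
Proof.
move=> e0; have e2 : e ^+ 2 + c ^+ 2 != 0.
  by rewrite gt_eqF// ltr_wpDr ?sqr_ge0// exprn_gt0.
pose k := (e ^+ 2 + c ^+ 2)^-1.
pose F x := expR (- (e * x)) * (- e^-1 + (c * sin (c * x) - e * cos (c * x)) * k).
have dF (x : R) : is_derive x 1 F (expR (- (e * x)) * (1 + cos (c * x))).
  rewrite /F; apply: is_derive_eq.
  by rewrite /GRing.scale /= /k; field; rewrite e2 gt_eqF.
rewrite (ge0_FTC2y (l := 0) _ _ dF).
- rewrite /F !mulr0 oppr0 expR0 sin0 cos0 sub0e -EFinN; congr EFin.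
  by rewrite /k; field; rewrite e2 gt_eqF.
- by move=> x _; rewrite mulr_ge0 ?expR_ge0// -lerBlDl sub0r cos_geN1.
- move=> x; apply: cvgM.
    apply: continuous_comp; last exact: continuous_expR.
    by apply: continuousN; apply: mulrl_continuous.
  apply: cvgD; first exact: cvg_cst.
  by apply: continuous_comp; [exact: mulrl_continuous|exact: continuous_cos].
- pose B := e^-1 + (`|c| + e) * k.
  apply: norm_cvg0.
  apply: (@squeeze_cvgr _ _ _ _ (cst 0) (fun x => expR (- (e * x)) * B)).
  + apply: nearW => x /=; rewrite normr_ge0 /= /F normrM (ger0_norm (expR_ge0 _)).
    rewrite ler_wpM2l ?expR_ge0// (le_trans (ler_normD _ _))// normrN.
    rewrite /B ger0_norm ?invr_ge0 ?(ltW e0)// lerD2l normrM (ger0_norm (x := k)); last first.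
      by rewrite invr_ge0 addr_ge0// sqr_ge0.
    rewrite ler_wpM2r ?invr_ge0 ?addr_ge0 ?sqr_ge0//.
    rewrite (le_trans (ler_normB _ _))// !normrM (gtr0_norm e0) lerD//.
      by rewrite ler_piMr// ler_norml sin_geN1 sin_le1.
    by rewrite ler_piMr ?(ltW e0)// ler_norml cos_geN1 cos_le1.
  + exact: cvg_cst.
  + rewrite -(mul0r B); apply: cvgM; [exact: cvg_expRN_mul|exact: cvg_cst].
Qed.

Lemma measurable_expRN (e : R) : measurable_fun [set: RT] (fun x => expR (- (e * x))).
Proof.
apply: measurableT_comp; first exact: measurable_expR.
by apply: measurable_funN; exact: measurable_funM.
Qed.

Lemma laplace_weightE e x : laplace_weight e x = if 0 <= x then expR (- (e * x)) else 0.
Proof. by rewrite /laplace_weight patchE mem_setE in_itv /= andbT. Qed.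

Lemma laplace_weight_ge0 e x : 0 <= laplace_weight e x.
Proof. by rewrite laplace_weightE; case: ifP => // _; exact: expR_ge0. Qed.

Lemma laplace_weight_L1 e : 0 < e -> L1 (laplace_weight e).
Proof.
move=> e0; have h : leb.-integrable `[0%R, +oo[ (EFin \o (fun x => expR (- (e * x)))).
  apply/integrableP; split.
    by apply/measurable_EFinP/measurable_funTS; exact: measurable_expRN.
  under eq_integral do rewrite /= ger0_norm ?expR_ge0//.
  by rewrite integral_exp// ltry.
by have := (integrable_mkcond _ _).1 h; rewrite restrict_EFin; apply.
Qed.

Lemma integral_laplace_weight e (h : R -> R) :
  (\int[leb]_x (laplace_weight e x * h x)%:E =
   \int[leb]_(x in `[0%R, +oo[) (expR (- (e * x)) * h x)%:E)%E.
Proof.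
rewrite [RHS]integral_mkcond; apply: eq_integral => x _.
rewrite patchE laplace_weightE mem_setE in_itv /= andbT.
by case: ifP => //; rewrite mul0r.
Qed.

Lemma measurable_cosM (c : R) : measurable_fun [set: RT] (fun x => cos (c * x)).
Proof.
apply: (@measurableT_comp _ _ _ _ _ _ (@cos R)).
  by apply: continuous_measurable_fun; exact: continuous_cos.
exact: measurable_funM.
Qed.

Lemma laplace_cos e c : 0 < e ->
  (\int[leb]_x (laplace_weight e x * cos (c * x)) = e / (e ^+ 2 + c ^+ 2))%R.
Proof.
move=> e0; have iw := laplace_weight_L1 e0.
have i1 : L1 (fun x => laplace_weight e x * (1 + cos (c * x))).
  apply: (@L1_bounded_mul _ _ 2) => //.
    by apply: measurable_funD => //; exact: measurable_cosM.
  move=> x; rewrite (le_trans (ler_normD _ _))// normr1 -[2]/(1 + 1) lerD2l.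
  by rewrite ler_norml cos_geN1 cos_le1.
have -> : (fun x => laplace_weight e x * cos (c * x)) =
    (fun x => laplace_weight e x * (1 + cos (c * x)) - laplace_weight e x).
  by apply/funext => x; ring.
rewrite RintegralB// /Rintegral integral_laplace_weight integral_exp_cos//=.
have -> : (\int[leb]_x (laplace_weight e x)%:E = (e^-1)%:E)%E.
  rewrite -integral_exp// [RHS]integral_mkcond; apply: eq_integral => x _.
  by rewrite patchE laplace_weightE mem_setE in_itv /= andbT; case: ifP.
by rewrite /= addrAC subrr add0r.
Qed.

Lemma poisson_ge0 (e y : R) : 0 <= e -> 0 <= poisson e y.
Proof. by move=> e0; rewrite divr_ge0// addr_ge0// sqr_ge0. Qed.

Lemma poisson_den (e y : R) : 0 < e -> 0 < e ^+ 2 + (2 * pi * y) ^+ 2.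
Proof. by move=> e0; rewrite ltr_wpDr ?sqr_ge0// exprn_gt0. Qed.

Lemma poisson_le (e y : R) : 0 < e -> poisson e y <= e^-1.
Proof.
move=> e0; rewrite /poisson ler_pdivrMr ?poisson_den//.
rewrite mulrDr expr2 mulrA mulVf ?gt_eqF// mul1r lerDl.
by rewrite mulr_ge0 ?sqr_ge0// invr_ge0 ltW.
Qed.

Lemma poissonN e y : poisson e (- y) = poisson e y.
Proof. by rewrite /poisson mulrN sqrrN. Qed.

Lemma continuous_poisson e : 0 < e -> continuous (poisson e).
Proof.
move=> e0 x; apply: cvgM; first exact: cvg_cst.
apply: cvgV; first by rewrite gt_eqF// poisson_den.
apply: cvgD; first exact: cvg_cst.
apply: (cvg_comp (fun y => 2 * pi * y) (fun z => z ^+ 2)).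
  exact: mulrl_continuous.
exact: exprn_continuous.
Qed.

Lemma measurable_poisson e : 0 < e -> measurable_fun [set: RT] (poisson e).
Proof. by move=> e0; apply: continuous_measurable_fun; exact: continuous_poisson. Qed.

Lemma integral_poisson0 e : 0 < e -> (\int[leb]_y (poisson e y)%:E = (2^-1)%:E)%E.
Proof.
move=> e0; rewrite ge0_symfun_integralT; last 3 first.
- by move=> x; exact: poisson_ge0 (ltW e0).
- exact: continuous_poisson.
- by move=> x /=; rewrite poissonN.
rewrite (_ : [set x | _] = `[0%R, +oo[%classic); last first.
  by apply/seteqP; split => x/=; rewrite in_itv/= andbT.
have pi0 : 0 < pi :> R by exact: pi_gt0.
pose F y := (2 * pi)^-1 * atan (2 * pi / e * y).
have dF (y : R) : is_derive y 1 F (poisson e y).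
  rewrite /F; apply: is_derive_eq.
  have h1 := poisson_den y e0.
  have h2 : 1 + (2 * pi / e * y) ^+ 2 != 0 by rewrite gt_eqF// ltr_wpDr ?sqr_ge0.
  rewrite /GRing.scale /= /poisson; move: (pi : R) pi0 h1 h2 => p p0 h1 h2.
  by field; rewrite (gt_eqF h1) (gt_eqF e0) (gt_eqF p0).
rewrite (ge0_FTC2y (l := 4^-1) _ _ dF).
- by rewrite /F mulr0 atan0 mulr0 sube0 -EFinM; congr EFin; field.
- by move=> x _; exact: poisson_ge0 (ltW e0).
- exact: continuous_poisson.
- rewrite (_ : 4^-1 = (2 * pi)^-1 * (pi / 2)); last by move: (pi : R) pi0 => p p0; field; rewrite (gt_eqF p0).
  apply: cvgM; first exact: cvg_cst.
  apply: (cvg_comp (fun y => 2 * pi / e * y) (@atan R)); last exact: cvgy_atan.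
  by apply: gt0_cvgMry => //; rewrite divr_gt0// mulr_gt0.
Qed.

Lemma integral_poisson e s : 0 < e ->
  (\int[leb]_t (poisson e (s - t))%:E = (2^-1)%:E)%E.
Proof.
move=> e0; rewrite -(integral_poisson0 e0).
have mp : measurable_fun [set: RT] (fun t => (poisson e t)%:E).
  by apply/measurable_EFinP; exact: measurable_poisson.
rewrite -[RHS](@ge0_integral_affine _ 1 (- s))//; last first.
  by move=> x; rewrite lee_fin poisson_ge0// ltW.
rewrite mul1e; apply: eq_integral => t _.
by rewrite mul1r -poissonN opprB.
Qed.

(** * Cosine and sine transforms *)

Definition cos_tr (u : R -> R) (x : R) : R := (\int[leb]_s (u s * cos (2 * pi * x * s)))%R.
Definition sin_tr (u : R -> R) (x : R) : R := (\int[leb]_s (u s * sin (2 * pi * x * s)))%R.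
(** The real part of u^(x) conj(v^(x)), where u^ = [cos_tr u] + i [sin_tr u] is the Fourier
    transform of a real function. *)
Definition pairing u v x := cos_tr u x * cos_tr v x + sin_tr u x * sin_tr v x.

Lemma measurable_sinM (c : R) : measurable_fun [set: RT] (fun x => sin (c * x)).
Proof.
apply: (@measurableT_comp _ _ _ _ _ _ (@sin R)).
  by apply: continuous_measurable_fun; exact: continuous_sin.
exact: measurable_funM.
Qed.

Lemma cos_norm1 (x : R) : `|cos x| <= 1.
Proof. by rewrite ler_norml cos_geN1 cos_le1. Qed.

Lemma sin_norm1 (x : R) : `|sin x| <= 1.
Proof. by rewrite ler_norml sin_geN1 sin_le1. Qed.

Lemma L1_cos u c : L1 u -> L1 (fun s => u s * cos (c * s)).
Proof.
move=> iu; apply: (@L1_bounded_mul _ _ 1) => //; first exact: measurable_cosM.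
by move=> x; exact: cos_norm1.
Qed.

Lemma L1_sin u c : L1 u -> L1 (fun s => u s * sin (c * s)).
Proof.
move=> iu; apply: (@L1_bounded_mul _ _ 1) => //; first exact: measurable_sinM.
by move=> x; exact: sin_norm1.
Qed.

Lemma Rintegral_norm_le (u v : R -> R) : L1 u -> L1 v -> (forall x, `|u x| <= v x) ->
  `|\int[leb]_x u x|%R <= (\int[leb]_x v x)%R.
Proof.
move=> iu iv uv; apply: (le_trans (le_normr_Rintegral _ iu)) => //.
by apply: le_Rintegral => //; exact: integrable_norm.
Qed.

Lemma measurable_phase : measurable_fun [set: RT * RT] (fun p => 2 * pi * p.1 * p.2 : R).
Proof.
by apply: measurable_funM => //; apply: measurable_funM.
Qed.

Lemma measurable_cos_tr u : L1 u -> measurable_fun [set: RT] (cos_tr u).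
Proof.
move=> iu; apply: (@measurable_Rintegral _ RT _ RT leb
  (fun p => u p.2 * cos (2 * pi * p.1 * p.2))).
apply: measurable_funM; first exact: measurableT_comp (L1_measurable iu) measurable_snd.
apply: measurableT_comp measurable_phase.
by apply: continuous_measurable_fun; exact: continuous_cos.
Qed.

Lemma measurable_sin_tr u : L1 u -> measurable_fun [set: RT] (sin_tr u).
Proof.
move=> iu; apply: (@measurable_Rintegral _ RT _ RT leb
  (fun p => u p.2 * sin (2 * pi * p.1 * p.2))).
apply: measurable_funM; first exact: measurableT_comp (L1_measurable iu) measurable_snd.
apply: measurableT_comp measurable_phase.
by apply: continuous_measurable_fun; exact: continuous_sin.
Qed.

Definition norm1 (u : R -> R) : R := (\int[leb]_x `|u x|)%R.

Lemma cos_tr_le u x : L1 u -> `|cos_tr u x| <= norm1 u.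
Proof.
move=> iu; apply: Rintegral_norm_le; [exact: L1_cos|exact: L1_norm|].
by move=> s; rewrite normrM ler_piMr// cos_norm1.
Qed.

Lemma sin_tr_le u x : L1 u -> `|sin_tr u x| <= norm1 u.
Proof.
move=> iu; apply: Rintegral_norm_le; [exact: L1_sin|exact: L1_norm|].
by move=> s; rewrite normrM ler_piMr// sin_norm1.
Qed.

Lemma measurable_pairing u v : L1 u -> L1 v -> measurable_fun [set: RT] (pairing u v).
Proof.
by move=> iu iv; apply: measurable_funD; apply: measurable_funM;
  [exact: measurable_cos_tr..|exact: measurable_sin_tr|exact: measurable_sin_tr].
Qed.

Lemma pairing_le u v x : L1 u -> L1 v -> `|pairing u v x| <= 2 * (norm1 u * norm1 v).
Proof.
move=> iu iv; rewrite (le_trans (ler_normD _ _))// !normrM mulrDl mul1r.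
by rewrite lerD// ler_pM// ?cos_tr_le ?sin_tr_le.
Qed.

Lemma L1_weight_pairing e u v : 0 < e -> L1 u -> L1 v ->
  L1 (fun x => laplace_weight e x * pairing u v x).
Proof.
move=> e0 iu iv; apply: L1_bounded_mul (fun x => pairing_le x iu iv) => //.
  exact: laplace_weight_L1.
exact: measurable_pairing.
Qed.

Lemma shifted_cos_tr v x s : L1 v ->
  cos (2 * pi * x * s) * cos_tr v x + sin (2 * pi * x * s) * sin_tr v x =
  (\int[leb]_t (v t * cos (2 * pi * (s - t) * x)))%R.
Proof.
move=> iv; rewrite /cos_tr /sin_tr -!RintegralZl ?L1_cos ?L1_sin//.
rewrite -RintegralD//; last 2 first.
- by have := integrableZl measurableT (cos (2 * pi * x * s)) (L1_cos (2 * pi * x) iv).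
- by have := integrableZl measurableT (sin (2 * pi * x * s)) (L1_sin (2 * pi * x) iv).
apply: eq_Rintegral => t _.
have -> : 2 * pi * (s - t) * x = 2 * pi * x * s - 2 * pi * x * t.
  by move: (pi : R) => p; ring.
by rewrite cosB; move: (cos _) (sin _) (cos _) (sin _) => *; ring.
Qed.

(** Fubini, first for the integral that defines the transform of u and then for that of v: the
    weight turns cos(2 pi (s - t) x) into the Poisson kernel. *)
Lemma pairing_poisson e u v : 0 < e -> L1 u -> L1 v ->
  (\int[leb]_x (laplace_weight e x * pairing u v x) =
   \int[leb]_s (u s * \int[leb]_t (v t * poisson e (s - t))))%R.
Proof.
move=> e0 iu iv.
pose K (p : R * R) := cos (2 * pi * p.1 * p.2) * cos_tr v p.1 +
                      sin (2 * pi * p.1 * p.2) * sin_tr v p.1.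
have mK : measurable_fun [set: RT * RT] K.
  apply: measurable_funD; apply: measurable_funM.
  - apply: measurableT_comp measurable_phase.
    by apply: continuous_measurable_fun; exact: continuous_cos.
  - exact: measurableT_comp (measurable_cos_tr iv) measurable_fst.
  - apply: measurableT_comp measurable_phase.
    by apply: continuous_measurable_fun; exact: continuous_sin.
  - exact: measurableT_comp (measurable_sin_tr iv) measurable_fst.
have KM p : `|K p| <= 2 * norm1 v.
  rewrite (_ : 2 * norm1 v = norm1 v + norm1 v); last by ring.
  rewrite (le_trans (ler_normD _ _))// !normrM lerD//.
    by rewrite -[leRHS]mul1r ler_pM// ?cos_norm1 ?cos_tr_le.
  by rewrite -[leRHS]mul1r ler_pM// ?sin_norm1 ?sin_tr_le.
transitivity (\int[leb]_x (laplace_weight e x * \int[leb]_s (u s * K (x, s))))%R.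
  apply: eq_Rintegral => x _; congr (_ * _).
  rewrite /pairing {1}/cos_tr {1}/sin_tr -!RintegralZr ?L1_cos ?L1_sin//.
  rewrite -RintegralD//; last 2 first.
  - by have := integrableZr measurableT (cos_tr v x) (L1_cos (2 * pi * x) iu).
  - by have := integrableZr measurableT (sin_tr v x) (L1_sin (2 * pi * x) iu).
  by apply: eq_Rintegral => s _; rewrite [RHS]mulrDr !mulrA.
rewrite (Fubini_bounded_kernel (laplace_weight_L1 e0) iu mK KM).
apply: eq_Rintegral => s _; congr (_ * _).
pose K2 (p : R * R) := cos (2 * pi * (s - p.2) * p.1).
transitivity (\int[leb]_x (laplace_weight e x * \int[leb]_t (v t * K2 (x, t))))%R.
  by apply: eq_Rintegral => x _; rewrite /K /= shifted_cos_tr.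
rewrite (@Fubini_bounded_kernel _ _ K2 1 (laplace_weight_L1 e0) iv); last 2 first.
- apply: (@measurableT_comp _ _ _ _ _ _ (@cos R)).
    by apply: continuous_measurable_fun; exact: continuous_cos.
  apply: measurable_funM => //; apply: measurable_funM => //.
  exact: measurable_funB.
- by move=> p; exact: cos_norm1.
apply: eq_Rintegral => t _; congr (_ * _).
by rewrite /K2 /= laplace_cos// /poisson.
Qed.

Local Notation I2 u := (\int[leb]_x ((u x) ^+ 2)%:E)%E.

Lemma measurable_poisson_sub e : 0 < e ->
  measurable_fun [set: RT * RT] (fun p => poisson e (p.1 - p.2)).
Proof.
move=> e0; apply: measurableT_comp (measurable_poisson e0) _.
exact: measurable_funB.
Qed.

(** * Poisson averages *)

Lemma ge0_poisson_fubini e (f : R -> \bar R) : 0 < e -> measurable_fun [set: RT] f ->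
  (forall x, 0 <= f x)%E ->
  (\int[leb]_s \int[leb]_t (f t * (poisson e (s - t))%:E) = 2^-1%:E * \int[leb]_t f t)%E.
Proof.
move=> e0 mf f0.
have mp := measurable_poisson_sub e0.
have mF : measurable_fun [set: RT * RT] (fun p => f p.2 * (poisson e (p.1 - p.2))%:E)%E.
  apply: emeasurable_funM; first exact: measurableT_comp mf measurable_snd.
  by apply/measurable_EFinP.
rewrite (@fubini_tonelli _ _ RT RT R leb leb (fun p => f p.2 * (poisson e (p.1 - p.2))%:E)%E)//=;
  last by move=> p; rewrite mule_ge0// lee_fin poisson_ge0// ltW.
rewrite -ge0_integralZl//.
apply: eq_integral => t _.
rewrite ge0_integralZl//; last 2 first.
- apply/measurable_EFinP; apply: measurableT_comp (measurable_poisson e0) _.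
  exact: measurable_funB.
- by move=> s _; rewrite lee_fin poisson_ge0// ltW.
rewrite muleC; congr (_ * _)%E; rewrite -(integral_poisson t e0).
by apply: eq_integral => s _; rewrite -poissonN opprB.
Qed.

Definition poisson_avg e (w : R -> R) (s : R) : R := (\int[leb]_t (w t * poisson e (s - t)))%R.

Lemma measurable_poisson_shift e s : 0 < e ->
  measurable_fun [set: RT] (fun t => poisson e (s - t)).
Proof.
by move=> e0; apply: measurableT_comp (measurable_poisson e0) _; exact: measurable_funB.
Qed.

Lemma L1_poisson_mul e s w : 0 < e -> L1 w -> L1 (fun t => w t * poisson e (s - t)).
Proof.
move=> e0 iw; apply: (@L1_bounded_mul _ _ e^-1) => //; first exact: measurable_poisson_shift.
by move=> t; rewrite ger0_norm ?poisson_le// poisson_ge0// ltW.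
Qed.

Lemma L1_poisson_shift e s : 0 < e -> L1 (fun t => poisson e (s - t)).
Proof.
move=> e0; apply/integrableP; split; first by apply/measurable_EFinP; exact: measurable_poisson_shift.
under eq_integral do rewrite /= ger0_norm ?poisson_ge0 ?(ltW e0)//.
by rewrite integral_poisson// ltry.
Qed.

Lemma measurable_poisson_avg e w : 0 < e -> L1 w -> measurable_fun [set: RT] (poisson_avg e w).
Proof.
move=> e0 iw; apply: (@measurable_Rintegral _ RT _ RT leb (fun p => w p.2 * poisson e (p.1 - p.2))).
apply: measurable_funM; last exact: measurable_poisson_sub.
exact: measurableT_comp (L1_measurable iw) measurable_snd.
Qed.

Lemma poisson_avg_norm_le e w s : 0 < e -> L1 w -> `|poisson_avg e w s| <= poisson_avg e (fun t => `|w t|) s.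
Proof.
move=> e0 iw; apply: Rintegral_norm_le; [exact: L1_poisson_mul|exact/L1_poisson_mul/L1_norm|].
by move=> t; rewrite normrM (ger0_norm (poisson_ge0 _ (ltW e0))).
Qed.

Lemma ge0_poisson_avg e w : 0 < e -> L1 w -> (forall t, 0 <= w t) ->
  L1 (poisson_avg e w) /\ (\int[leb]_s poisson_avg e w s = 2^-1 * \int[leb]_t w t)%R.
Proof.
move=> e0 iw w0; have p0 y : 0 <= poisson e y by exact: poisson_ge0 (ltW e0).
have a0 s : 0 <= poisson_avg e w s by apply: Rintegral_ge0 => t _; rewrite mulr_ge0.
have E : (\int[leb]_s (poisson_avg e w s)%:E = (2^-1 * \int[leb]_t w t)%R%:E)%E.
  rewrite EFinM EFin_Rintegral// -(@ge0_poisson_fubini e (EFin \o w))//.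
  - by apply: eq_integral => s _; rewrite EFin_Rintegral//; exact: L1_poisson_mul.
  - exact: measurable_int iw.
have iA : L1 (poisson_avg e w).
  apply/integrableP; split; first by apply/measurable_EFinP; exact: measurable_poisson_avg.
  by under eq_integral do rewrite /= (ger0_norm (a0 _)); rewrite E ltry.
by split => //; apply: EFin_inj; rewrite EFin_Rintegral.
Qed.

Lemma L1_poisson_avg e w : 0 < e -> L1 w -> L1 (poisson_avg e w).
Proof.
move=> e0 iw; have [i _] := ge0_poisson_avg e0 (L1_norm iw) (fun t => normr_ge0 _).
apply: (le_integrable _ _ _ i) => //; first by apply/measurable_EFinP; exact: measurable_poisson_avg.
move=> s _; rewrite /= lee_fin; apply: (le_trans (poisson_avg_norm_le s e0 iw)); exact: ler_norm.
Qed.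

Lemma poisson_avg_form_norm_le e (phi w : R -> R) (M : R) : 0 < e -> L1 w ->
  measurable_fun [set: RT] phi -> (forall x, `|phi x| <= M) ->
  L1 (fun s => phi s * poisson_avg e w s) /\
  `|\int[leb]_s (phi s * poisson_avg e w s)|%R <= M * (2^-1 * norm1 w).
Proof.
move=> e0 iw mphi phiM; have [i E] := ge0_poisson_avg e0 (L1_norm iw) (fun t => normr_ge0 _).
have ip : L1 (fun s => phi s * poisson_avg e w s).
  have := L1_bounded_mul (L1_poisson_avg e0 iw) mphi phiM.
  by apply: eq_integrable => // s _; rewrite /= mulrC.
split=> //; rewrite /norm1 -E -RintegralZl//; apply: Rintegral_norm_le => //.
  by have := integrableZl measurableT M i.
move=> s; rewrite normrM ler_pM//; exact: poisson_avg_norm_le.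
Qed.

(** Because u(s) u(t) <= (u(s)^2 + u(t)^2) / 2 and the kernel has mass 1/2 in each variable. *)
Lemma poisson_avg_form_le e u : 0 < e -> L1 u -> L1 (fun x => u x ^+ 2) ->
  (\int[leb]_s (u s * poisson_avg e u s) <= 2^-1 * \int[leb]_x (u x ^+ 2))%R.
Proof.
move=> e0 iu iu2; have p0 y : 0 <= poisson e y by exact: poisson_ge0 (ltW e0).
have [ih E] := ge0_poisson_avg e0 iu2 (fun x => sqr_ge0 (u x)); have mu := L1_measurable iu.
set h := poisson_avg e _ in ih E.
have us s : u s * poisson_avg e u s <= 4^-1 * u s ^+ 2 + 2^-1 * h s.
  have i1 := L1_poisson_mul s e0 iu; have i2 := L1_poisson_mul s e0 iu2.
  have i3 := integrableZl measurableT (2^-1 * u s ^+ 2) (L1_poisson_shift s e0).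
  have -> : 4^-1 * u s ^+ 2 = (\int[leb]_t (2^-1 * u s ^+ 2 * poisson e (s - t)))%R.
    rewrite RintegralZl ?L1_poisson_shift// /Rintegral integral_poisson//=.
    by field.
  rewrite /h /poisson_avg -!RintegralZl// -RintegralD//; last first.
    by have := integrableZl measurableT 2^-1 i2.
  apply: le_Rintegral => //.
  - by have := integrableZl measurableT (u s) i1.
  - by have := integrableD measurableT i3 (integrableZl measurableT 2^-1 i2).
  - move=> t _; rewrite -subr_ge0.
    have -> : 2^-1 * u s ^+ 2 * poisson e (s - t) + 2^-1 * (u t ^+ 2 * poisson e (s - t)) -
      u s * (u t * poisson e (s - t)) = 2^-1 * ((u s - u t) ^+ 2 * poisson e (s - t)) by field.
    by rewrite mulr_ge0// mulr_ge0// sqr_ge0.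
have j1 := integrableZl measurableT 4^-1 iu2; have j2 := integrableZl measurableT 2^-1 ih.
have j3 : L1 (fun s => 4^-1 * u s ^+ 2 + 2^-1 * h s) by have := integrableD measurableT j1 j2.
have [|iuQ] := boolP `[< L1 (fun s => u s * poisson_avg e u s) >].
  move=> /asboolP iuQ; apply: (le_trans (le_Rintegral _ iuQ j3 (fun s _ => us s))) => //.
  rewrite RintegralD// ?RintegralZl// E; move: (\int[leb]_x (u x ^+ 2))%R => I; lra.
case/asboolP: iuQ; have iuM : forall t, `|poisson_avg e u t| <= norm1 u * e^-1.
  move=> t; apply: (@le_trans _ _ (\int[leb]_x (`|u x| * e^-1))%R); last first.
    by rewrite /norm1 -RintegralZr//; exact: L1_norm.
  apply: Rintegral_norm_le; first exact: L1_poisson_mul.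
    by have := integrableZr measurableT e^-1 (L1_norm iu).
  by move=> x; rewrite normrM ler_wpM2l// ger0_norm// poisson_le.
exact: L1_bounded_mul (measurable_poisson_avg e0 iu) iuM.
Qed.

Lemma pairing_laplace_le e u : 0 < e -> L1 u ->
  (\int[leb]_x (laplace_weight e x * pairing u u x)%:E <= 2^-1%:E * I2 u)%E.
Proof.
move=> e0 iu; have mu := L1_measurable iu.
have m2 : measurable_fun [set: RT] (fun x => (u x ^+ 2)%:E).
  by apply/measurable_EFinP; exact: measurable_funX.
have [Ifin|] := ltP (I2 u) +oo%E; last by rewrite leye_eq => /eqP ->; rewrite gt0_muley ?leey.
have iu2 : L1 (fun x => u x ^+ 2).
  apply/integrableP; split => //.
  by under eq_integral do rewrite /= ger0_norm ?sqr_ge0//.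
rewrite -EFin_Rintegral; last exact: L1_weight_pairing.
by rewrite -[I2 u]EFin_Rintegral// -EFinM lee_fin pairing_poisson//; exact: poisson_avg_form_le.
Qed.

(** Monotone convergence, as the weights increase to 1 on the half-line. *)
Lemma pairing_half_le u : L1 u ->
  (\int[leb]_(x in `[0%R, +oo[) (pairing u u x)%:E <= 2^-1%:E * I2 u)%E.
Proof.
move=> iu; pose e n : R := n.+1%:R^-1.
have e0 n : 0 < e n by rewrite invr_gt0.
have N0 x : 0 <= pairing u u x by rewrite addr_ge0// -expr2 sqr_ge0.
have mN := measurable_pairing iu iu.
pose g n x := (laplace_weight (e n) x * pairing u u x)%:E.
have mg n : measurable_fun [set: RT] (g n).
  by apply/measurable_EFinP; exact: L1_measurable (L1_weight_pairing (e0 n) iu iu).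
have g0 n x : [set: RT] x -> (0 <= g n x)%E.
  by move=> _; rewrite lee_fin mulr_ge0// laplace_weight_ge0.
have gnd x : [set: RT] x -> {homo g^~ x : m n / (m <= n)%N >-> (m <= n)%E}.
  move=> _ m n mn; rewrite lee_fin ler_wpM2r// !laplace_weightE.
  case: ifPn => // x0; rewrite ler_expR lerN2 ler_wpM2r//.
  by rewrite lef_pV2 ?posrE// ler_nat ltnS.
have := monotone_convergence leb measurableT mg g0 gnd.
have -> : (\int[leb]_x limn (g^~ x) = \int[leb]_(x in `[0%R, +oo[) (pairing u u x)%:E)%E.
  rewrite [RHS]integral_mkcond; apply: eq_integral => x _.
  rewrite patchE mem_setE in_itv /= andbT; apply/cvg_lim => //.
  rewrite /g; under eq_fun do rewrite laplace_weightE.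
  case: ifPn => x0; last by under eq_fun do rewrite mul0r; exact: cvg_cst.
  apply: cvg_EFin; first exact: nearW.
  rewrite -[X in _ --> X]mul1r; apply: cvgM; last exact: cvg_cst.
  rewrite -(@expR0 R); apply: continuous_cvg; first exact: continuous_expR.
  rewrite -[X in _ --> X]oppr0; apply: cvgN; rewrite -[X in _ --> X](mul0r x).
  by apply: cvgM; [exact: cvg_harmonic|exact: cvg_cst].
move=> ->; apply: lime_le.
  apply: ereal_nondecreasing_is_cvgn => m n mn.
  by apply: ge0_le_integral => // x Tx; [exact: g0|exact: gnd].
by apply: nearW => n; exact: pairing_laplace_le.
Qed.

(** The decomposition f = (|f| + f) - |f| reduces to nonnegative functions. *)
Lemma Rintegral_affine (f : R -> R) (a c : R) : 0 < a -> L1 f ->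
  L1 (fun x => f (a * x + c)) /\ (a * \int[leb]_x f (a * x + c) = \int[leb]_x f x)%R.
Proof.
move=> a0 i.
have pos (g : R -> R) : L1 g -> (forall x, 0 <= g x) ->
    L1 (fun x => g (a * x + c)) /\ (a * \int[leb]_x g (a * x + c) = \int[leb]_x g x)%R.
  move=> ig g0; have mg : measurable_fun [set: RT] (fun x => (g x)%:E) by exact: measurable_int ig.
  have := ge0_integral_affine c a0 mg (fun x => g0 x); rewrite -(EFin_Rintegral ig) => E.
  have {}E : (\int[leb]_x (g (a * x + c))%:E = (a^-1 * \int[leb]_x g x)%R%:E)%E.
    by rewrite EFinM -E muleA -EFinM mulVf ?mul1e// gt_eqF.
  have ic : L1 (fun x => g (a * x + c)).
    apply/integrableP; split; first exact: measurableT_comp mg (measurable_affine a c).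
    by under eq_integral do rewrite /= ger0_norm//; rewrite E ltry.
  by split => //; rewrite /Rintegral E /= mulrA divff ?mul1r// gt_eqF.
have [ic1 E1] := pos _ (L1_norm i) (fun x => normr_ge0 _).
have is2 : L1 (fun x => `|f x| + f x) by have := integrableD measurableT (L1_norm i) i.
have [|ic2 E2] := pos _ is2; first by move=> x; rewrite -lerBlDr sub0r -normrN ler_norm.
have fE (g : R -> R) : g = (fun x => (`|g x| + g x) - `|g x|).
  by apply/funext => x; rewrite addrAC subrr add0r.
split; first by rewrite (fE (fun x => f (a * x + c))); have := integrableB measurableT ic2 ic1.
rewrite [in RHS](fE f) (fE (fun x => f (a * x + c))) !RintegralB//; last exact: L1_norm.
by rewrite mulrBr E1 E2.
Qed.

Lemma dominated_Rintegral d (T : measurableType d) (mu : {measure set T -> \bar R})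
    (f_ : nat -> T -> R) (f g : T -> R) :
  (forall n, measurable_fun [set: T] (f_ n)) -> measurable_fun [set: T] f ->
  {ae mu, forall x, f_ n x @[n --> \oo] --> f x} ->
  mu.-integrable setT (EFin \o g) -> (forall n x, `|f_ n x| <= g x) ->
  mu.-integrable setT (EFin \o f) /\
  (\int[mu]_x f_ n x)%R @[n --> \oo] --> (\int[mu]_x f x)%R.
Proof.
move=> mf_ mf ff ig fg.
have [] := @dominated_convergence _ T R mu setT measurableT
  (fun n x => (f_ n x)%:E) (EFin \o f) (EFin \o g).
- by move=> n; exact/measurable_EFinP.
- exact/measurable_EFinP.
- by apply: filterS ff => x h _; apply: cvg_EFin => //; exact: nearW.
- exact: ig.
- by apply: aeW => x n _; rewrite lee_fin.
move=> i _ h; split => //; rewrite /Rintegral.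
by apply: fine_cvg; rewrite fineK//; exact: integrable_fin_num.
Qed.

(** The substitution t = e y + s moves the scale from the kernel to the function; as e tends to 0
    the kernel stays fixed and dominated convergence applies. *)
Lemma poisson_avg_scaled e w s : 0 < e -> L1 (fun t => w t * poisson e (s - t)) ->
  poisson_avg e w s = (\int[leb]_y (w (e * y + s) * poisson 1 y))%R.
Proof.
move=> e0 i; have [ia Ea] := Rintegral_affine s e0 i.
rewrite /poisson_avg -Ea -RintegralZl//.
apply: eq_Rintegral => y _; rewrite mulrCA; congr (_ * _).
have -> : s - (e * y + s) = - (e * y) by ring.
rewrite poissonN /poisson.
have h1 := poisson_den y (@ltr01 R).
have h2 : e ^+ 2 + (2 * pi * (e * y)) ^+ 2 = e ^+ 2 * (1 ^+ 2 + (2 * pi * y) ^+ 2).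
  by move: (pi : R) => p; ring.
move: (1 ^+ 2 + _) h1 h2 => q q0 ->.
by field; rewrite (gt_eqF q0) (gt_eqF e0).
Qed.

Lemma poisson_avg_cvg (h : R -> R) (B : R) s : measurable_fun [set: RT] h ->
  (forall x, `|h x| <= B) -> {for s, continuous h} ->
  poisson_avg n.+1%:R^-1 h s @[n --> \oo] --> 2^-1 * h s.
Proof.
move=> mh hB hs; pose e n : R := n.+1%:R^-1.
have e0 n : 0 < e n by rewrite invr_gt0.
have p0 y : 0 <= poisson 1 y by exact: poisson_ge0 ler01.
have ip : L1 (poisson 1).
  have := L1_poisson_shift 0 (@ltr01 R); apply: eq_integrable => // y _.
  by rewrite /= sub0r poissonN.
have ihp n : L1 (fun t => h t * poisson (e n) (s - t)).
  have := L1_bounded_mul (L1_poisson_shift s (e0 n)) mh hB.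
  by apply: eq_integrable => // t _; rewrite /= mulrC.
under eq_fun do rewrite (poisson_avg_scaled (e0 _) (ihp _)).
have -> : 2^-1 * h s = (\int[leb]_y (h s * poisson 1 y))%R.
  by rewrite RintegralZl// /Rintegral integral_poisson0//= mulrC.
have [|||||//] := @dominated_Rintegral _ RT leb (fun n y => h (e n * y + s) * poisson 1 y)
    (fun y => h s * poisson 1 y) (fun y => B * poisson 1 y).
- move=> n; apply: measurable_funM; last exact: measurable_poisson.
  exact: measurableT_comp mh (measurable_affine (e n) s).
- by apply: measurable_funM => //; exact: measurable_poisson.
- apply: aeW => y; apply: cvgM; last exact: cvg_cst.
  apply: continuous_cvg; first exact: hs.
  rewrite -[X in _ --> X]add0r; apply: cvgD; last exact: cvg_cst.
  by rewrite -(mul0r y); apply: cvgM; [exact: cvg_harmonic|exact: cvg_cst].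
- by have := integrableZl measurableT B ip.
- by move=> n y; rewrite normrM (ger0_norm (p0 _)) ler_wpM2r.
Qed.

Lemma poisson_avg_bounded e (h : R -> R) (B : R) s : 0 < e -> L1 h -> (forall x, `|h x| <= B) ->
  `|poisson_avg e h s| <= B.
Proof.
move=> e0 ih hB; have p0 y : 0 <= poisson e y by exact: poisson_ge0 (ltW e0).
have B0 : 0 <= B by rewrite (le_trans _ (hB 0)).
apply: (@le_trans _ _ (\int[leb]_t (B * poisson e (s - t)))%R).
  apply: Rintegral_norm_le; first exact: L1_poisson_mul.
    by have := integrableZl measurableT B (L1_poisson_shift s e0).
  by move=> t; rewrite normrM (ger0_norm (p0 _)) ler_wpM2r.
by rewrite RintegralZl ?L1_poisson_shift// /Rintegral integral_poisson//=; lra.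
Qed.

Lemma continuous_cutoff (g : R -> R) (a s : R) : continuous g -> `|s| != a ->
  {for s, continuous (fun x : R => if `|x| <= a then g x else 0)}.
Proof.
move=> gc; have ns : `|x| @[x --> s] --> `|s| by exact: (@norm_continuous R R s).
case: ltgtP => // sa _; rewrite /prop_for /continuous_at.
  have near_h : \forall x \near s, g x = if `|x| <= a then g x else 0.
    have : \forall x \near s, `|x| < a by exact: (@cvgr_lt _ R (nbhs s) _ (fun x : R => `|x|) `|s| ns a sa).
    by apply: filterS => x /ltW ->.
  by rewrite (ltW sa); apply: cvg_trans (gc s); exact: near_eq_cvg.
have near_h : \forall x \near s, 0 = if `|x| <= a then g x else 0.
  have : \forall x \near s, a < `|x| by exact: (@cvgr_gt _ R (nbhs s) _ (fun x : R => `|x|) `|s| ns a sa).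
  by apply: filterS => x; rewrite ltNge => /negbTE ->.
have -> : (if `|s| <= a then g s else 0) = 0 by rewrite leNgt sa.
apply: (@cvg_trans _ ((fun x : R => 0 : R) @ nbhs s)).
  exact: (@near_eq_cvg _ _ (nbhs s) _ _ _ near_h).
by move=> P /nbhs_singleton P0; apply: (@nearW R (nbhs s)).
Qed.

(** A continuous approximation on [-n, n] is cut off to 0 outside that interval, which creates
    discontinuities at the two end points only. *)
Lemma L1_approx (u : R -> R) (d : R) : L1 u -> 0 < d -> exists (h : R -> R) (B : R),
  [/\ L1 h, forall x, `|h x| <= B, {ae leb, forall s, {for s, continuous h}} &
      norm1 (fun x => u x - h x) <= d].
Proof.
move=> iu d0; have mu := L1_measurable iu; have d2 : 0 < d / 2 by rewrite divr_gt0.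
pose E n : set RT := `[- n%:R, n%:R]%classic.
have EE n x : (x \in E n) = (`|x| <= n%:R) by rewrite mem_setE in_itv /= -ler_norml.
have mE n : measurable (E n) by exact: measurable_itv.
pose t n x := if `|x| <= n%:R then 0 else `|u x|.
have tu n x : `|t n x| <= `|u x| by rewrite /t; case: ifP; rewrite ?normr0 ?normr_id.
have mt n : measurable_fun [set: RT] (t n).
  apply: measurable_fun_ifT => //; first exact: measurable_fun_ler.
  exact: measurableT_comp mu.
have [|_ /cvgrPdist_le/(_ _ d2) [n _ /(_ n (leqnn n)) /= tn]] :=
    @dominated_Rintegral _ RT leb t (cst 0) _ mt (measurable_cst _) _ (L1_norm iu) tu.
  apply: aeW => x; apply: cvg_near_cst; exists (Num.bound `|x|) => // n /= bn.
  by rewrite /t ifT// (le_trans (ltW (archi_boundP _)))// ler_nat.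
have it : L1 (t n).
  apply: (@le_integrable _ RT _ leb _ _ _ (EFin \o u)) => //.
    exact/measurable_EFinP.
  by move=> x _; rewrite /= lee_fin.
have fE : (leb (E n) < +oo)%E.
  by rewrite lebesgue_measure_itv /=; case: ifP => _; rewrite -?EFinB ltry.
have [g [gc gi g0]] := @approximation_continuous_integrable R (E n) u (mE n) fE
    (integrableS measurableT (mE n) (@subsetT _ _) iu).
have [k hk] : exists k, (\int[leb]_(z in E n) `|(u z - g k z)%:E| <= (d / 2)%:E)%E.
  move/fine_cvgP : g0 => [[N _ hN]] /cvgrPdist_le/(_ _ d2) [N' _ hN'].
  exists (maxn N N'); have := hN' (maxn N N') (leq_maxr _ _).
  rewrite /= sub0r normrN -(fineK (hN (maxn N N') (leq_maxl _ _))) lee_fin.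
  by apply: le_trans; exact: ler_norm.
have [B0 [_ gB]] : [bounded g k x | x in `[- n%:R, n%:R]%classic].
  have := @segment_compact R (- n%:R) n%:R.
  move/(continuous_compact (f := g k)) => /(_ (continuous_subspaceT (gc k))).
  by move/compact_bounded => [M [Mr h]]; exists M; split => // y My x Ex; apply: h My _ _; exists x.
pose h x := if `|x| <= n%:R then g k x else 0.
have hE : h = g k \_ (E n) by apply/funext => x; rewrite /h patchE EE.
have ih : L1 h by have := (integrable_mkcond _ (mE n)).1 (gi k); rewrite restrict_EFin hE.
exists h, (`|B0| + 1); split=> // [x||].
- rewrite /h; case: ifPn => [xn|_]; last by rewrite normr0 addr_ge0.
  by apply: gB; [rewrite ltr_pwDr// ler_norm|apply/set_mem; rewrite EE].
- exists [set - n%:R; n%:R]; split.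
  + by apply: measurableU; exact: measurable_set1.
  + by rewrite measureU0; [|exact: measurable_set1..|]; exact: lebesgue_measure_set1.
  + move=> s /= hs; apply: contrapT => /not_orP [sn sn']; apply: hs.
    apply: continuous_cutoff => //; apply/negP => /eqP sE; have [s0|s0] := leP 0 s.
      by apply: sn'; rewrite -sE ger0_norm.
    by apply: sn; rewrite -sE ltr0_norm// opprK.
- have iuh : L1 (fun x => u x - h x) by have := integrableB measurableT iu ih.
  have E2 x : `|u x - h x| = t n x + ((fun x => `|u x - g k x|) \_ (E n)) x.
    by rewrite patchE EE /t /h; case: ifP => _; rewrite ?add0r// subr0 addr0.
  have ig : L1 ((fun x => `|u x - g k x|) \_ (E n)).
    have := integrableB measurableT (L1_norm iuh) it; apply: eq_integrable => // x _.
    by rewrite /= -EFinB E2 addrAC subrr add0r.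
  rewrite /norm1; under eq_Rintegral do rewrite E2; rewrite RintegralD// [leRHS]splitr lerD//.
    move: tn; rewrite /Rintegral integral0 sub0r normrN; exact/le_trans/ler_norm.
  rewrite -lee_fin EFin_Rintegral//; apply: le_trans hk.
  rewrite [leRHS]integral_mkcond; rewrite le_eqVlt; apply/orP; left; apply/eqP/eq_integral => x _.
  by rewrite !patchE; case: ifP.
Qed.

(** For the approximants h of [L1_approx] this is dominated convergence; the remainder u - h is
    controlled because averaging does not increase the L^1 norm. *)
Lemma poisson_avg_weak_cvg (phi u : R -> R) (M : R) : L1 phi -> L1 u -> (forall x, `|phi x| <= M) ->
  (\int[leb]_s (phi s * poisson_avg n.+1%:R^-1 u s))%R @[n --> \oo] -->
  (\int[leb]_s (phi s * (2^-1 * u s)))%R.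
Proof.
move=> iphi iu phiM; have M0 : 0 <= M by rewrite (le_trans _ (phiM 0)).
pose e n : R := n.+1%:R^-1; have e0 n : 0 < e n by rewrite invr_gt0.
have mphi := L1_measurable iphi; have mu := L1_measurable iu.
apply/cvgrPdist_le => d d0.
(* M + 1 only keeps the denominator positive. *)
have [|h [B [ih hB hc uh]]] := @L1_approx u (d / (2 * (M + 1))) iu.
  by rewrite divr_gt0// mulr_gt0// ltr_wpDl.
have mh := L1_measurable ih; pose v x := u x - h x.
have iv : L1 v by have := integrableB measurableT iu ih.
have half_int w : L1 w -> L1 (fun s => phi s * (2^-1 * w s)).
  move=> iw; have := integrableZl measurableT 2^-1 (L1_bounded_mul iw mphi phiM).
  by apply: eq_integrable => // s _; rewrite /= -EFinM; congr EFin; ring.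
have vd : M * (2^-1 * norm1 v) + M * (2^-1 * norm1 v) <= d / 2.
  move: (uh : norm1 v <= _).
  rewrite ler_pdivlMr; last by rewrite mulr_gt0// ltr_wpDl.
  have : 0 <= norm1 v by apply: Rintegral_ge0 => x _.
  by move: (norm1 v) => z; nra.
have [|||_ hlim] := @dominated_Rintegral _ RT leb (fun n s => phi s * poisson_avg (e n) h s)
    (fun s => phi s * (2^-1 * h s)) (fun s => B * `|phi s|)
    (fun n => measurable_funM mphi (measurable_poisson_avg (e0 n) ih))
    (L1_measurable (half_int _ ih)).
- move: hc; apply: negligibleS => s /=; apply: contra_not => hs.
  apply: cvgM; first exact: cvg_cst.
  exact: poisson_avg_cvg.
- by have := integrableZl measurableT B (L1_norm iphi).
- by move=> n s; rewrite normrM mulrC ler_wpM2r// poisson_avg_bounded.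
move/cvgrPdist_le: hlim => /(_ (d / 2)); case; first by rewrite divr_gt0.
move=> N _ hN; exists N => // n /hN /= {}hN.
have [iv1 vn] := poisson_avg_form_norm_le (e0 n) iv mphi phiM.
have [ih1 _] := poisson_avg_form_norm_le (e0 n) ih mphi phiM.
have uE : (\int[leb]_s (phi s * poisson_avg (e n) u s) =
    \int[leb]_s (phi s * poisson_avg (e n) v s) + \int[leb]_s (phi s * poisson_avg (e n) h s))%R.
  rewrite -RintegralD//; apply: eq_Rintegral => s _; rewrite -mulrDr; congr (_ * _).
  rewrite /poisson_avg -RintegralD ?L1_poisson_mul//; apply: eq_Rintegral => t _.
  by rewrite -mulrDl /v subrK.
have uE2 : (\int[leb]_s (phi s * (2^-1 * u s)) =
    \int[leb]_s (phi s * (2^-1 * v s)) + \int[leb]_s (phi s * (2^-1 * h s)))%R.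
  rewrite -RintegralD ?half_int//; apply: eq_Rintegral => s _.
  by rewrite -!mulrDr /v subrK.
have v2 : `|\int[leb]_s (phi s * (2^-1 * v s))|%R <= M * (2^-1 * norm1 v).
  rewrite /norm1 -!RintegralZl ?L1_norm//; last first.
    by have := integrableZl measurableT 2^-1 (L1_norm iv).
  apply: Rintegral_norm_le; first exact: half_int.
    by have := integrableZl measurableT M (integrableZl measurableT 2^-1 (L1_norm iv)).
  by move=> s; rewrite !normrM ler_pM// gtr0_norm.
move: uE uE2 vd hN vn v2 => -> ->; move: (Rintegral _ _ _) (Rintegral _ _ _) => x y.
move: (Rintegral _ _ _) (Rintegral _ _ _) => z w vd hN vn v2.
rewrite opprD addrACA (le_trans (ler_normD _ _))// [leRHS]splitr lerD//.
by rewrite (le_trans (ler_normB _ _))// (le_trans _ vd)// lerD.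
Qed.

(** * The Plancherel formula *)

Lemma laplace_pairing_le_half e u : 0 < e -> L1 u ->
  (\int[leb]_x (laplace_weight e x * pairing u u x)%:E <=
   \int[leb]_(x in `[0%R, +oo[) (pairing u u x)%:E)%E.
Proof.
move=> e0 iu; have N0 x : 0 <= pairing u u x by rewrite addr_ge0// -expr2 sqr_ge0.
have mN := measurable_pairing iu iu.
rewrite integral_laplace_weight; apply: ge0_le_integral => //.
- by move=> x _; rewrite lee_fin mulr_ge0// expR_ge0.
- apply/measurable_EFinP/measurable_funTS; apply: measurable_funM => //.
  exact: measurable_expRN.
- by apply/measurable_EFinP/measurable_funTS.
- move=> x; rewrite /= in_itv /= andbT => x0; rewrite lee_fin ler_piMl//.
  by rewrite -expR0 ler_expR oppr_le0 mulr_ge0// ltW.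
Qed.

(** Lower semicontinuity of the norm. Let C be the right-hand side and phi a truncation of u.
    Writing Q for the positive form given by the kernel, 2 Q(phi, u) <= Q(u, u) + Q(phi, phi) is at
    most C + |phi|^2 / 2, while 2 Q(phi, u) tends to the integral of phi u = phi^2. Hence
    |phi|^2 / 2 <= C, and phi increases to u. *)
Lemma half_le_pairing u : L1 u ->
  (2^-1%:E * I2 u <= \int[leb]_(x in `[0%R, +oo[) (pairing u u x)%:E)%E.
Proof.
move=> iu; have mu := L1_measurable iu.
set C := (\int[leb]_(x in `[0%R, +oo[) (pairing u u x)%:E)%E.
have N0 v x : 0 <= pairing v v x by rewrite addr_ge0// -expr2 sqr_ge0.
have C0 : (0 <= C)%E by apply: integral_ge0 => x _; rewrite lee_fin.
have [Cfin|] := ltP C +oo%E; last by rewrite leye_eq => /eqP ->; rewrite leey.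
pose phi (n : nat) x := if `|u x| <= n%:R then u x else 0.
have mphi n : measurable_fun [set: RT] (phi n).
  apply: measurable_fun_ifT => //; apply: measurable_fun_ler => //.
  exact: measurableT_comp mu.
have phiM n x : `|phi n x| <= n%:R.
  by rewrite /phi; case: ifPn => // _; rewrite normr0.
have phiu n x : `|phi n x| <= `|u x|.
  by rewrite /phi; case: ifPn => // _; rewrite normr0.
have iphi n : L1 (phi n).
  apply: (@le_integrable _ RT _ leb _ _ _ (EFin \o u)) => //.
    exact/measurable_EFinP.
  by move=> x _; rewrite /= lee_fin.
have phi2u n x : phi n x * u x = phi n x ^+ 2.
  by rewrite /phi; case: ifPn => // _; rewrite mul0r expr0n.
have iphi2 n : L1 (fun x => phi n x ^+ 2).
  by have := L1_bounded_mul (iphi n) (mphi n) (phiM n).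
have key n : (2^-1%:E * I2 (phi n) <= C)%E.
  set v := phi n; rewrite -EFin_Rintegral; last exact: iphi2.
  set a := Rintegral _ _ _; pose c := fine C.
  have CE : C = c%:E by rewrite fineK// ge0_fin_numE.
  rewrite -EFinM CE lee_fin.
  have lim := poisson_avg_weak_cvg (iphi n) iu (phiM n).
  have aE : (\int[leb]_s (phi n s * (2^-1 * u s)) = 2^-1 * a)%R.
    rewrite /a -RintegralZl//; last exact: iphi2.
    by apply: eq_Rintegral => s _; rewrite mulrCA phi2u.
  rewrite aE in lim.
  suff bound k : (\int[leb]_s (phi n s * poisson_avg k.+1%:R^-1 u s))%R <= 2^-1 * (c + 2^-1 * a).
    have : 2^-1 * a <= 2^-1 * (c + 2^-1 * a).
      by apply: cvgr_to_le lim _; exact: nearW.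
    by move: (a) (c) => a' c'; lra.
  set e : R := k.+1%:R^-1; have e0 : 0 < e by rewrite invr_gt0.
  rewrite -(pairing_poisson e0 (iphi n) iu).
  have h1 : (\int[leb]_x (laplace_weight e x * pairing u u x))%R <= c.
    rewrite -lee_fin -CE EFin_Rintegral; last exact: L1_weight_pairing.
    exact: laplace_pairing_le_half.
  have h2 : (\int[leb]_x (laplace_weight e x * pairing v v x))%R <= 2^-1 * a.
    rewrite -lee_fin EFin_Rintegral; last by apply: L1_weight_pairing => //; exact: iphi.
    rewrite EFinM EFin_Rintegral; last exact: iphi2.
    by apply: pairing_laplace_le => //; exact: iphi.
  have h3 : 2 * (\int[leb]_x (laplace_weight e x * pairing v u x))%R <=
      (\int[leb]_x (laplace_weight e x * pairing u u x))%R +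
      (\int[leb]_x (laplace_weight e x * pairing v v x))%R.
    have i1 := L1_weight_pairing e0 iu iu.
    have i2 := L1_weight_pairing e0 (iphi n) (iphi n).
    have i3 := L1_weight_pairing e0 (iphi n) iu.
    rewrite -RintegralZl// -RintegralD//; apply: le_Rintegral => //.
    - by have := integrableZl measurableT 2 i3.
    - by have := integrableD measurableT i1 i2.
    - move=> x _; rewrite -mulrDr mulrCA ler_wpM2l ?laplace_weight_ge0//.
      rewrite /pairing; have := sqr_ge0 (cos_tr u x - cos_tr v x).
      by have := sqr_ge0 (sin_tr u x - sin_tr v x); nra.
  have := le_trans h3 (lerD h1 h2); clear.
  move: (Rintegral _ _ _) (a) (c) => x a' c' h.
  by rewrite mulrC ler_pdivlMr// mulrC.
have I2lim : (I2 (phi n) @[n --> \oo] --> I2 u)%E.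
  have := @cvg_monotone_convergence _ RT R leb setT measurableT
    (fun n x => (phi n x ^+ 2)%:E).
  have e x : limn (fun n => (phi n x ^+ 2)%:E) = (u x ^+ 2)%:E.
    apply: cvg_lim => //.
    apply: cvg_near_cst; near=> n; rewrite /phi ifT//.
    near: n; exists (Num.bound `|u x|) => // n /= bn.
    by apply/ltW/(lt_le_trans (archi_boundP _)); rewrite ?ler_nat.
  rewrite (_ : I2 u = \int[leb]_x limn (fun n => (phi n x ^+ 2)%:E))%E; last first.
    by apply: eq_integral => x _; rewrite e.
  apply.
  - by move=> n; apply/measurable_EFinP; exact: measurable_funX.
  - by move=> n x _; rewrite lee_fin sqr_ge0.
  - move=> x _ m n mn; rewrite lee_fin /phi.
    have [um|um] := leP `|u x| m%:R; last by rewrite expr0n sqr_ge0.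
    by rewrite (le_trans um)// ler_nat.
have : (2^-1%:E * I2 (phi n) @[n --> \oo] --> 2^-1%:E * I2 u)%E by exact: cvgeZl.
move=> h; rewrite -(cvg_lim _ h)//; apply: lime_le; first by apply/cvg_ex; exists (2^-1%:E * I2 u)%E.
exact: nearW.
Unshelve. all: by end_near. Qed.

Lemma plancherel_half u : L1 u ->
  (\int[leb]_(x in `[0%R, +oo[) (pairing u u x)%:E = 2^-1%:E * I2 u)%E.
Proof. by move=> iu; apply/eqP; rewrite eq_le pairing_half_le ?half_le_pairing. Qed.

Lemma ge0_integral_even (f : R -> \bar R) : measurable_fun [set: RT] f ->
  (forall x, 0 <= f x)%E -> (forall x, f (- x) = f x) ->
  (\int[leb]_x f x = 2%:E * \int[leb]_(x in `[0%R, +oo[) f x)%E.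
Proof.
move=> mf f0 fe; pose P : set RT := `[0, +oo[%classic; pose Q : set RT := `]-oo, 0[%classic.
have mP : measurable P by exact: measurable_itv.
have mQ : measurable Q by exact: measurable_itv.
have -> : (\int[leb]_x f x = \int[leb]_(x in P `|` Q) f x)%E.
  congr integral; apply/esym/seteqP; split => // x _; rewrite /P /Q /= !in_itv /= andbT.
  by case: leP; [left|right].
rewrite ge0_integral_setU//; last 2 first.
- exact: measurable_funTS.
- apply/disj_set2P/seteqP; split => // x []; rewrite /P /Q /= !in_itv /= andbT.
  by move=> /le_lt_trans h /h; rewrite ltxx.
have -> : (\int[leb]_(x in Q) f x = \int[leb]_(x in P) f x)%E.
  rewrite integral_mkcond -ge0_integral_reflect; last 2 first.
  - by apply/measurable_restrict => //; exact: measurable_funTS.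
  - by move=> x; rewrite patchE; case: ifP.
  have -> : (fun x => (f \_ Q) (- x)) = f \_ `]0, +oo[%classic.
    apply/funext => x; rewrite !patchE fe; congr (if _ then _ else _).
    by rewrite !mem_setE !in_itv /= oppr_lt0 andbT.
  rewrite -integral_mkcond; apply: integral_itv_obnd_cbnd.
  exact: measurable_funTS.
by rewrite -mule2n mule_natl.
Qed.

Lemma cos_trN u x : cos_tr u (- x) = cos_tr u x.
Proof. by apply: eq_Rintegral => s _; rewrite mulrN mulNr cosN. Qed.

Lemma sin_trN u x : L1 u -> sin_tr u (- x) = - sin_tr u x.
Proof.
move=> iu; rewrite /sin_tr -[RHS]mulN1r -RintegralZl//; last first.
  apply: (@L1_bounded_mul _ _ 1) => //; first exact: measurable_sinM.
  by move=> s; rewrite ler_norml sin_geN1 sin_le1.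
by apply: eq_Rintegral => s _; rewrite mulrN mulNr sinN; ring.
Qed.

(** The squared modulus of the Fourier transform of u + i v. *)
Definition fourier_normsq (u v : R -> R) (x : R) : R :=
  (cos_tr u x - sin_tr v x) ^+ 2 + (sin_tr u x + cos_tr v x) ^+ 2.

Lemma measurable_fourier_normsq u v : L1 u -> L1 v ->
  measurable_fun [set: RT] (fourier_normsq u v).
Proof.
move=> iu iv; apply: measurable_funD; apply: measurable_funX.
  by apply: measurable_funB; [exact: measurable_cos_tr|exact: measurable_sin_tr].
by apply: measurable_funD; [exact: measurable_sin_tr|exact: measurable_cos_tr].
Qed.

(** The cross terms between u and v are odd in x, so that symmetrizing leaves the two real
    pairings. Both sides may be infinite. *)
Lemma plancherel u v : L1 u -> L1 v ->
  (\int[leb]_x (fourier_normsq u v x)%:E =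
   \int[leb]_x (u x ^+ 2 + v x ^+ 2)%:E)%E.
Proof.
move=> iu iv; have mu := L1_measurable iu; have mv := L1_measurable iv.
have mF := measurable_fourier_normsq iu iv.
have F0 x : 0 <= fourier_normsq u v x by rewrite addr_ge0// sqr_ge0.
pose E x := pairing u u x + pairing v v x.
have N0 w x : 0 <= pairing w w x by rewrite addr_ge0// -expr2 sqr_ge0.
have mN w : L1 w -> measurable_fun [set: RT] (fun x => (pairing w w x)%:E).
  by move=> iw; apply/measurable_EFinP; exact: measurable_pairing.
have mE : measurable_fun [set: RT] (fun x => (E x)%:E).
  by apply/measurable_EFinP; apply: measurable_funD; exact: measurable_pairing.
have FE x : fourier_normsq u v x + fourier_normsq u v (- x) = 2 * E x.
  by rewrite /fourier_normsq /E /pairing !cos_trN !sin_trN//; ring.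
have h2 : (2%:E * \int[leb]_x (fourier_normsq u v x)%:E = 2%:E * \int[leb]_x (E x)%:E)%E.
  rewrite -[RHS]ge0_integralZl//; last by move=> x _; rewrite lee_fin addr_ge0.
  under [RHS]eq_integral do rewrite -EFinM -FE EFinD.
  rewrite ge0_integralD//.
  - rewrite (@ge0_integral_reflect (fun x => (fourier_normsq u v x)%:E))//.
      by rewrite -mule2n mule_natl.
    exact/measurable_EFinP.
  - by move=> x _; rewrite lee_fin.
  - exact/measurable_EFinP.
  - by move=> x _; rewrite lee_fin.
  - apply/measurable_EFinP; apply: (measurableT_comp mF).
    exact: oppr_measurable.
have -> : (\int[leb]_x (fourier_normsq u v x)%:E = \int[leb]_x (E x)%:E)%E.
  move: h2; move: (\int[leb]_x (fourier_normsq u v x)%:E)%E (\int[leb]_x (E x)%:E)%E.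
  move=> X Y /(congr1 (fun z => 2^-1%:E * z)%E).
  by rewrite !muleA -!EFinM mulVf// !mul1e.
rewrite ge0_integral_even//; last 2 first.
- by move=> x; rewrite lee_fin addr_ge0.
- by move=> x; rewrite /E /pairing !cos_trN !sin_trN// !mulrNN.
under eq_integral do rewrite EFinD.
rewrite ge0_integralD//; last 4 first.
- by move=> x _; rewrite lee_fin.
- by apply: measurable_funTS; apply: mN.
- by move=> x _; rewrite lee_fin.
- by apply: measurable_funTS; apply: mN.
rewrite !plancherel_half//.
have I0 (w : R -> R) : (0 <= I2 w)%E by apply: integral_ge0 => x _; rewrite lee_fin sqr_ge0.
rewrite -ge0_muleDr// muleA -EFinM divff// mul1e -ge0_integralD//.
- by move=> x _; rewrite lee_fin sqr_ge0.
- by apply/measurable_EFinP; exact: measurable_funX.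
- by move=> x _; rewrite lee_fin sqr_ge0.
- by apply/measurable_EFinP; exact: measurable_funX.
Qed.

End IntegralTools.

(** * Complex-valued measurable functions *)

Lemma ReZ (R : realType) (a : R) (z : R[i]) : complex.Re (a%:C * z) = a * complex.Re z.
Proof. by rewrite ReM mul0r subr0. Qed.

Lemma ImZ (R : realType) (a : R) (z : R[i]) : complex.Im (a%:C * z) = a * complex.Im z.
Proof. by rewrite ImM mul0r addr0. Qed.

Lemma cvg0c_part (R : realType) (p : R[i] -> R) (z : nat -> R[i]) x :
  (forall x y, p (x - y) = p x - p y) -> (forall x, p x ^+ 2 <= normc_sq x) ->
  cvg0c (fun n => x - z n) -> p (z n) @[n --> \oo] --> p x.
Proof.
move=> pB p_le zx; apply/cvgrPdist_le => e e0.
have /cvgrPdist_le/(_ (e ^+ 2)) := zx; rewrite exprn_gt0// => /(_ isT).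
apply: filterS => n; rewrite sub0r normrN ger0_norm ?normc_sq_ge0// => h.
rewrite -(@ler_pXn2r _ 2)// ?nnegrE ?(ltW e0)// real_normK ?num_real//.
by rewrite -pB; exact: le_trans (p_le _) h.
Qed.

Lemma cvg0c_Re (R : realType) (z : nat -> R[i]) x :
  cvg0c (fun n => x - z n) -> complex.Re (z n) @[n --> \oo] --> complex.Re x.
Proof.
apply: cvg0c_part; last exact: Re_le_normc_sq.
by move=> a b; rewrite ReD ReN.
Qed.

Lemma cvg0c_Im (R : realType) (z : nat -> R[i]) x :
  cvg0c (fun n => x - z n) -> complex.Im (z n) @[n --> \oo] --> complex.Im x.
Proof.
apply: cvg0c_part => [a b|a]; first by rewrite ImD ImN.
by rewrite /normc_sq lerDr sqr_ge0.
Qed.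

Lemma Re_Im_cvg0c (R : realType) (z : nat -> R[i]) (x : R[i]) :
  complex.Re (z n) @[n --> \oo] --> complex.Re x ->
  complex.Im (z n) @[n --> \oo] --> complex.Im x -> cvg0c (fun n => x - z n).
Proof.
move=> c1 c2; rewrite /cvg0c (_ : 0 = 0 ^+ 2 + 0 ^+ 2 :> R); last by rewrite expr0n addr0.
have sub0 (u : nat -> R) (l : R) : u n @[n --> \oo] --> l ->
    (l - u n) ^+ 2 @[n --> \oo] --> (0 : R) ^+ 2.
  move=> ul; rewrite !expr2 -(subrr l).
  by under eq_fun do rewrite expr2; apply: cvgM; apply: cvgB => //; exact: cvg_cst.
have h := cvgD (F := \oo) (sub0 _ _ c1) (sub0 _ _ c2).
apply: cvg_trans (h _); apply: near_eq_cvg; apply: nearW => n.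
by rewrite /normc_sq ReD ReN ImD ImN.
Qed.

Lemma cvg0c_normc_sq (R : realType) (z : nat -> R[i]) x : cvg0c z ->
  normc_sq (x + z n) @[n --> \oo] --> normc_sq x.
Proof.
move=> z0; have h : cvg0c (fun n => x - (x + z n)).
  apply: cvg0c_eq z0 => n.
  by rewrite opprD addrA subrr sub0r normc_sqN.
rewrite /normc_sq; apply: cvgD; rewrite expr2; under eq_fun do rewrite expr2.
  by apply: cvgM; exact: cvg0c_Re h.
by apply: cvgM; exact: cvg0c_Im h.
Qed.

Section ComplexMeasurable.
Context {R : realType} d (T : measurableType d).
Implicit Types f g : T -> R[i].
Local Notation cmeas f := (cmeasurable [set: T] f).

Lemma cmeasurable_cst (c : R[i]) : cmeas (fun=> c).
Proof. by split; exact: measurable_cst. Qed.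

Lemma cmeasurableD f g : cmeas f -> cmeas g -> cmeas (fun t => f t + g t).
Proof.
move=> [f1 f2] [g1 g2]; split.
  by under eq_fun do rewrite ReD; exact: measurable_funD.
by under eq_fun do rewrite ImD; exact: measurable_funD.
Qed.

Lemma cmeasurableM f g : cmeas f -> cmeas g -> cmeas (fun t => f t * g t).
Proof.
move=> [f1 f2] [g1 g2]; split.
  by under eq_fun do rewrite ReM; apply: measurable_funB; exact: measurable_funM.
by under eq_fun do rewrite ImM; apply: measurable_funD; exact: measurable_funM.
Qed.

Lemma cmeasurableJ f : cmeas f -> cmeas (fun t => (f t)^*).
Proof.
move=> [f1 f2]; split; first by under eq_fun do rewrite ReJ.
by under eq_fun do rewrite ImJ; exact: measurableT_comp.
Qed.

Lemma cmeasurableN f : cmeas f -> cmeas (fun t => - f t).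
Proof.
move=> [f1 f2]; split; first by under eq_fun do rewrite ReN; exact: measurableT_comp.
by under eq_fun do rewrite ImN; exact: measurableT_comp.
Qed.

Lemma cmeasurableB f g : cmeas f -> cmeas g -> cmeas (fun t => f t - g t).
Proof. by move=> mf mg; apply: cmeasurableD => //; exact: cmeasurableN. Qed.

Lemma cmeasurableR (f : T -> R) : measurable_fun [set: T] f -> cmeas (fun t => (f t)%:C).
Proof. by move=> mf; split => //; exact: measurable_cst. Qed.

Lemma cmeasurable_sum n (F : nat -> T -> R[i]) : (forall k, cmeas (F k)) ->
  cmeas (fun t => \sum_(k < n) F k t).
Proof.
move=> mF; elim: n => [|n IH].
  by under eq_fun do rewrite big_ord0; exact: cmeasurable_cst.
by under eq_fun do rewrite big_ord_recr /=; exact: cmeasurableD.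
Qed.

Lemma measurable_normc_sq f : cmeas f -> measurable_fun [set: T] (fun t => normc_sq (f t)).
Proof. by move=> [f1 f2]; apply: measurable_funD; exact: measurable_funX. Qed.

Lemma emeasurable_normc_sq f : cmeas f ->
  measurable_fun [set: T] (fun t => (normc_sq (f t))%:E).
Proof. by move=> mf; apply/measurable_EFinP; exact: measurable_normc_sq. Qed.

Lemma cmeasurable_comp d' (T' : measurableType d') (phi : T' -> T) f :
  measurable_fun [set: T'] phi -> cmeas f -> cmeasurable [set: T'] (fun t => f (phi t)).
Proof.
by move=> mphi [f1 f2]; split;
  [exact: (measurableT_comp f1 mphi)|exact: (measurableT_comp f2 mphi)].
Qed.

Lemma cmeasurable_ifT (P : T -> bool) f g : measurable_fun [set: T] P ->
  cmeas f -> cmeas g -> cmeas (fun t => if P t then f t else g t).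
Proof.
move=> mP [f1 f2] [g1 g2]; split.
  rewrite (_ : (fun t => _) = fun t => if P t then complex.Re (f t) else complex.Re (g t)).
    exact: measurable_fun_ifT.
  by apply/funext => t; case: ifP.
rewrite (_ : (fun t => _) = fun t => if P t then complex.Im (f t) else complex.Im (g t)).
  exact: measurable_fun_ifT.
by apply/funext => t; case: ifP.
Qed.

End ComplexMeasurable.

(** * The complex integral *)

Section ComplexIntegral.
Context {R : realType} d (T : measurableType d) (mu : {measure set T -> \bar R}).
Implicit Types f g : T -> R[i].

Definition cintegrable f := mu.-integrable setT (fun t => (complex.Re (f t))%:E) /\
  mu.-integrable setT (fun t => (complex.Im (f t))%:E).

Definition cint f : R[i] := Complex
  (\int[mu]_t complex.Re (f t)) (\int[mu]_t complex.Im (f t)).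

Lemma cintegrable_le f (g : T -> R) : cmeasurable [set: T] f ->
  mu.-integrable setT (EFin \o g) -> (forall t, normc_sq (f t) <= g t ^+ 2) ->
  (forall t, 0 <= g t) -> cintegrable f.
Proof.
move=> [f1 f2] ig fg g0; split; apply: (le_integrable _ _ _ ig) => //.
- exact/measurable_EFinP.
- move=> t _; rewrite /= lee_fin (ger0_norm (g0 t)).
  rewrite -(@ler_pXn2r _ 2)// ?nnegrE// real_normK ?num_real//.
  exact: le_trans (Re_le_normc_sq _) (fg t).
- exact/measurable_EFinP.
- move=> t _; rewrite /= lee_fin (ger0_norm (g0 t)).
  rewrite -(@ler_pXn2r _ 2)// ?nnegrE// real_normK ?num_real//.
  by apply: le_trans (fg t); rewrite /normc_sq lerDr sqr_ge0.
Qed.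

Lemma cintegrableD f g : cintegrable f -> cintegrable g ->
  cintegrable (fun t => f t + g t).
Proof.
move=> [f1 f2] [g1 g2]; split.
  by under eq_fun do rewrite ReD EFinD; exact: integrableD.
by under eq_fun do rewrite ImD EFinD; exact: integrableD.
Qed.

Lemma cintegrableZ c f : cintegrable f -> cintegrable (fun t => c * f t).
Proof.
move=> [f1 f2]; split.
  under eq_fun do rewrite ReM EFinB !EFinM; apply: integrableB => //; exact: integrableZl.
under eq_fun do rewrite ImM EFinD !EFinM; apply: integrableD => //; exact: integrableZl.
Qed.

Lemma cintD f g : cintegrable f -> cintegrable g ->
  cint (fun t => f t + g t) = cint f + cint g.
Proof.
move=> [f1 f2] [g1 g2]; rewrite /cint; apply: complexP => /=.
  by under eq_Rintegral do rewrite ReD; rewrite RintegralD.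
by under eq_Rintegral do rewrite ImD; rewrite RintegralD.
Qed.

Lemma cintZ c f : cintegrable f -> cint (fun t => c * f t) = c * cint f.
Proof.
move=> [f1 f2]; rewrite /cint; case: c => a b; apply: complexP => /=.
  under eq_Rintegral do rewrite ReM /=; rewrite RintegralB//; last 2 first.
  - by have := integrableZl measurableT a f1.
  - by have := integrableZl measurableT b f2.
  by rewrite !RintegralZl.
under eq_Rintegral do rewrite ImM /=; rewrite RintegralD//; last 2 first.
- by have := integrableZl measurableT a f2.
- by have := integrableZl measurableT b f1.
by rewrite !RintegralZl.
Qed.

Lemma cintJ f : cintegrable f -> cint (fun t => (f t)^*) = (cint f)^*.
Proof.
move=> [f1 f2]; rewrite /cint; apply: complexP => /=.
  by apply: eq_Rintegral => t _; rewrite ReJ.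
rewrite -mulN1r -RintegralZl//; apply: eq_Rintegral => t _; by rewrite ImJ mulN1r.
Qed.

Lemma eq_cint f g : f =1 g -> cint f = cint g.
Proof. by move=> fg; congr cint; exact/funext. Qed.

Lemma cint_sum n (F : nat -> T -> R[i]) : (forall k, cintegrable (F k)) ->
  cintegrable (fun t => \sum_(k < n) F k t) /\
  cint (fun t => \sum_(k < n) F k t) = \sum_(k < n) cint (F k).
Proof.
move=> iF; elim: n => [|n [IH1 IH2]].
  under eq_fun do rewrite big_ord0; rewrite big_ord0; split.
    by split; exact: integrable0.
  by rewrite /cint; apply: complexP => /=; rewrite /Rintegral integral0.
under eq_fun do rewrite big_ord_recr /=; rewrite big_ord_recr /= -IH2.
by split; [exact: cintegrableD|exact: cintD].
Qed.

Lemma dominated_cint (f_ : nat -> T -> R[i]) f (g : T -> R) :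
  (forall n, cmeasurable [set: T] (f_ n)) ->
  mu.-integrable setT (EFin \o g) -> (forall t, 0 <= g t) ->
  (forall n t, normc_sq (f_ n t) <= g t ^+ 2) ->
  (forall t, cvg0c (fun n => f t - f_ n t)) ->
  cintegrable f /\ cvg0c (fun n => cint f - cint (f_ n)).
Proof.
move=> mf ig g0 fg ff.
have part (p : R[i] -> R) : (forall x y, p (x - y) = p x - p y) ->
    (forall x, p x ^+ 2 <= normc_sq x) ->
    (forall n, measurable_fun [set: T] (fun t => p (f_ n t))) ->
    mu.-integrable setT (fun t => (p (f t))%:E) /\
    (\int[mu]_t p (f_ n t))%R @[n --> \oo] --> (\int[mu]_t p (f t))%R.
  move=> pB p_le mp.
  have cvgp t : p (f_ n t) @[n --> \oo] --> p (f t) by exact: cvg0c_part (ff t).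
  have bd n t : `|p (f_ n t)| <= g t.
    rewrite -(@ler_pXn2r _ 2)// ?nnegrE// real_normK ?num_real//.
    exact: le_trans (p_le _) (fg n t).
  apply: (@dominated_Rintegral _ _ T mu (fun n t => p (f_ n t)) _ g) => //.
    exact: (@measurable_fun_cvg _ _ _ _ (fun n t => p (f_ n t))).
  by apply: aeW => t; exact: cvgp.
have [|||i1 c1] := part (@complex.Re R).
- by move=> x y; rewrite ReD ReN.
- exact: Re_le_normc_sq.
- by move=> n; exact: (mf n).1.
have [|||i2 c2] := part (@complex.Im R).
- by move=> x y; rewrite ImD ImN.
- by move=> x; rewrite /normc_sq lerDr sqr_ge0.
- by move=> n; exact: (mf n).2.
by split => //; exact: Re_Im_cvg0c.
Qed.

End ComplexIntegral.

(** * The space of square-integrable functions *)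

Section AlmostEverywhere.
Context {R : realType} d (T : measurableType d) (mu : {measure set T -> \bar R}).

Lemma ae_imp (P Q : T -> Prop) : {ae mu, forall t, P t} ->
  (forall t, P t -> Q t) -> {ae mu, forall t, Q t}.
Proof. by move=> h PQ; apply: filterS h. Qed.

Lemma ae_imp2 (P Q S : T -> Prop) : {ae mu, forall t, P t} -> {ae mu, forall t, Q t} ->
  (forall t, P t -> Q t -> S t) -> {ae mu, forall t, S t}.
Proof. by move=> h h' PQ; apply: filterS2 h h'. Qed.

End AlmostEverywhere.

Section SquareIntegrable.
Context {R : realType}.
Local Notation leb := (@lebesgue_measure R).
Local Notation RT := (measurableTypeR R).
Implicit Types f g h : R -> R[i].

Definition SQ h := cmeasurable [set: RT] h /\
  (\int[leb]_x (normc_sq (h x))%:E < +oo)%E.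

(** The half-density of [f]: it turns the measure dr/r of the half-line into Lebesgue measure on the
    whole line, on which [f] is extended by zero. *)
Definition hd f (r : R) : R[i] := if 0 < r then ((Num.sqrt r)^-1)%:C * f r else 0.

(** A function whose half-density is [h], if [h] vanishes off the half-line. *)
Definition dh h (r : R) : R[i] := (Num.sqrt r)%:C * h r.

Lemma hd_linear c f g r : hd (fun r => c * f r + g r) r = c * hd f r + hd g r.
Proof. by rewrite /hd; case: ifP => _; rewrite ?mulr0 ?addr0// mulrDr mulrCA. Qed.

Lemma hd_dh h r : 0 < r -> hd (dh h) r = h r.
Proof.
move=> r0; rewrite /hd /dh r0 mulrA -rmorphM /= mulVf ?mul1r//.
by rewrite gt_eqF// sqrtr_gt0.
Qed.

Lemma hd_le0 f r : r <= 0 -> hd f r = 0.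
Proof. by rewrite /hd ltNge => ->. Qed.

Lemma hdM f g r : 0 < r -> hd f r * (hd g r)^* = (r^-1)%:C * (f r * (g r)^*).
Proof.
move=> r0; rewrite /hd r0.
have -> : r^-1 = (Num.sqrt r)^-1 * (Num.sqrt r)^-1.
  by rewrite -invfM -expr2 sqr_sqrtr// ltW.
case: (f r) (g r) => [a b] [c e]; apply: complexP; rewrite /=; ring.
Qed.

Lemma normc_sq_hd f r : 0 < r -> normc_sq (hd f r) = r^-1 * normc_sq (f r).
Proof.
move=> r0; rewrite /hd r0 normc_sqM normc_sqR exprVn sqr_sqrtr//; exact: ltW.
Qed.

Lemma Rplus_measurable : measurable (Rplus : set RT).
Proof. exact: measurable_itv. Qed.

Lemma in_Rplus r : (r \in (Rplus : set R)) = (0 < r).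
Proof. by rewrite /Rplus mem_setE in_itv /= andbT. Qed.

Lemma measurable_sqrt : measurable_fun [set: RT] (@Num.sqrt R : RT -> R).
Proof. by apply: continuous_measurable_fun; exact: sqrt_continuous. Qed.

Lemma measurable_sqrtV : measurable_fun (Rplus : set RT) (fun r : RT => (Num.sqrt r)^-1).
Proof.
apply: open_continuous_measurable_fun; first exact: interval_open.
move=> r; rewrite in_Rplus => r0; apply: cvgV; first by rewrite gt_eqF// sqrtr_gt0.
exact: sqrt_continuous.
Qed.

Lemma cmeasurable_hd f : cmeasurable Rplus f <-> cmeasurable [set: RT] (hd f).
Proof.
have E1 : (fun r : RT => complex.Re (hd f r)) =
    (fun r : RT => (Num.sqrt r)^-1 * complex.Re (f r)) \_ Rplus.
  apply/funext => r; rewrite patchE in_Rplus /hd; case: ifP => // _.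
  by case: (f r) => a b /=; ring.
have E2 : (fun r : RT => complex.Im (hd f r)) =
    (fun r : RT => (Num.sqrt r)^-1 * complex.Im (f r)) \_ Rplus.
  apply/funext => r; rewrite patchE in_Rplus /hd; case: ifP => // _.
  by case: (f r) => a b /=; ring.
have mR := Rplus_measurable; split=> [[f1 f2]|[]].
  split; [rewrite E1|rewrite E2]; apply/measurable_restrict => //; rewrite setTI;
    by apply: measurable_funM => //; exact: measurable_sqrtV.
rewrite E1 E2 => /measurable_restrict h1 /measurable_restrict h2.
have aux (u : RT -> R) : measurable_fun (Rplus : set RT) (fun r => (Num.sqrt r)^-1 * u r) ->
    measurable_fun (Rplus : set RT) u.
  move=> mu; apply: (@eq_measurable_fun _ _ RT _ _ (fun r => Num.sqrt r * ((Num.sqrt r)^-1 * u r))).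
    move=> r; rewrite in_Rplus => r0; rewrite mulrA divff ?mul1r//.
    by rewrite gt_eqF// sqrtr_gt0.
  by apply: measurable_funM => //; apply: measurable_funTS; exact: measurable_sqrt.
split; apply: aux; [have := h1 mR measurableT|have := h2 mR measurableT]; by rewrite setTI.
Qed.

Lemma integral_Rplus (F G : R -> \bar R) : (forall r, 0 < r -> F r = G r) ->
  (forall r, r <= 0 -> G r = 0%E) ->
  (\int[leb]_(r in Rplus) F r = \int[leb]_r G r)%E.
Proof.
move=> FG G0; rewrite integral_mkcond; apply: eq_integral => r _.
by rewrite patchE in_Rplus; case: ltP => [/FG//|/G0 ->].
Qed.

Lemma L2_hd f : L2 f <-> SQ (hd f).
Proof.
have E : (\int[leb]_(r in Rplus) (r^-1 * normc_sq (f r))%:E =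
          \int[leb]_r (normc_sq (hd f r))%:E)%E.
  apply: integral_Rplus => r r0; first by rewrite normc_sq_hd.
  by rewrite hd_le0// normc_sq0.
split=> [[mf]|[mf]]; first by rewrite E => h; split => //; exact/cmeasurable_hd.
by move=> h; split; [exact/cmeasurable_hd|rewrite E].
Qed.

Lemma inner_cint f g : inner f g = cint leb (fun r => hd f r * (hd g r)^*).
Proof.
rewrite /inner /cint; apply: complexP => /=; rewrite /Rintegral; congr fine;
  (apply: integral_Rplus => r r0; last by rewrite hd_le0// mul0r);
  by rewrite hdM// ?ReZ ?ImZ.
Qed.

Lemma SQ_L1 h : SQ h -> leb.-integrable setT (fun r => (normc_sq (h r))%:E).
Proof.
move=> [mh hi]; apply/integrableP; split.
  exact: emeasurable_normc_sq.
by under eq_integral do rewrite gee0_abs ?lee_fin ?normc_sq_ge0//.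
Qed.

Lemma SQ_le h g : cmeasurable [set: RT] h -> SQ g ->
  (forall r, normc_sq (h r) <= normc_sq (g r)) -> SQ h.
Proof.
move=> mh [mg gi] hg; split => //; apply: le_lt_trans gi; apply: ge0_le_integral => //.
- by move=> r _; rewrite lee_fin normc_sq_ge0.
- exact: emeasurable_normc_sq.
- exact: emeasurable_normc_sq.
- by move=> r _; rewrite lee_fin.
Qed.

Lemma normc_sqM_le (x y : R[i]) : normc_sq (x * y) <= (normc_sq x + normc_sq y) ^+ 2.
Proof.
rewrite normc_sqM; have := normc_sq_ge0 x; have := normc_sq_ge0 y; nra.
Qed.

Lemma SQ_mul h g : SQ h -> SQ g -> cintegrable leb (fun r => h r * g r).
Proof.
move=> sh sg; apply: (@cintegrable_le _ _ RT leb _ (fun r => normc_sq (h r) + normc_sq (g r))).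
- by apply: cmeasurableM; [exact: sh.1|exact: sg.1].
- have := integrableD measurableT (SQ_L1 sh) (SQ_L1 sg).
  by apply: eq_integrable => // r _; rewrite /= EFinD.
- by move=> r; exact: normc_sqM_le.
- by move=> r; rewrite addr_ge0// normc_sq_ge0.
Qed.

Lemma SQJ h : SQ h -> SQ (fun r => (h r)^*).
Proof.
move=> sh; apply: (SQ_le _ sh); first by apply: cmeasurableJ; exact: sh.1.
by move=> r; rewrite normc_sqJ.
Qed.

Lemma SQ_linear c h g : SQ h -> SQ g -> SQ (fun r => c * h r + g r).
Proof.
move=> sh sg; have mh := sh.1; have mg := sg.1.
have mf : cmeasurable [set: RT] (fun r => c * h r + g r).
  by apply: cmeasurableD => //; apply: cmeasurableM => //; exact: cmeasurable_cst.
split => //; have i1 := integrableZl measurableT (2 * normc_sq c) (SQ_L1 sh).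
have i2 := integrableZl measurableT 2 (SQ_L1 sg).
have /integrableP[_] := integrableD measurableT i1 i2; apply: le_lt_trans.
apply: ge0_le_integral => //.
- by move=> r _; rewrite lee_fin normc_sq_ge0.
- exact: emeasurable_normc_sq.
- apply: measurableT_comp => //; apply: emeasurable_funD; [exact: measurable_int i1|exact: measurable_int i2].
- move=> r _; rewrite gee0_abs -?EFinM -?EFinD lee_fin.
    by apply: (le_trans (normc_sqD_le _ _)); rewrite normc_sqM mulrA.
  by rewrite addr_ge0// ?mulr_ge0 ?normc_sq_ge0.
Qed.

Lemma SQ0 : SQ (fun=> 0).
Proof.
split; first exact: cmeasurable_cst.
by under eq_integral do rewrite normc_sq0; rewrite integral0.
Qed.

Lemma L2_linear c f g : L2 f -> L2 g -> L2 (fun r => c * f r + g r).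
Proof.
move=> /L2_hd sf /L2_hd sg; apply/L2_hd.
rewrite (_ : hd _ = fun r => c * hd f r + hd g r); first exact: SQ_linear.
by apply/funext => r; exact: hd_linear.
Qed.

End SquareIntegrable.

(** * The Hilbert space of the half-line *)

Section Hspace.
Context {R : realType}.
Local Notation leb := (@lebesgue_measure R).
Local Notation RT := (measurableTypeR R).

Definition L2pred : {pred R -> R[i]} := fun f => `[< L2 f >].

Lemma L2_submod_closed : GRing.submod_closed L2pred.
Proof.
split=> [|c f g /asboolP hf /asboolP hg].
  apply/asboolP/L2_hd; rewrite (_ : hd _ = fun=> 0); first exact: SQ0.
  by apply/funext => r; rewrite /hd; case: ifP; rewrite ?mulr0.
by apply/asboolP; exact: L2_linear.
Qed.
HB.instance Definition _ := GRing.isSubmodClosed.Build _ _ L2pred L2_submod_closed.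

Record L2vec := MkL2vec { L2val : R -> R[i]; L2valP : L2val \in L2pred }.
HB.instance Definition _ := [isSub for L2val].
HB.instance Definition _ := [Choice of L2vec by <:].
HB.instance Definition _ := [SubChoice_isSubLmodule of L2vec by <:].

(** Square-integrable functions form a vector space under pointwise operations. Only these four
    properties are used of it, and the construction stays abstract. *)
Lemma Hspace : {H : lmodType R[i] & {Hfun : H -> R -> R[i] |
  [/\ forall x, L2 (Hfun x), forall f, L2 f -> exists x, Hfun x = f, injective Hfun &
      forall c x y r, Hfun (c *: x + y) r = c * Hfun x r + Hfun y r]}}.
Proof.
exists (L2vec : lmodType R[i]), L2val; split=> [x|f hf|x y|//].
- exact/asboolP/L2valP.
- by exists (MkL2vec (asboolT hf)).
- exact: val_inj.
Qed.

(** Functions rather than classes: agreeing almost everywhere is being at distance zero. *)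
Definition Hvec : lmodType R[i] := projT1 Hspace.
Definition Hfun : Hvec -> R -> R[i] := sval (projT2 Hspace).

Lemma HfunP x : L2 (Hfun x).
Proof. by have [h _ _ _] := svalP (projT2 Hspace); exact: h. Qed.

Lemma HfunE c (x y : Hvec) r : Hfun (c *: x + y) r = c * Hfun x r + Hfun y r.
Proof. by have [_ _ _ h] := svalP (projT2 Hspace); exact: h. Qed.

Lemma Hfun_inj : injective Hfun.
Proof. by have [_ _ h _] := svalP (projT2 Hspace). Qed.

Definition toH (f : R -> R[i]) : Hvec := xget 0 [set x | Hfun x = f].

Lemma toHK f : L2 f -> Hfun (toH f) = f.
Proof.
move=> hf; have [_ h _ _] := svalP (projT2 Hspace).
by apply: (@xgetPex _ 0 [set x | Hfun x = f]); exact: h.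
Qed.

Lemma HfunK x : toH (Hfun x) = x.
Proof. by apply: Hfun_inj; rewrite toHK//; exact: HfunP. Qed.

Lemma hdHE c (x y : Hvec) r :
  hd (Hfun (c *: x + y)) r = c * hd (Hfun x) r + hd (Hfun y) r.
Proof. by rewrite -hd_linear; congr (hd _ r); apply/funext => t; rewrite HfunE. Qed.

Lemma hdHB (x y : Hvec) r : hd (Hfun (x - y)) r = hd (Hfun x) r - hd (Hfun y) r.
Proof. by rewrite -scaleN1r addrC hdHE mulN1r addrC. Qed.

Lemma SQH (x : Hvec) : SQ (hd (Hfun x)).
Proof. exact/L2_hd/HfunP. Qed.

Lemma measurable_SQH (x : Hvec) :
  measurable_fun [set: RT] (fun r => (normc_sq (hd (Hfun x) r))%:E).
Proof. by apply: emeasurable_normc_sq; exact: (SQH x).1. Qed.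

Definition ipf (x y : Hvec) : R[i] := inner (Hfun x) (Hfun y).

Lemma ipf_linear a x y z : ipf (a *: x + y) z = a * ipf x z + ipf y z.
Proof.
have i1 := SQ_mul (SQH x) (SQJ (SQH z)); have i2 := SQ_mul (SQH y) (SQJ (SQH z)).
rewrite /ipf !inner_cint -cintZ// -cintD//; last exact: cintegrableZ.
by apply: eq_cint => r; rewrite hdHE mulrDl mulrA.
Qed.

Lemma ipfJ x y : (ipf x y)^* = ipf y x.
Proof.
have i1 := SQ_mul (SQH x) (SQJ (SQH y)).
rewrite /ipf !inner_cint -cintJ//; apply: eq_cint => r.
by rewrite rmorphM /= conjcK mulrC.
Qed.

Lemma mulJ_normc_sq (z : R[i]) : complex.Re (z * z^*) = normc_sq z.
Proof. by rewrite -normc_sqE. Qed.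

Lemma Re_ipf x : (complex.Re (ipf x x))%:E =
  (\int[leb]_r (normc_sq (hd (Hfun x) r))%:E)%E.
Proof.
have i1 := SQ_L1 (SQH x); rewrite /ipf inner_cint /cint /=.
rewrite [in LHS](_ : (fun _ => _) = fun r => normc_sq (hd (Hfun x) r)).
  by rewrite /Rintegral fineK//; exact: integrable_fin_num.
by apply/funext => r; exact: mulJ_normc_sq.
Qed.

Lemma ipf_ge0 x : 0 <= ipf x x.
Proof.
have im0 : complex.Im (ipf x x) = 0.
  have := congr1 (@complex.Im R) (ipfJ x x); rewrite ImJ.
  by move: (complex.Im _) => b h; lra.
have re0 : 0 <= complex.Re (ipf x x).
  by rewrite -lee_fin Re_ipf; apply: integral_ge0 => r _; rewrite lee_fin normc_sq_ge0.
by rewrite lecE; apply/andP; split; [apply/eqP; exact: im0|exact: re0].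
Qed.

(** Likewise abstract: an inner product is unfolded into an integral only by rewriting. *)
Lemma ipH_sig : {b : semi_inner Hvec | forall x y, b x y = inner (Hfun x) (Hfun y)}.
Proof. by exists (SemiInner ipf_linear ipfJ ipf_ge0). Qed.

Definition ipH : semi_inner Hvec := sval ipH_sig.

Lemma ipHE x y : ipH x y = inner (Hfun x) (Hfun y).
Proof. exact: (svalP ipH_sig). Qed.

Lemma qnHE x : (qn ipH x)%:E = (\int[leb]_r (normc_sq (hd (Hfun x) r))%:E)%E.
Proof. by rewrite /qn ipHE; exact: Re_ipf. Qed.

Lemma ae_Rplus (P : R -> Prop) : {ae leb, forall r, Rplus r -> P r} ->
  (forall r, r <= 0 -> P r) -> {ae leb, forall r, P r}.
Proof.
move=> h h0; apply: (@ae_imp _ _ RT leb _ _ h) => r hr; have [r0|r0] := leP r 0; first exact: h0.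
by apply: hr; rewrite /Rplus /= in_itv /= andbT.
Qed.

Lemma L2eq_hd (f g : R -> R[i]) : L2eq f g <-> {ae leb, forall r, hd f r = hd g r}.
Proof.
split=> h.
  apply: ae_Rplus => [|r r0]; last by rewrite !hd_le0.
  by apply: (@ae_imp _ _ RT leb _ _ h) => r /[apply] fg; rewrite /hd fg.
apply: (@ae_imp _ _ RT leb _ _ h) => r hr; rewrite /Rplus /= in_itv /= andbT => r0.
have s0 : Num.sqrt r != 0 by rewrite gt_eqF// sqrtr_gt0.
move: hr; rewrite /hd r0 => /(congr1 (fun z => (Num.sqrt r)%:C * z)).
by rewrite !mulrA -rmorphM /= divff// !mul1r.
Qed.

Lemma qn_ae x : qn ipH x = 0 <-> {ae leb, forall r, hd (Hfun x) r = 0}.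
Proof.
have [mh _] := SQH x.
have mn : measurable_fun [set: RT] (fun r => (normc_sq (hd (Hfun x) r))%:E).
  exact: emeasurable_normc_sq.
have E : (\int[leb]_r (normc_sq (hd (Hfun x) r))%:E =
          \int[leb]_r `|(normc_sq (hd (Hfun x) r))%:E|)%E.
  by apply: eq_integral => r _; rewrite gee0_abs// lee_fin normc_sq_ge0.
have I := @ae_eq_integral_abs _ RT R leb setT measurableT _ mn.
split=> [q0|h].
  have /I : (\int[leb]_r `|(normc_sq (hd (Hfun x) r))%:E| = 0)%E by rewrite -E -qnHE q0.
  by move=> h; apply: (@ae_imp _ _ RT leb _ _ h) => r /(_ Logic.I) [] /normc_sq_eq0.
apply: EFin_inj; rewrite qnHE E; apply/I.
by apply: (@ae_imp _ _ RT leb _ _ h) => r {}h _; rewrite h normc_sq0.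
Qed.

Lemma L2eq_qn x y : L2eq (Hfun x) (Hfun y) <-> qn ipH (x - y) = 0.
Proof.
rewrite L2eq_hd qn_ae; split=> h; apply: (@ae_imp _ _ RT leb _ _ h) => r; rewrite hdHB.
  by move=> ->; rewrite subrr.
by move/eqP; rewrite subr_eq0 => /eqP.
Qed.

Lemma norm2E x : norm2 (Hfun x) = Num.sqrt (qn ipH x).
Proof.
congr Num.sqrt; apply: EFin_inj; rewrite qnHE /Rintegral.
rewrite (integral_Rplus (G := fun r => (normc_sq (hd (Hfun x) r))%:E)).
- by rewrite fineK//; apply: integrable_fin_num => //; exact: SQ_L1 (SQH x).
- by move=> r r0; rewrite normc_sq_hd.
- by move=> r r0; rewrite hd_le0// normc_sq0.
Qed.

Lemma L2_dh (h : R -> R[i]) : SQ h -> L2 (dh h).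
Proof.
move=> sh; apply/L2_hd; apply: (SQ_le _ sh).
  rewrite (_ : hd _ = fun r : RT => if 0 < r then h r else 0).
    apply: cmeasurable_ifT; [|exact: sh.1|exact: cmeasurable_cst].
    exact: measurable_fun_ltr.
  by apply/funext => r; case: ifPn => [/hd_dh//|]; rewrite -leNgt => /hd_le0.
move=> r; have [r0|r0] := leP r 0; last by rewrite hd_dh.
by rewrite hd_le0// normc_sq0 normc_sq_ge0.
Qed.

(** Fatou, applied to |x - f_n|^2. *)
Lemma L2_lim_pointwise (f : nat -> Hvec) x (h : R -> R[i]) :
  qn ipH (x - f n) @[n --> \oo] --> (0 : R) ->
  {ae leb, forall r, cvg0c (fun n => h r - hd (Hfun (f n)) r)} ->
  {ae leb, forall r, hd (Hfun x) r = h r}.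
Proof.
move=> q0 hf.
pose g n r : \bar R := (normc_sq (hd (Hfun (x - f n)) r))%:E.
have mg n : measurable_fun [set: RT] (g n).
  exact: measurable_SQH.
have g0 n r : (0 <= g n r)%E by rewrite lee_fin normc_sq_ge0.
have := @fatou _ RT R leb setT measurableT g mg (fun n r _ => g0 n r).
have -> : limn_einf (fun n => \int[leb]_r g n r)%E = 0%E.
  have : (\int[leb]_r g n r)%E @[n --> \oo] --> 0%E.
    rewrite (_ : (fun n => _) = EFin \o (fun n => qn ipH (x - f n))).
      by apply: cvg_EFin => //; exact: nearW.
    by apply/funext => n; rewrite /= qnHE.
  by move=> c; rewrite (is_cvg_limn_einfE (cvgP _ c)); exact: cvg_lim.
move=> i0.
have ml : measurable_fun [set: RT] (fun r => limn_einf (g ^~ r)).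
  apply: (@measurableT_comp _ _ _ _ _ _ (-%E : \bar R -> \bar R)).
    exact: oppe_measurable.
  apply: (@measurable_fun_limn_esup _ RT R setT (fun n r => - g n r)%E) => n.
  exact: measurableT_comp.
have l0 r : (0 <= limn_einf (g ^~ r))%E.
  rewrite limn_einf_lim; apply: lime_ge; first exact: is_cvg_einfs.
  by apply: nearW => n; apply: le_ereal_inf_tmp => _ [k _ <-].
have /(@ae_eq_integral_abs _ RT R leb setT measurableT _ ml) :
    (\int[leb]_r `|limn_einf (g ^~ r)| = 0)%E.
  apply/eqP; rewrite eq_le integral_ge0// andbT; apply: le_trans i0.
  rewrite le_eqVlt; apply/orP; left; apply/eqP; apply: eq_integral => r _.
  exact: gee0_abs.
move=> h0; apply: (@ae_imp2 _ _ RT leb _ _ _ hf h0) => r c /(_ Logic.I) /= l.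
have c2 : g n r @[n --> \oo] --> (normc_sq (hd (Hfun x) r - h r))%:E.
  apply: cvg_EFin; first exact: nearW.
  rewrite (_ : fine \o g ^~ r = fun n => normc_sq ((hd (Hfun x) r - h r) +
      (h r - hd (Hfun (f n)) r))); first exact: cvg0c_normc_sq.
  by apply/funext => n; rewrite /= hdHB addrA subrK.
have := is_cvg_limn_einfE (cvgP _ c2); rewrite l (cvg_lim _ c2)// => -[] /esym/normc_sq_eq0/eqP.
by rewrite subr_eq0 => /eqP.
Qed.

(** * Completeness *)

Local Notation half := (2^-1 : R).

Lemma half_pow_small (e : R) : 0 < e -> exists m, half ^+ m <= e.
Proof.
move=> e0; have h1 : `|half| < 1 by rewrite ger0_norm ?invr_ge0// invf_lt1// ltr1n.
have /cvgrPdist_le/(_ _ e0) [N _ /(_ N (leqnn N))] := cvg_expr h1.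
rewrite /= sub0r normrN ger0_norm; first by exists N.
by rewrite exprn_ge0// invr_ge0.
Qed.

Lemma sum_half_pow (m n : nat) : \sum_(k < n) half ^+ (m + k) <= 2 * half ^+ m.
Proof.
suff : \sum_(k < n) half ^+ (m + k) = 2 * half ^+ m - 2 * half ^+ (m + n).
  by move=> ->; rewrite gerBl mulr_ge0// exprn_ge0// invr_ge0.
elim: n => [|n IH]; first by rewrite big_ord0 addn0 subrr.
rewrite big_ord_recr /= IH addnS exprS.
by move: (half ^+ _) (half ^+ _) => a b; field.
Qed.

Lemma cvg_geometric_cauchy (u : nat -> R) (K : R) : 0 <= K ->
  (forall m n, (u (m + n)%N - u m) ^+ 2 <= 2 * half ^+ m * K) -> cvgn u.
Proof.
move=> K0 uK; apply/cauchy_cvgP/cauchy_exP => e e0.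
have [|m hm] := @half_pow_small (e ^+ 2 / (4 * (K + 1))).
  by rewrite divr_gt0 ?exprn_gt0// mulr_gt0// ltr_wpDl.
exists (u m), m => // n /= mn; rewrite /ball /= distrC.
rewrite -(@ltr_pXn2r _ 2)// ?nnegrE ?(ltW e0)// real_normK ?num_real//.
rewrite -(subnKC mn); apply: (le_lt_trans (uK _ _)).
have K1 : 0 < K + 1 by lra.
move: hm; rewrite ler_pdivlMr ?mulr_gt0// => hm.
have m0 : 0 < half ^+ m by rewrite exprn_gt0// invr_gt0.
move: (half ^+ m) m0 hm => q q0 hm; have := mulr_ge0 (ltW q0) K0; nra.
Qed.

(** Riesz-Fischer: along a subsequence with increments of squared norm at most 4^-k, the sum of
    2^k |f_(k+1) - f_k|^2 is integrable, hence finite a.e.; by Cauchy-Schwarz it controls the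
    tails of the telescoping series, both pointwise and in mean square. *)
Lemma geometric_cauchy_cvg (f : nat -> Hvec) :
  (forall k, qn ipH (f k.+1 - f k) <= half ^+ (2 * k)) ->
  exists l, forall m, qn ipH (f m - l) <= 4 * half ^+ m.
Proof.
move=> fd; pose F k r := hd (Hfun (f k)) r.
pose a k r := 2 ^+ k * normc_sq (F k.+1 r - F k r).
pose S r := (\sum_(0 <= k <oo) (a k r)%:E)%E.
have h0 m : 0 <= half ^+ m by rewrite exprn_ge0// invr_ge0.
have p0 m : 0 <= 2 ^+ m :> R by rewrite exprn_ge0.
have a0 k r : 0 <= a k r by rewrite mulr_ge0// normc_sq_ge0.
have mF k : cmeasurable [set: RT] (F k) by exact: (SQH _).1.
have ma k : measurable_fun [set: RT] (fun r => (a k r)%:E).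
  apply/measurable_EFinP; apply: measurable_funM => //.
  by apply: measurable_normc_sq; exact: cmeasurableB.
have mS : measurable_fun [set: RT] S by apply: ge0_emeasurable_sum => // k r _ _; rewrite lee_fin.
have S0 r : (0 <= S r)%E by apply: nneseries_ge0 => k _ _; rewrite lee_fin.
have IS : (\int[leb]_r S r <= 2%:E)%E.
  rewrite (@integral_nneseries _ RT)//; last by move=> k r _; rewrite lee_fin.
  have E k : (\int[leb]_r (a k r)%:E = (2 ^+ k * qn ipH (f k.+1 - f k))%:E)%E.
    under eq_integral do rewrite EFinM; rewrite ge0_integralZl//; last 2 first.
    - apply: emeasurable_normc_sq.
      exact: cmeasurableB.
    - by move=> r _; rewrite lee_fin normc_sq_ge0.
    by rewrite EFinM qnHE; congr (_ * _)%E; apply: eq_integral => r _; rewrite hdHB.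
  rewrite (eq_eseriesr (fun k _ => E k)); apply: nneseries_le_EFin => [k|n].
    by rewrite mulr_ge0// qn_ge0.
  apply: (@le_trans _ _ (\sum_(k < n) half ^+ (0 + k))).
    apply: ler_sum => k _; apply: (le_trans (ler_wpM2l (p0 k) (fd k))).
    by rewrite mul2n -addnn exprD mulrA -exprMn divff// expr1n mul1r.
  by apply: le_trans (sum_half_pow _ _) _; rewrite expr0 mulr1.
have tele r m n s : (S r <= s%:E)%E ->
    normc_sq (F (m + n) r - F m r) <= 2 * half ^+ m * s.
  move=> Ss; pose z k := F (m + k).+1 r - F (m + k) r.
  have -> : F (m + n) r - F m r = \sum_(k < n) z k.
    rewrite -(big_mkord xpredT z); under eq_bigr do rewrite /z -addnS.
    by rewrite (@telescope_sumr _ 0 n (fun k => F (m + k)%N r))// addn0.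
  have bz k : normc_sq (z k) <= half ^+ (m + k) * a (m + k)%N r.
    by rewrite /a mulrA -exprMn mulVf// expr1n mul1r.
  apply: (le_trans (@CauchySchwarz_sum _ z (fun k => half ^+ (m + k))
    (fun k => a (m + k)%N r) n _ _ bz)) => //.
  apply: ler_pM => //; [exact: sumr_ge0|exact: sumr_ge0|exact: sum_half_pow|].
  rewrite -lee_fin; apply: le_trans Ss; apply: (@le_trans _ _ (\sum_(k < m + n) (a k r)%:E)%E).
    rewrite sumEFin lee_fin big_split_ord /= lerDr; exact: sumr_ge0.
  rewrite -(big_mkord xpredT (fun k => (a k r)%:E)).
  by apply: nneseries_lim_ge => k _ _; rewrite lee_fin.
(* Setting F_k to 0 where S is infinite makes the limit exist at every point. *)
pose G k r := if (S r < +oo)%E then F k r else 0.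
pose h r := Complex (limn (fun k => complex.Re (G k r))) (limn (fun k => complex.Im (G k r))).
have mG k : cmeasurable [set: RT] (G k).
  apply: (cmeasurable_ifT _ (mF k)); last exact: cmeasurable_cst.
  exact: measurable_fun_lte.
have teleG r m n s : (S r <= s%:E)%E ->
    normc_sq (G (m + n) r - G m r) <= 2 * half ^+ m * s.
  move=> Ss; rewrite /G; case: ifP => _; first exact: tele.
  rewrite subrr normc_sq0 !mulr_ge0//.
  by rewrite -lee_fin; exact: le_trans Ss.
have Gh r : cvg0c (fun k => h r - G k r).
  have part (p : R[i] -> R) : (forall x y, p (x - y) = p x - p y) ->
      (forall x, p x ^+ 2 <= normc_sq x) -> cvgn (fun k => p (G k r)).
    move=> pB p_le; have [Sr|] := ltP (S r) +oo%E; last first.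
      rewrite leye_eq => /eqP Sr; rewrite /G; under eq_fun do rewrite Sr ltxx.
      exact: is_cvg_cst.
    have /fineK SE : S r \is a fin_num by rewrite ge0_fin_numE.
    apply: (@cvg_geometric_cauchy _ (fine (S r))); first exact: fine_ge0.
    move=> m n; rewrite -pB; apply: (le_trans (p_le _)); apply: teleG.
    by rewrite SE.
  apply: Re_Im_cvg0c => /=.
    apply: part; last exact: Re_le_normc_sq.
    by move=> x y; rewrite ReD ReN.
  apply: part => [x y|x]; first by rewrite ImD ImN.
  by rewrite /normc_sq lerDr sqr_ge0.
have mh : cmeasurable [set: RT] h.
  split.
    apply: (@measurable_fun_cvg _ RT R setT (fun k r => complex.Re (G k r))) => [k|r _].
      exact: (mG k).1.
    exact: cvg0c_Re (Gh r).
  apply: (@measurable_fun_cvg _ RT R setT (fun k r => complex.Im (G k r))) => [k|r _].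
    exact: (mG k).2.
  exact: cvg0c_Im (Gh r).
have hF m r : ((normc_sq (F m r - h r))%:E <= (2 * half ^+ m)%:E * S r)%E.
  have [Sr|] := ltP (S r) +oo%E; last first.
    rewrite leye_eq => /eqP ->; rewrite gt0_muley ?leey//.
  have /fineK SE : S r \is a fin_num by rewrite ge0_fin_numE.
  rewrite -SE -EFinM lee_fin.
  have c : normc_sq ((F m r - h r) + (h r - G (m + n)%N r)) @[n --> \oo] -->
      normc_sq (F m r - h r).
    apply: cvg0c_normc_sq; have := Gh r; rewrite /cvg0c -(@cvg_shiftn m).
    by under [X in _ -> X]eq_cvg do rewrite addnC.
  apply: (cvgr_to_le c); apply: nearW => n; rewrite addrA subrK /G Sr.
  by rewrite -normc_sqN opprB tele// SE.
have IhF m : (\int[leb]_r (normc_sq (F m r - h r))%:E <= (4 * half ^+ m)%:E)%E.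
  apply: (@le_trans _ _ (\int[leb]_r ((2 * half ^+ m)%:E * S r))%E).
    apply: ge0_le_integral => //.
    - by move=> r _; rewrite lee_fin normc_sq_ge0.
    - apply: emeasurable_normc_sq; exact: cmeasurableB.
    - exact: emeasurable_funM.
  rewrite ge0_integralZl//.
  apply: (@le_trans _ _ ((2 * half ^+ m)%:E * 2%:E)%E).
    by rewrite lee_wpmul2l// lee_fin mulr_ge0.
  by rewrite -EFinM lee_fin; lra.
have sh : SQ h.
  have s0 : SQ (fun r => F 0%N r - h r).
    split; first exact: cmeasurableB.
    by apply: (le_lt_trans (IhF 0%N)); rewrite ltry.
  have := SQ_linear (-1) s0 (SQH (f 0%N)).
  rewrite (_ : (fun _ => _) = h)//; apply/funext => r.
  by rewrite mulN1r opprB subrK.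
exists (toH (dh h)) => m; rewrite -lee_fin qnHE; apply: le_trans (IhF m).
apply: ge0_le_integral => //.
- by move=> r _; rewrite lee_fin normc_sq_ge0.
- exact: measurable_SQH.
- by apply: emeasurable_normc_sq; exact: cmeasurableB.
- move=> r _; rewrite lee_fin; have [r0|r0] := leP r 0.
    by rewrite hd_le0// normc_sq0 normc_sq_ge0.
  by rewrite hdHB (toHK (L2_dh sh)) hd_dh.
Qed.

(** A Cauchy sequence has a subsequence to which [geometric_cauchy_cvg] applies. *)
Lemma H_complete : hilbert_complete ipH.
Proof.
move=> x xC.
have /choice [N hN] k : exists N, forall m n, (N <= m)%N -> (N <= n)%N ->
    qn ipH (x m - x n) <= half ^+ (2 * k).
  by apply: xC; rewrite exprn_gt0// invr_gt0.
pose phi k := (\sum_(i < k.+1) N i)%N.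
have Nphi k : (N k <= phi k)%N by rewrite /phi big_ord_recr leq_addl.
have phiS k : (N k <= phi k.+1)%N.
  by rewrite /phi big_ord_recr /=; exact: leq_trans (Nphi k) (leq_addr _ _).
have [l hl] := @geometric_cauchy_cvg (x \o phi) (fun k => hN k _ _ (phiS k) (Nphi k)).
(* 2 * half ^+ (2 * m) + 2 * (4 * half ^+ m) is at most 10 * half ^+ m. *)
exists l; apply/cvgrPdist_le => e e0.
have [|m hm] := @half_pow_small (e / 10); first by rewrite divr_gt0.
exists (phi m) => // n /= mn; rewrite sub0r normrN ger0_norm ?qn_ge0//.
have -> : x n - l = (x n - x (phi m)) + (x (phi m) - l) by rewrite addrA subrK.
apply: (le_trans (qnD_le _ _ _)).
have h1 := hN m n (phi m) (leq_trans (Nphi m) mn) (Nphi m).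
have h2 := hl m; rewrite /= in h2.
have h3 : half ^+ (2 * m) <= half ^+ m.
  by rewrite mul2n -addnn exprD ler_piMl ?exprn_ge0 ?exprn_ile1 ?invr_ge0// invf_le1// ler1n.
move: (qn ipH (x n - _)) (qn ipH (_ - l)) (half ^+ _) (half ^+ _) h1 h2 h3 hm.
by move=> *; lra.
Qed.

End Hspace.

(** * Operators *)

Section Operators.
Context {R : realType}.
Local Notation leb := (@lebesgue_measure R).
Local Notation RT := (measurableTypeR R).
Local Notation H := (@Hvec R).
Local Notation b := (@ipH R).
Implicit Types (A B T : operator R) (x y z : H) (f g h : R -> R[i]).

Lemma toH_linear c f g : L2 f -> L2 g ->
  toH (fun r => c * f r + g r) = c *: toH f + toH g.
Proof.
move=> hf hg; rewrite -[RHS]HfunK; congr toH; apply/funext => r.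
by rewrite HfunE !toHK.
Qed.

(** The map of vectors induced by an operator on functions, kept abstract like the vectors. *)
Lemma lift_sig : {l : operator R -> H -> H | forall A x, l A x = toH (A (Hfun x))}.
Proof. by exists (fun A x => toH (A (Hfun x))). Qed.

Definition lift : operator R -> H -> H := sval lift_sig.

Lemma liftH A x : lift A x = toH (A (Hfun x)).
Proof. exact: (svalP lift_sig). Qed.

Lemma innerE f g : L2 f -> L2 g -> inner f g = b (toH f) (toH g).
Proof. by move=> hf hg; rewrite ipHE !toHK. Qed.

Lemma L2eqE f g : L2 f -> L2 g -> L2eq f g <-> qn b (toH f - toH g) = 0.
Proof. by move=> hf hg; rewrite -L2eq_qn !toHK. Qed.

Section Bounded.
Variable A : operator R.
Hypothesis Abd : bounded_operator A.

Lemma bounded_L2 f : L2 f -> L2 (A f).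
Proof. by case: Abd => h _ _; exact: h. Qed.

Lemma liftE x : Hfun (lift A x) = A (Hfun x).
Proof. by rewrite liftH toHK//; exact/bounded_L2/HfunP. Qed.

Lemma lift_toH f : L2 f -> toH (A f) = lift A (toH f).
Proof. by move=> hf; rewrite liftH toHK. Qed.

Lemma lift_wlinear : wlinear b (lift A).
Proof.
move=> a x y z; rewrite -ip_linear; apply: ip_eq_null; apply/L2eq_qn.
case: Abd => _ h _; have := h a _ _ (HfunP x) (HfunP y).
rewrite liftE; congr L2eq.
  by congr A; apply/funext => r; rewrite HfunE.
by apply/funext => r; rewrite HfunE !liftE.
Qed.

Lemma lift_bounded : exists2 M, 0 <= M & forall x, qn b (lift A x) <= M * qn b x.
Proof.
case: Abd => _ _ [M hM]; exists (M ^+ 2); first exact: sqr_ge0.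
move=> x; have := hM _ (HfunP x); rewrite -liftE !norm2E => h.
have h0 : 0 <= M * Num.sqrt (qn b x) by exact: le_trans (sqrtr_ge0 _) h.
have := h; rewrite -(@ler_pXn2r _ 2)// ?nnegrE ?sqrtr_ge0//.
by rewrite exprMn !sqr_sqrtr// qn_ge0.
Qed.

Lemma lift_L2eq f g : L2 f -> L2 g -> L2eq f g -> L2eq (A f) (A g).
Proof.
move=> hf hg /L2eqE h; apply/L2eqE; [exact: bounded_L2|exact: bounded_L2|].
rewrite !lift_toH//; have [M M0 hM] := lift_bounded.
have E : qn b (lift A (toH f) - lift A (toH g) - lift A (toH f - toH g)) = 0.
  by apply: qn_ext => z; rewrite !ipBl wlinearB ?subrr//; exact: lift_wlinear.
rewrite (qn_eq_null E); apply/eqP; rewrite eq_le qn_ge0 andbT.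
by apply: (le_trans (hM _)); rewrite h// mulr0.
Qed.

End Bounded.

Lemma operator_bounded (T : operator R) M : (forall f, L2 f -> L2 (T f)) ->
  wlinear b (lift T) -> (forall x, qn b (lift T x) <= M * qn b x) -> bounded_operator T.
Proof.
move=> T2 TL TM; split=> // [c f g hf hg|].
  have hfg := L2_linear c hf hg; have h2 := L2_linear c (T2 _ hf) (T2 _ hg).
  apply/L2eqE => //; first exact: T2.
  have -> : toH (T (fun r => c * f r + g r)) = lift T (c *: toH f + toH g).
    by rewrite -toH_linear// liftH toHK.
  rewrite toH_linear; [|exact: T2|exact: T2].
  rewrite (_ : toH (T f) = lift T (toH f)); last by rewrite liftH toHK.
  rewrite (_ : toH (T g) = lift T (toH g)); last by rewrite liftH toHK.
  exact: wlinear_null.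
exists (Num.sqrt M) => f hf; rewrite -(toHK hf) -[T _](toHK (T2 _ _)); last by rewrite toHK.
rewrite !norm2E -liftH.
have [M0|M0] := leP 0 M.
  by rewrite -sqrtrM// ler_sqrt// ?mulr_ge0 ?qn_ge0.
rewrite ler0_sqrtr ?mulr_ge0 ?sqrtr_ge0//.
by apply: (le_trans (TM _)); rewrite nmulr_rle0// qn_ge0.
Qed.

Lemma onbH e : orthonormal_basis e -> onb b (fun n => toH (e n)).
Proof.
move=> [e2 eo ec]; split=> [i j|x hx]; first by rewrite -innerE.
have h : L2eq (Hfun x) (fun=> 0).
  by apply: ec => [|n]; [exact: HfunP|rewrite -(hx n) ipHE toHK].
apply/qn_ae; move/L2eq_hd : h => h; apply: (@ae_imp _ _ RT leb _ _ h) => r ->.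
by rewrite /hd mulr0 if_same.
Qed.

(** Adjoints exist by the Riesz representation, which uses an orthonormal basis; trace-class and
    Hilbert-Schmidt operators provide one. *)
Section Adjoint.
Variable e : nat -> H.
Hypothesis eON : onb b e.

Lemma adjointP A : bounded_operator A -> forall g, L2 g ->
  L2 (adjoint A g) /\ forall f, L2 f -> inner (A f) g = inner f (adjoint A g).
Proof.
move=> Abd g hg; rewrite /adjoint.
suff [h hh] : exists h, L2 h /\ forall f, L2 f -> inner (A f) g = inner f h.
  by apply: (@xgetPex _ _ [set h | L2 h /\ forall f, L2 f -> inner (A f) g = inner f h]); exists h.
have [M M0 hM] := lift_bounded Abd.
have [||y hy] := @Riesz _ _ b (@H_complete R) e eON (fun x => b (lift A x) (toH g)) (M * qn b (toH g)).
- by move=> a x z; exact: lift_wlinear.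
- move=> x; apply: (le_trans (CauchySchwarz _ _ _)).
  by rewrite mulrAC ler_wpM2r ?qn_ge0.
exists (Hfun y); split=> [|f hf]; first exact: HfunP.
by rewrite innerE//; [rewrite lift_toH// hy innerE ?HfunK//; exact: HfunP|exact: bounded_L2].
Qed.

Lemma lift_adjoint A : bounded_operator A -> forall x y,
  b (lift A x) y = b x (lift (adjoint A) y).
Proof.
move=> Abd x y; have [h1 h2] := adjointP Abd (HfunP y).
rewrite ipHE liftE// (h2 _ (HfunP x)) innerE//; last exact: HfunP.
by rewrite HfunK liftH.
Qed.

Lemma lift_adjoint_r A : bounded_operator A -> forall x y,
  b y (lift A x) = b (lift (adjoint A) y) x.
Proof. by move=> Abd x y; rewrite -(ipJ b) lift_adjoint// ipJ. Qed.

Lemma adjoint_bounded A : bounded_operator A -> bounded_operator (adjoint A).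
Proof.
move=> Abd; have [M M0 hM] := lift_bounded Abd.
apply: (@operator_bounded _ M) => [f hf|a x y z|x].
- by have [] := adjointP Abd hf.
- rewrite -(lift_adjoint_r Abd z).
  rewrite -(lift_adjoint_r Abd z x).
  rewrite -(lift_adjoint_r Abd z y).
  by rewrite ip_linear.
- set q := qn b _; have q0 : 0 <= q by exact: qn_ge0.
  have : q ^+ 2 <= (M * q) * qn b x.
    rewrite /q {1}/qn -(lift_adjoint_r Abd); apply: (le_trans (Re_le_normc_sq _)).
    rewrite -normc_sqJ ipJ; apply: (le_trans (CauchySchwarz _ _ _)).
    by rewrite ler_wpM2r ?qn_ge0.
  have [->|qn0] := eqVneq q 0; first by rewrite mulr_ge0 ?qn_ge0.
  by rewrite expr2 mulrAC [M * qn b x * q]mulrC ler_pM2l// lt_def qn0.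
Qed.

Lemma comp_bounded A B : bounded_operator A -> bounded_operator B ->
  bounded_operator (fun f => A (B f)).
Proof.
move=> Abd Bbd; have [M M0 hM] := lift_bounded Abd; have [N N0 hN] := lift_bounded Bbd.
have E x : lift (fun f => A (B f)) x = lift A (lift B x).
  by rewrite !liftH toHK//; exact/(bounded_L2 Bbd)/HfunP.
apply: (@operator_bounded _ (M * N)) => [f hf|a x y z|x].
- exact/(bounded_L2 Abd)/(bounded_L2 Bbd).
- rewrite !E -(lift_wlinear Abd a); apply: ip_eq_null.
  have h := wlinear_null (lift_wlinear Bbd) a x y.
  move/L2eq_qn: h => /(lift_L2eq Abd (HfunP _) (HfunP _)).
  by rewrite -!liftE// => /L2eq_qn.
- by rewrite E; apply: (le_trans (hM _)); rewrite -mulrA ler_wpM2l.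
Qed.

Lemma lift_comp A B : bounded_operator B -> forall x,
  lift (fun f => A (B f)) x = lift A (lift B x).
Proof. by move=> Bbd x; rewrite !liftH toHK//; exact/(bounded_L2 Bbd)/HfunP. Qed.

Lemma ip_normal B : bounded_operator B -> forall x y,
  b (lift (fun f => adjoint B (B f)) x) y = b (lift B x) (lift B y).
Proof. by move=> Bbd x y; rewrite (lift_comp _ Bbd) lift_adjoint_r. Qed.

Lemma normal_bounded B : bounded_operator B ->
  bounded_operator (fun f => adjoint B (B f)).
Proof. by move=> Bbd; apply: comp_bounded => //; exact: adjoint_bounded. Qed.

End Adjoint.

Lemma norm2_sq f : L2 f -> norm2 f ^+ 2 = qn b (toH f).
Proof. by move=> hf; rewrite -{1}(toHK hf) norm2E sqr_sqrtr// qn_ge0. Qed.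

(** B^* B is positive, so it is its own absolute value, and its trace is the squared
    Hilbert-Schmidt norm of B. *)
Lemma trace_class_normal B : Hilbert_Schmidt B ->
  trace_class (fun f => adjoint B (B f)).
Proof.
move=> [Bbd [e [eON Be]]]; have eH := onbH eON; pose T f := adjoint B (B f).
have Tbd : bounded_operator T by exact: normal_bounded eH _ Bbd.
have TB x y : b (lift T x) y = b (lift B x) (lift B y) by exact: (ip_normal eH Bbd).
split => //; exists T, e; split => //.
- split => // [f hf|f hf].
    by rewrite innerE ?(lift_toH T)// ?TB ?ip_ge0//; exact: (bounded_L2 Tbd).
  have hT : L2 (T f) by exact: (bounded_L2 Tbd).
  have Tabd := adjoint_bounded eH Tbd.
  apply/L2eqE; [exact: (bounded_L2 Tbd)|exact: (bounded_L2 Tabd)|].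
  rewrite (lift_toH T hT) (lift_toH (adjoint T) hT).
  apply: qn_ext => z; rewrite ipBl -(lift_adjoint_r eH Tbd) TB.
  by rewrite -[X in _ - X](ipJ b) TB (ipJ b) subrr.
- apply: le_lt_trans Be; apply: lee_nneseries => n _.
    move=> _; case: eON => e2 _ _.
    rewrite innerE//; last exact: (bounded_L2 Tbd).
    by rewrite lift_toH// TB lee_fin; exact: (qn_ge0 b).
  case: eON => e2 _ _.
  rewrite innerE//; last exact: (bounded_L2 Tbd).
  rewrite lift_toH// TB norm2_sq; last exact: (bounded_L2 Bbd).
  by rewrite lift_toH.
Qed.

Lemma trace_class_rank_one A : trace_class A -> exists (e : nat -> R -> R[i]) u w,
  [/\ orthonormal_basis e, summable_sq b u, summable_sq b w &
      rank_one_sum b (lift A) u w].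
Proof.
move=> [Abd [P [e [[Pbd P0 PPA] eON Ptr]]]]; have eH := onbH eON.
have [M M0 hM] := lift_bounded Pbd.
have P0' x : 0 <= b (lift P x) x by rewrite ipHE liftE//; exact/P0/HfunP.
have PPA' x y : b (lift P (lift P x)) y = b (lift A x) (lift A y).
  rewrite -[RHS](ipJ b) (lift_adjoint eH Abd) (ipJ b).
  apply: ip_eq_null; apply/L2eq_qn.
  rewrite !(liftE Pbd) (liftE (adjoint_bounded eH Abd)) (liftE Abd).
  exact/PPA/HfunP.
pose c n := complex.Re (b (lift P (toH (e n))) (toH (e n))).
have cE n : complex.Re (inner (P (e n)) (e n)) = c n.
  case: eON => e2 _ _; rewrite innerE//; last exact: (bounded_L2 Pbd).
  by rewrite lift_toH.
have c0 n : 0 <= c n by have := P0' (toH (e n)); rewrite lecE => /andP[].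
have tr : (\sum_(0 <= n <oo) (c n)%:E < +oo)%E.
  by move: Ptr; under eq_eseriesr do rewrite cE.
have s0 : (0 <= \sum_(0 <= n <oo) (c n)%:E)%E by apply: nneseries_ge0 => n _ _; rewrite lee_fin.
have cK n : \sum_(k < n) c k <= fine (\sum_(0 <= n <oo) (c n)%:E)%E.
  rewrite -lee_fin fineK ?ge0_fin_numE// -sumEFin -(big_mkord xpredT (fun k => (c k)%:E)).
  by apply: nneseries_lim_ge => k _ _; rewrite lee_fin.
have [u [w [h1 h2 h3]]] := trace_class_factor (@H_complete R) eH
  (lift_wlinear Pbd) (lift_wlinear Abd) hM P0' PPA' cK.
by exists e, u, w.
Qed.

(** * Multiplication by r^(-1/2) and truncation to windows *)

Lemma mulJR (a : R) (x y : R[i]) : x * (a%:C * y)^* = a%:C * x * y^*.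
Proof. by case: x y => [? ?] [? ?]; apply: complexP; rewrite /=; ring. Qed.

Lemma eq_inner f g f' g' : (forall r, hd f r * (hd g r)^* = hd f' r * (hd g' r)^*) ->
  inner f g = inner f' g'.
Proof. by move=> h; rewrite !inner_cint; exact: eq_cint. Qed.

Lemma L2_ae f g : cmeasurable [set: RT] (hd f) -> L2 g -> L2eq f g -> L2 f.
Proof.
move=> mf /L2_hd [mg gi] /L2eq_hd fg; apply/L2_hd; split => //.
rewrite (@ge0_ae_eq_integral _ RT R leb setT _ (fun r => (normc_sq (hd g r))%:E))//.
- exact: emeasurable_normc_sq.
- exact: emeasurable_normc_sq.
- by move=> r _; rewrite lee_fin normc_sq_ge0.
- by move=> r _; rewrite lee_fin normc_sq_ge0.
- by apply: (@ae_imp _ _ RT leb _ _ fg) => r h _; rewrite h.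
Qed.

Lemma L2eq_trans g f h : L2eq f g -> L2eq g h -> L2eq f h.
Proof.
move=> /L2eq_hd h1 /L2eq_hd h2; apply/L2eq_hd.
by apply: (@ae_imp2 _ _ RT leb _ _ _ h1 h2) => r -> ->.
Qed.

Lemma L2eq_sym f g : L2eq f g -> L2eq g f.
Proof.
by move=> /L2eq_hd h; apply/L2eq_hd; apply: (@ae_imp _ _ RT leb _ _ h) => r ->.
Qed.

Lemma norm2_ae f g : L2 f -> L2 g -> L2eq f g -> norm2 f = norm2 g.
Proof.
move=> hf hg h; rewrite -(toHK hf) -(toHK hg) !norm2E; congr Num.sqrt.
by apply: qn_eq_null; apply/L2eqE.
Qed.

(** The function by which D^-1 multiplies, extended by zero. *)
Definition rt (r : R) : R := if 0 < r then (Num.sqrt r)^-1 else 0.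

Lemma rt_sq r : 0 < r -> rt r ^+ 2 = r^-1.
Proof. by move=> r0; rewrite /rt r0 exprVn sqr_sqrtr// ltW. Qed.

Lemma rt_le0 r : r <= 0 -> rt r = 0.
Proof. by rewrite /rt leNgt => /negbTE ->. Qed.

Lemma measurable_rt : measurable_fun [set: RT] (rt : RT -> R).
Proof.
rewrite (_ : rt = (fun r : RT => (Num.sqrt r)^-1) \_ Rplus).
  apply/measurable_restrict => //; first exact: Rplus_measurable.
  by rewrite setTI; exact: measurable_sqrtV.
by apply/funext => r; rewrite patchE in_Rplus.
Qed.

Lemma hd_Dinv f r : hd (Dinv f) r = (rt r)%:C * hd f r.
Proof. by rewrite /hd /Dinv /rt; case: ifP => // _; rewrite mulr0. Qed.

Lemma cmeasurable_Dinv f : L2 f -> cmeasurable [set: RT] (hd (Dinv f)).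
Proof.
move=> /L2_hd [mf _]; rewrite (_ : hd _ = fun r => (rt r)%:C * hd f r).
  by apply: cmeasurableM => //; apply: cmeasurableR; exact: measurable_rt.
by apply/funext => r; rewrite hd_Dinv.
Qed.

(** D^-1 is bounded on the functions supported in a window, and the windows exhaust the
    half-line. *)
Definition window N (r : R) : bool := (N.+1%:R^-1 <= r) && (r <= N.+1%:R).

Definition cut N f (r : R) : R[i] := if window N r then f r else 0.

Lemma window_gt0 N r : window N r -> 0 < r.
Proof. by move=> /andP[h _]; apply: lt_le_trans h; rewrite invr_gt0. Qed.

Lemma window_exhausts r : 0 < r -> exists N, window N r.
Proof.
move=> r0; exists (maxn (Num.bound r) (Num.bound r^-1)); apply/andP; split.
  rewrite invf_ple ?posrE//; apply: (le_trans (ltW (archi_boundP _))).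
    by rewrite invr_ge0 ltW.
  by rewrite ler_nat leqW// leq_maxr.
apply: (le_trans (ltW (archi_boundP (ltW r0)))).
by rewrite ler_nat leqW// leq_maxl.
Qed.

Lemma window_mono M N r : (M <= N)%N -> window M r -> window N r.
Proof.
move=> MN /andP[h1 h2]; apply/andP; split; last by rewrite (le_trans h2)// ler_nat.
by apply: le_trans h1; rewrite lef_pV2 ?posrE// ler_nat.
Qed.

Lemma measurable_window N : measurable_fun [set: RT] (window N : RT -> bool).
Proof.
apply: measurable_and; exact: measurable_fun_ler.
Qed.

Lemma hd_cut N f r : hd (cut N f) r = if window N r then hd f r else 0.
Proof.
by rewrite /hd /cut; case: ifP => r0; case: ifP => // _; rewrite mulr0.
Qed.

Lemma cmeasurable_cut N f : cmeasurable [set: RT] (hd f) ->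
  cmeasurable [set: RT] (hd (cut N f)).
Proof.
move=> mf; rewrite (_ : hd _ = fun r : RT => if window N r then hd f r else 0).
  apply: (cmeasurable_ifT (measurable_window N) mf); exact: cmeasurable_cst.
by apply/funext => r; rewrite hd_cut.
Qed.

Lemma L2_cut N f : L2 f -> L2 (cut N f).
Proof.
move=> /L2_hd sf; apply/L2_hd; apply: (SQ_le _ sf) => [|r].
  by apply: cmeasurable_cut; exact: sf.1.
by rewrite hd_cut; case: ifP => // _; rewrite normc_sq0 normc_sq_ge0.
Qed.

Lemma rt_window N r : window N r -> rt r ^+ 2 <= N.+1%:R.
Proof.
move=> w; have r0 := window_gt0 w; rewrite rt_sq//.
by case/andP: w => h _; rewrite invf_ple ?posrE.
Qed.

Lemma L2_Dinv_cut N f : L2 f -> L2 (Dinv (cut N f)).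
Proof.
move=> hf; have /L2_hd sf := hf; apply/L2_hd.
have s2 : SQ (fun r => (Num.sqrt N.+1%:R)%:C * hd f r + 0).
  by apply: SQ_linear => //; exact: SQ0.
apply: (SQ_le _ s2) => [|r]; first by apply/cmeasurable_Dinv/L2_cut.
rewrite addr0 hd_Dinv hd_cut; case: ifPn => w; last by rewrite mulr0 normc_sq0 normc_sq_ge0.
by rewrite !normc_sqM !normc_sqR sqr_sqrtr// ler_wpM2r ?normc_sq_ge0 ?rt_window.
Qed.

Lemma cut_Dinv N f : cut N (Dinv f) = Dinv (cut N f).
Proof. by apply/funext => r; rewrite /cut /Dinv; case: ifP => // _; rewrite mulr0. Qed.

Lemma cut_dom N f : L2 f -> dom_Dinv (cut N f).
Proof. by move=> hf; split; [exact: L2_cut|exact: L2_Dinv_cut]. Qed.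

Lemma L2eq_cut f g : (forall N, L2eq (cut N f) (cut N g)) -> L2eq f g.
Proof.
move=> h; have /(@ae_foralln _ RT R leb) h' : forall N,
    {ae leb, forall r, hd (cut N f) r = hd (cut N g) r} by move=> N; apply/L2eq_hd.
apply/L2eq_hd; apply: (@ae_imp _ _ RT leb _ _ h') => r hr.
have [r0|/window_exhausts [N w]] := leP r 0; first by rewrite !hd_le0.
by have := hr N; rewrite !hd_cut w.
Qed.

(** * From a Hilbert-Schmidt extension to admissibility *)

Section Extension.
Variables (A B : operator R) (e : nat -> R -> R[i]).
Hypotheses (eON : orthonormal_basis e) (Abd : bounded_operator A).
Hypothesis Bbd : bounded_operator B.
Hypothesis BA : forall f, dom_Dinv f -> L2eq (B f) (A (Dinv f)).
Let eH := onbH eON.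

(** Testing against functions q supported away from 0 and infinity, where D^-1 is bounded:
    <q, D^-1 A^* h> = <A D^-1 q, h> = <B q, h> = <q, B^* h>. *)
Lemma Dinv_adjoint h : L2 h -> L2eq (Dinv (adjoint A h)) (adjoint B h).
Proof.
move=> hh; set p := adjoint A h; set s := adjoint B h.
have [hp pA] := adjointP eH Abd hh; have [hs sB] := adjointP eH Bbd hh.
rewrite -/p -/s in hp hs pA sB.
apply: L2eq_cut => N; rewrite cut_Dinv.
have h1 := L2_Dinv_cut N hp; have h2 := L2_cut N hs.
apply/L2eqE => //; set q := _ - _.
have qE r : hd (Hfun q) r = if window N r then (rt r)%:C * hd p r - hd s r else 0.
  rewrite hdHB !toHK// hd_Dinv !hd_cut; case: ifP => // _.
  by rewrite mulr0 subr0.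
have qcut r : hd (cut N (Hfun q)) r = hd (Hfun q) r.
  by rewrite hd_cut qE; case: (window N r).
have hq := HfunP q; have hDq := L2_Dinv_cut N hq.
have e1 : inner (Hfun q) (Dinv (cut N p)) = inner (Dinv (cut N (Hfun q))) p.
  apply: eq_inner => r; rewrite !hd_Dinv qcut hd_cut qE; case: ifP => _; last by rewrite !(mulr0,mul0r).
  exact: mulJR.
have e2 : inner (Hfun q) (cut N s) = inner (cut N (Hfun q)) s.
  by apply: eq_inner => r; rewrite qcut hd_cut qE; case: ifP => _; rewrite ?mul0r.
rewrite /qn {2}/q ipBr !ipHE !toHK// e1 e2 -pA// -sB; last exact: L2_cut.
have hB : L2 (B (cut N (Hfun q))) by exact/(bounded_L2 Bbd)/L2_cut.
have hA : L2 (A (Dinv (cut N (Hfun q)))) by exact: (bounded_L2 Abd).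
have /L2eqE := BA (cut_dom N hq) => /(_ hB hA) h0.
by rewrite !innerE// -(ip_eq_null _ h0) subrr.
Qed.

End Extension.

(** D^-1 A^* A D^-1 is a restriction of B^* B, as D^-1 A^* = B^*. It is nonzero with A, since
    <A^* A f, f> = |A f|^2. *)
Lemma HS_extension_admissible A : trace_class A -> nonzero_operator A ->
  (exists B : operator R, Hilbert_Schmidt B /\
     forall f, dom_Dinv f -> L2eq (B f) (A (Dinv f))) ->
  admissible (fun f => adjoint A (A f)).
Proof.
move=> [Abd _] Anz [B [BHS BA]]; have [Bbd [e [eON _]]] := BHS.
have eH := onbH eON; have DB := Dinv_adjoint eON Abd Bbd BA.
have Astar := adjoint_bounded eH Abd; have Bstar := adjoint_bounded eH Bbd.
have L2D h : L2 h -> L2 (Dinv (adjoint A h)).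
  move=> hh; apply: (L2_ae (g := adjoint B h)); last exact: DB.
    by apply: cmeasurable_Dinv; exact: (bounded_L2 Astar).
  exact: (bounded_L2 Bstar).
have DSD f : dom_Dinv f -> L2eq (adjoint B (B f)) (Dinv (adjoint A (A (Dinv f)))).
  move=> hf; have [f2 Df2] := hf.
  have hA : L2 (A (Dinv f)) by exact: (bounded_L2 Abd).
  apply: L2eq_trans (L2eq_sym (DB _ hA)).
  by apply: (lift_L2eq Bstar) => //; [exact: (bounded_L2 Bbd)|exact: BA].
split.
- exact: normal_bounded eH _ Abd.
- move=> S0; apply: Anz => f hf; have z2 : L2 (fun=> 0 : R[i]).
    by apply/L2_hd; rewrite (_ : hd _ = fun=> 0); [exact: SQ0|apply/funext => r; rewrite /hd mulr0 if_same].
  have hA : L2 (A f) by exact: (bounded_L2 Abd).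
  rewrite -(toHK hA) -[X in L2eq _ X](toHK z2) L2eq_qn.
  have z0 : toH (fun=> 0) = 0 :> H.
    by rewrite -[RHS]HfunK; congr toH; apply/funext => r; have := HfunE (-1) 0 0 r; rewrite scaler0 add0r mulN1r addNr.
  rewrite z0 subr0 lift_toH// /qn -(ip_normal eH Abd).
  have hS : L2 (adjoint A (A f)) by exact: (bounded_L2 Astar).
  have := S0 _ hf; move/(L2eqE hS z2); rewrite z0 subr0 => h0.
  by rewrite liftH toHK// ip_null_l.
- move=> f [f2 _]; have hA : L2 (A f) by exact: (bounded_L2 Abd).
  by split; [exact: (bounded_L2 Astar)|exact: L2D].
- have Tbd := normal_bounded eH Bbd; have [_ _ [M hM]] := Tbd; exists M => f hf.
  have [f2 Df2] := hf; have hA : L2 (A (Dinv f)) by exact: (bounded_L2 Abd).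
  by rewrite -(norm2_ae _ _ (DSD f hf)); [exact: hM|exact: (bounded_L2 Tbd)|exact: L2D].
- exists (fun f => adjoint B (B f)); split; last exact: DSD.
  exact: trace_class_normal.
Qed.

End Operators.

(** * Integral kernels *)

Section Kernel.
Context {R : realType}.
Local Notation leb := (@lebesgue_measure R).
Local Notation RT := (measurableTypeR R).
Local Notation H := (@Hvec R).
Local Notation b := (@ipH R).
Local Notation hf x := (hd (Hfun x)).

(** The sum of the |u_j|^2 is integrable, hence finite almost everywhere; setting the u_j to 0 on
    the exceptional null set makes the bound hold at every point. *)
Lemma patch_summable (u : nat -> H) : summable_sq b u ->
  exists (u' : nat -> H) (V : R -> R), [/\ forall j, qn b (u' j - u j) = 0,
    leb.-integrable setT (EFin \o V) &
    forall n r, \sum_(j < n) normc_sq (hf (u' j) r) <= V r].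
Proof.
move=> us; pose S r := (\sum_(0 <= j <oo) (normc_sq (hf (u j) r))%:E)%E.
have mu j : measurable_fun [set: RT] (fun r => (normc_sq (hf (u j) r))%:E).
  exact: measurable_SQH.
have mS : measurable_fun [set: RT] S.
  by apply: ge0_emeasurable_sum => // k r _ _; rewrite lee_fin normc_sq_ge0.
have S0 r : (0 <= S r)%E.
  by apply: nneseries_ge0 => k _ _; rewrite lee_fin normc_sq_ge0.
have IS : (\int[leb]_r S r < +oo)%E.
  rewrite (@integral_nneseries _ RT)//; last by move=> j r _; rewrite lee_fin normc_sq_ge0.
  by under eq_eseriesr do rewrite -qnHE.
have iS : leb.-integrable setT S.
  by apply/integrableP; split => //; under eq_integral do rewrite gee0_abs//.
pose p j (r : R) := if (S r < +oo)%E then Hfun (u j) r else 0.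
have hdp j r : hd (p j) r = if (S r < +oo)%E then hf (u j) r else 0.
  by rewrite /hd /p; case: ifP => r0; case: ifP => // _; rewrite mulr0.
have p2 j : L2 (p j).
  apply/L2_hd; apply: (SQ_le _ (SQH (u j))) => [|r].
    rewrite (_ : hd _ = fun r : RT => if (S r < +oo)%E then hf (u j) r else 0).
      apply: cmeasurable_ifT; [exact: measurable_fun_lte|exact: (SQH _).1|exact: cmeasurable_cst].
    by apply/funext => r; rewrite hdp.
  by rewrite hdp; case: ifP => // _; rewrite normc_sq0 normc_sq_ge0.
exists (fun j => toH (p j)), (fine \o S); split=> [j||n r].
- apply/qn_ae; have := integrable_ae measurableT iS => h.
  apply: (@ae_imp _ _ RT leb _ _ h) => r /(_ I) Sr.
  by rewrite hdHB toHK// hdp -ge0_fin_numE// Sr subrr.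
- apply: (le_integrable _ _ _ iS) => //.
    apply/measurable_EFinP; apply: (@measurableT_comp _ _ _ _ _ _ (@fine R)) => //.
  move=> r _; rewrite /= !gee0_abs ?lee_fin ?fine_ge0//.
  by rewrite ger0_norm ?fine_ge0//; move: (S r) (S0 r) => [t| |].
- under eq_bigr do rewrite toHK// hdp.
  rewrite /=; case: (boolP (S r < +oo)%E) => [Sr|_]; last first.
    by rewrite big1 ?fine_ge0// => i _; rewrite normc_sq0.
  rewrite -lee_fin fineK ?ge0_fin_numE// -sumEFin.
  rewrite -(big_mkord xpredT (fun k => (normc_sq (hf (u k) r))%:E)).
  by apply: nneseries_lim_ge => k _ _; rewrite lee_fin normc_sq_ge0.
Qed.

Lemma bounded_abs_series_cvg (a c : nat -> R) (M : R) : (forall j, `|a j| <= c j) ->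
  (forall n, \sum_(j < n) c j <= M) -> cvgn (fun n => \sum_(j < n) a j).
Proof.
move=> ac cM; have -> : (fun n => \sum_(j < n) a j) = series a.
  by apply/funext => n; rewrite /series /= big_mkord.
apply: normed_cvg; apply: (@series_le_cvg _ _ c) => [n|n|n|].
- exact: normr_ge0.
- exact: le_trans (ac n).
- exact: ac.
- apply: nondecreasing_is_cvgn.
    apply/nondecreasing_seqP => n; rewrite /series /= big_nat_recr//= lerDl.
    exact: le_trans (ac n).
  exists M => _ [n _ <-]; rewrite /series /= big_mkord; exact: cM.
Qed.

Lemma ip_cint x y : b x y = cint leb (fun r => hf x r * (hf y r)^*).
Proof. by rewrite ipHE inner_cint. Qed.

Lemma ip_eq_null_r (x y z : H) : qn b (x - y) = 0 -> b z x = b z y.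
Proof. by move=> h; rewrite -(ipJ b x) -(ipJ b y) (ip_eq_null _ h). Qed.

Lemma qn_sum_null n (c : nat -> R[i]) (x : nat -> H) : (forall j, qn b (x j) = 0) ->
  qn b (\sum_(j < n) c j *: x j) = 0.
Proof.
move=> x0; elim: n => [|n IH]; first by rewrite big_ord0 qn0.
by rewrite big_ord_recr /=; apply: qnD_null => //; rewrite qnZ x0 mulr0.
Qed.

Lemma rank_one_sum_patch (T : H -> H) (u w u' w' : nat -> H) :
  rank_one_sum b T u w -> (forall j, qn b (u' j - u j) = 0) ->
  (forall j, qn b (w' j - w j) = 0) -> rank_one_sum b T u' w'.
Proof.
move=> h uu ww x; have := h x; apply: cvg_trans; apply: near_eq_cvg; apply: nearW => n.
apply/esym/qn_eq_null; under eq_bigr do rewrite (ip_eq_null_r _ (ww _)).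
rewrite opprB addrC addrA subrK -sumrB; under eq_bigr do rewrite -scalerBr.
apply: (@qn_sum_null n (fun j => b x (w j)) (fun j => u j - u' j)) => j.
by rewrite qnBC uu.
Qed.

Section HilbertSchmidtKernel.
Variables (k : R -> R -> R[i]) (e : nat -> H) (F : nat -> H).
Hypothesis mk : cmeasurable [set: RT * RT] (fun p : RT * RT => k p.1 p.2).
Hypothesis k0 : forall r s, s <= 0 -> k r s = 0.

(** The inner product with this vector is integration against k(r, .). *)
Definition row_vec r : H := toH (dh (fun s => (k r s)^*)).

Lemma hd_row_vec r s : SQ (k r) -> hf (row_vec r) s = (k r s)^*.
Proof.
move=> sk; rewrite /row_vec toHK; last by apply: L2_dh; exact: SQJ.
have [s0|s0] := leP s 0; last by rewrite hd_dh.
by rewrite hd_le0// k0// rmorph0.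
Qed.

Lemma ip_row_vec r x : SQ (k r) -> b x (row_vec r) = cint leb (fun s => k r s * hf x s).
Proof.
move=> sk; rewrite ip_cint; apply: eq_cint => s.
by rewrite hd_row_vec// [X in _ * X]conjcK mulrC.
Qed.

Lemma qn_row_vec r : SQ (k r) -> (qn b (row_vec r))%:E = (\int[leb]_s (normc_sq (k r s))%:E)%E.
Proof.
by move=> sk; rewrite qnHE; apply: eq_integral => s _; rewrite hd_row_vec// normc_sqJ.
Qed.

Lemma measurable_row_norm :
  measurable_fun [set: RT] (fun r => (\int[leb]_s (normc_sq (k r s))%:E)%E).
Proof.
apply: (@measurable_fun_fubini_tonelli_F _ _ RT RT R leb
  (fun p : RT * RT => (normc_sq (k p.1 p.2))%:E)).
- exact: emeasurable_normc_sq mk.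
- by move=> p; rewrite lee_fin normc_sq_ge0.
Qed.

(** Parseval in the second variable, for almost every value of the first. *)
Lemma Hilbert_Schmidt_norm : onb b e -> {ae leb, forall r, SQ (k r)} ->
  (forall n, {ae leb, forall r, hf (F n) r = cint leb (fun s => k r s * hf (e n) s)}) ->
  (\sum_(0 <= n <oo) (qn b (F n))%:E = \int[leb]_r \int[leb]_s (normc_sq (k r s))%:E)%E.
Proof.
move=> eON sk hF.
have mF n : measurable_fun [set: RT] (fun r => (normc_sq (hf (F n) r))%:E).
  exact: measurable_SQH.
under eq_eseriesr do rewrite qnHE.
rewrite -(@integral_nneseries _ RT)//; last by move=> n r _; rewrite lee_fin normc_sq_ge0.
apply: (@ge0_ae_eq_integral _ RT) => //.
- by apply: ge0_emeasurable_sum => // n r _ _; rewrite lee_fin normc_sq_ge0.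
- exact: measurable_row_norm.
- by move=> r _; apply: nneseries_ge0 => n _ _; rewrite lee_fin normc_sq_ge0.
- by move=> r _; apply: integral_ge0 => s _; rewrite lee_fin normc_sq_ge0.
have /(@ae_foralln _ RT R leb) hF' := hF.
apply: (@ae_imp2 _ _ RT leb _ _ _ sk hF') => r skr hFr _.
rewrite -qn_row_vec// -(Parseval (@H_complete R) eON); apply: eq_eseriesr => n _.
by rewrite hFr -ip_row_vec// -(ipJ b) normc_sqJ.
Qed.

End HilbertSchmidtKernel.

(** * Translations, dilations and traces *)

Lemma normc_sq_expi (t : R) : normc_sq (expi t) = 1.
Proof. by rewrite /normc_sq /= cos2Dsin2. Qed.

Lemma measurable_expi d (T : measurableType d) (f : T -> R) :
  measurable_fun [set: T] f -> cmeasurable [set: T] (fun t => expi (f t)).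
Proof.
move=> mf; split => /=.
  apply: (@measurableT_comp _ _ _ _ _ _ (@cos R)) => //.
  by apply: continuous_measurable_fun; exact: continuous_cos.
apply: (@measurableT_comp _ _ _ _ _ _ (@sin R)) => //.
by apply: continuous_measurable_fun; exact: continuous_sin.
Qed.

Section Translation.
Variables (x a : R).
Hypothesis a0 : 0 < a.

Lemma hd_U f r : hd (U (x, a) f) r =
  expi (2 * pi * x * r) * ((Num.sqrt a)%:C * hd f (a * r)).
Proof.
rewrite /hd pmulr_rgt0//; case: ifP => r0; last by rewrite !mulr0.
rewrite /U /= sqrtrM ?(ltW a0)// mulrCA; congr (_ * _); rewrite mulrA; congr (_ * _).
rewrite -rmorphM /= invfM mulrA divff ?mul1r//.
by rewrite gt_eqF// sqrtr_gt0.
Qed.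

Lemma measurable_scale : measurable_fun [set: RT] (fun r : RT => a * r : RT).
Proof. by have := measurable_affine a 0; under eq_fun do rewrite addr0. Qed.

Lemma integral_scale (f : R -> \bar R) : measurable_fun [set: RT] f -> (forall r, 0 <= f r)%E ->
  (a%:E * \int[leb]_r f (a * r)%R = \int[leb]_r f r)%E.
Proof.
move=> mf f0; rewrite -(ge0_integral_affine 0 a0 mf f0).
by under [in RHS]eq_integral do rewrite addr0.
Qed.

Lemma U_norm f : L2 f -> L2 (U (x, a) f) /\
  (\int[leb]_r (normc_sq (hd (U (x, a) f) r))%:E = \int[leb]_r (normc_sq (hd f r))%:E)%E.
Proof.
move=> /L2_hd [mf fi].
have mU : cmeasurable [set: RT] (hd (U (x, a) f)).
  rewrite (_ : hd _ = fun r => expi (2 * pi * x * r) * ((Num.sqrt a)%:C * hd f (a * r))).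
    apply: cmeasurableM; first by apply: measurable_expi; exact: measurable_funM.
    apply: cmeasurableM; first exact: cmeasurable_cst.
    exact: (cmeasurable_comp measurable_scale mf).
  by apply/funext => r; exact: hd_U.
have mnf : measurable_fun [set: RT] (fun r => (normc_sq (hd f r))%:E).
  exact: emeasurable_normc_sq.
suff E : (\int[leb]_r (normc_sq (hd (U (x, a) f) r))%:E = \int[leb]_r (normc_sq (hd f r))%:E)%E.
  by split => //; apply/L2_hd; split => //; rewrite E.
rewrite -(integral_scale mnf); last by move=> r; rewrite lee_fin normc_sq_ge0.
rewrite -ge0_integralZl//; last 3 first.
- by apply: (measurableT_comp mnf); exact: measurable_scale.
- by move=> r _; rewrite lee_fin normc_sq_ge0.
- by rewrite lee_fin ltW.
apply: eq_integral => r _; rewrite hd_U !normc_sqM normc_sq_expi mul1r normc_sqR.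
by rewrite sqr_sqrtr ?ltW// EFinM.
Qed.

Lemma U_wlinear : wlinear b (lift (U (x, a))).
Proof.
move=> c y z t; rewrite -ip_linear; congr (ip _ _ _).
rewrite !liftH -toH_linear; [|exact: (U_norm (HfunP y)).1|exact: (U_norm (HfunP z)).1].
by congr toH; apply/funext => r; rewrite /U HfunE mulrDr mulrCA.
Qed.

Lemma qn_U y : qn b (lift (U (x, a)) y) = qn b y.
Proof.
apply: EFin_inj; have [h1 h2] := U_norm (HfunP y).
by rewrite !qnHE liftH toHK.
Qed.

Lemma U_bounded : bounded_operator (U (x, a)).
Proof.
apply: (@operator_bounded _ _ 1) => [f /U_norm[]//||y]; first exact: U_wlinear.
by rewrite qn_U mul1r.
Qed.

End Translation.

Lemma cvg0c_cvg (z : nat -> R[i]) (t : R[i]) : cvg0c (fun n => t - z n) ->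
  (z : nat -> R[i]^o) @ \oo --> (t : R[i]^o).
Proof.
move=> zt; apply/(@cvgrPdist_lt _ R[i]^o) => e e0.
have eE : e = (complex.Re e)%:C.
  by move: e0; case: e => a c; rewrite ltcE /= => /andP[/eqP -> _].
have r0 : 0 < complex.Re e by move: e0; rewrite {1}eE ltcR.
have := zt; rewrite /cvg0c => /cvgrPdist_lt/(_ (complex.Re e ^+ 2)).
rewrite exprn_gt0// => /(_ isT); apply: filterS => n.
rewrite sub0r normrN ger0_norm ?normc_sq_ge0// => h.
rewrite -(@ltr_pXn2r _ 2)// ?nnegrE ?(ltW e0)// normCK -[X in X < _]normc_sqE eE.
by rewrite -rmorphXn ltcR.
Qed.

Lemma trace_eq (T : operator R) (e : nat -> R -> R[i]) (t : R[i]) : orthonormal_basis e ->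
  (forall e, orthonormal_basis e ->
    cvg0c (fun n => t - \sum_(k < n) inner (T (e k)) (e k))) -> trace T = t.
Proof.
move=> eON h; pose P := [set t : R[i] | forall e, orthonormal_basis e ->
    (fun n => \sum_(0 <= k < n) inner (T (e k)) (e k) : R[i]^o) @ \oo
      --> (t : R[i]^o)].
have Pt : P t.
  move=> e' e'ON; have := cvg0c_cvg (h e' e'ON).
  by under [X in X @ _ --> _ -> _]eq_fun do rewrite -(big_mkord xpredT (fun k => inner (T (e' k)) (e' k))).
have Ptr : P (trace T) by apply: (@xgetPex _ 0 P); exists t.
have := @cvg_unique R[i]^o _ (_ @ \oo) _ _ _ (Ptr e eON) (Pt e eON); apply.
exact: norm_hausdorff.
Qed.

Lemma normc_sq_cint_expi (g : R -> R[i]) x : cintegrable leb g ->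
  normc_sq (cint leb (fun s => expi (2 * pi * x * s) * g s)) =
  fourier_normsq (fun s => complex.Re (g s)) (fun s => complex.Im (g s)) x.
Proof.
move=> [i1 i2].
have cosb (s : R) : `|cos (2 * pi * x * s)| <= 1 by rewrite ler_norml cos_geN1 cos_le1.
have sinb (s : R) : `|sin (2 * pi * x * s)| <= 1 by rewrite ler_norml sin_geN1 sin_le1.
have c1 := L1_bounded_mul i1 (measurable_cosM _) cosb.
have c2 := L1_bounded_mul i2 (measurable_cosM _) cosb.
have s1 := L1_bounded_mul i1 (measurable_sinM _) sinb.
have s2 := L1_bounded_mul i2 (measurable_sinM _) sinb.
rewrite /normc_sq /fourier_normsq /cint /=; congr (_ ^+ 2 + _ ^+ 2).
  rewrite /cos_tr /sin_tr -RintegralB//; apply: eq_Rintegral => s _.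
  by rewrite ReM /= [cos _ * _]mulrC [sin _ * _]mulrC.
rewrite /cos_tr /sin_tr addrC -RintegralD//; apply: eq_Rintegral => s _.
by rewrite ImM /= [cos _ * _]mulrC [sin _ * _]mulrC.
Qed.

Lemma scale_inv (s c : R) (X Y : \bar R) : 0 < s -> c = s^-1 ->
  (s%:E * X = Y)%E -> (X = c%:E * Y)%E.
Proof. by move=> s0 -> <-; rewrite muleA -EFinM mulVf ?mul1e// gt_eqF. Qed.

(** Substituting r = a s in the dilation variable a. *)
Lemma dilation_norm (k : R -> R -> R[i]) :
  cmeasurable [set: RT * RT] (fun p : RT * RT => k p.1 p.2) ->
  (forall r s, (r <= 0) || (s <= 0) -> k r s = 0) ->
  (\int[leb]_a \int[leb]_s (normc_sq (k (a * s) s))%:E =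
   \int[leb]_r \int[leb]_s (normc_sq ((rt s)%:C * k r s))%:E)%E.
Proof.
move=> mk k0; pose g (p : RT * RT) := (normc_sq (k (p.1 * p.2) p.2))%:E.
have mg : measurable_fun [set: RT * RT] g.
  apply: emeasurable_normc_sq.
  have mp : measurable_fun [set: RT * RT] (fun p => (p.1 * p.2 : RT, p.2)).
    by apply: measurable_fun_pair => //; apply: measurable_funM.
  exact: (cmeasurable_comp mp mk).
have g0 p : (0 <= g p)%E by rewrite lee_fin normc_sq_ge0.
pose h (p : RT * RT) := (normc_sq ((rt p.2)%:C * k p.1 p.2))%:E.
have mh : measurable_fun [set: RT * RT] h.
  apply: emeasurable_normc_sq; apply: cmeasurableM => //.
  by apply: cmeasurableR; exact: measurableT_comp measurable_rt measurable_snd.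
have h0 p : (0 <= h p)%E by rewrite lee_fin normc_sq_ge0.
have swap_g := @fubini_tonelli _ _ RT RT R leb leb g mg g0.
have swap_h := @fubini_tonelli _ _ RT RT R leb leb h mh h0.
have column (s : R) : (\int[leb]_a g (a, s) = \int[leb]_r h (r, s))%E.
  rewrite /g /h /=; have [s0|s0] := leP s 0.
    apply: eq_integral => r _.
    have e1 : k (r * s) s = 0 by apply: k0; rewrite s0 orbT.
    have e2 : k r s = 0 by apply: k0; rewrite s0 orbT.
    rewrite e1.
    rewrite e2.
    by rewrite mulr0.
  have mks : measurable_fun [set: RT] (fun r : RT => (normc_sq (k r s))%:E).
    apply: emeasurable_normc_sq.
    exact: (cmeasurable_comp (pair2_measurable (s : RT)) mk).
  have ks0 r : (0 <= (normc_sq (k r s))%:E)%E by rewrite lee_fin normc_sq_ge0.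
  have E := integral_scale s0 mks ks0.
  move: (rt s) (rt_sq s0) => c cE; have c0 : (0 <= (c ^+ 2)%:E)%E by rewrite lee_fin sqr_ge0.
  transitivity ((c ^+ 2)%:E * \int[leb]_r (normc_sq (k r s))%:E)%E.
    transitivity (\int[leb]_r (normc_sq (k (s * r) s))%:E)%E.
      apply: eq_integral => r _.
      have e1 : r * s = s * r by exact: mulrC.
      by rewrite e1.
    exact: scale_inv s0 cE E.
  rewrite -(@ge0_integralZl _ RT R leb setT measurableT _ mks _ (fun r _ => ks0 r) c0).
  by apply: eq_integral => r _; rewrite normc_sqM normc_sqR EFinM.
rewrite -[LHS]/(\int[leb]_a \int[leb]_s g (a, s))%E swap_g.
rewrite -[RHS]/(\int[leb]_r \int[leb]_s h (r, s))%E swap_h.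
by apply: eq_integral => s _; exact: column.
Qed.

(** * The kernel of a trace-class operator *)

Section RankOneKernel.
Variables (A : operator R) (u w : nat -> H) (V W : R -> R).
Hypotheses (iV : leb.-integrable setT (EFin \o V)) (iW : leb.-integrable setT (EFin \o W)).
Hypothesis uV : forall n r, \sum_(j < n) normc_sq (hf (u j) r) <= V r.
Hypothesis wW : forall n r, \sum_(j < n) normc_sq (hf (w j) r) <= W r.
Hypothesis Auw : rank_one_sum b (lift A) u w.

Definition knl_part n (r s : R) : R[i] := \sum_(j < n) hf (u j) r * (hf (w j) s)^*.

(** By [uV] and [wW] the series converges absolutely at every point. *)
Definition knl (r s : R) : R[i] := Complex (limn (fun n => complex.Re (knl_part n r s)))
  (limn (fun n => complex.Im (knl_part n r s))).

Lemma V_ge0 r : 0 <= V r.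
Proof. by have := uV 0 r; rewrite big_ord0. Qed.

Lemma W_ge0 r : 0 <= W r.
Proof. by have := wW 0 r; rewrite big_ord0. Qed.

Lemma knl_part_bound n r s : normc_sq (knl_part n r s) <= V r * W s.
Proof.
apply: (le_trans (@CauchySchwarz_sum _ (fun j => hf (u j) r * (hf (w j) s)^*)
  (fun j => normc_sq (hf (u j) r)) (fun j => normc_sq (hf (w j) s)) n _ _ _)) => [k|k|k|].
- exact: normc_sq_ge0.
- exact: normc_sq_ge0.
- by rewrite normc_sqM normc_sqJ.
- by apply: ler_pM => //; apply: sumr_ge0 => *; exact: normc_sq_ge0.
Qed.

Lemma knl_cvg r s : cvg0c (fun n => knl r s - knl_part n r s).
Proof.
pose c j := normc_sq (hf (u j) r) + normc_sq (hf (w j) s).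
have cM n : \sum_(j < n) c j <= V r + W s by rewrite /c big_split /= lerD ?uV ?wW.
have part (p : R[i] -> R) : (forall x, p x ^+ 2 <= normc_sq x) ->
    (forall n, p (knl_part n r s) = \sum_(j < n) p (hf (u j) r * (hf (w j) s)^*)) ->
    cvgn (fun n => p (knl_part n r s)).
  move=> p_le pS; under eq_fun do rewrite pS.
  apply: (@bounded_abs_series_cvg (fun j => p (hf (u j) r * (hf (w j) s)^*)) c
    (V r + W s) _ cM) => j.
  have c0 : 0 <= c j by rewrite addr_ge0 ?normc_sq_ge0.
  rewrite -(@ler_pXn2r _ 2)// ?nnegrE// real_normK ?num_real//.
  apply: (le_trans (p_le _)); rewrite normc_sqM normc_sqJ /c.
  by have := normc_sq_ge0 (hf (u j) r); have := normc_sq_ge0 (hf (w j) s); nra.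
apply: Re_Im_cvg0c => /=.
  by apply: part => [x|n]; [exact: Re_le_normc_sq|rewrite Re_sum].
apply: part => [x|n]; last by rewrite Im_sum.
by rewrite /normc_sq lerDr sqr_ge0.
Qed.

Lemma knl_bound r s : normc_sq (knl r s) <= V r * W s.
Proof.
have h : cvg0c (fun n => knl_part n r s - knl r s).
  by have := knl_cvg r s; apply: cvg0c_eq => n; rewrite -normc_sqN opprB.
have c := @cvg0c_normc_sq _ _ (knl r s) h.
apply: (cvgr_to_le c); apply: nearW => n.
by rewrite addrC subrK; exact: knl_part_bound.
Qed.

Lemma knl_part_measurable n :
  cmeasurable [set: RT * RT] (fun p : RT * RT => knl_part n p.1 p.2).
Proof.
apply: (@cmeasurable_sum _ _ _ n (fun j p => hf (u j) p.1 * (hf (w j) p.2)^*)) => j.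
apply: cmeasurableM.
  exact: (cmeasurable_comp measurable_fst (SQH (u j)).1).
apply: cmeasurableJ; exact: (cmeasurable_comp measurable_snd (SQH (w j)).1).
Qed.

Lemma knl_measurable : cmeasurable [set: RT * RT] (fun p : RT * RT => knl p.1 p.2).
Proof.
split.
  apply: (@measurable_fun_cvg _ _ R setT (fun n (p : RT * RT) => complex.Re (knl_part n p.1 p.2))) => [n|p _].
    exact: (knl_part_measurable n).1.
  exact: cvg0c_Re (knl_cvg p.1 p.2).
apply: (@measurable_fun_cvg _ _ R setT (fun n (p : RT * RT) => complex.Im (knl_part n p.1 p.2))) => [n|p _].
  exact: (knl_part_measurable n).2.
exact: cvg0c_Im (knl_cvg p.1 p.2).
Qed.

Lemma knl_eq0 r s : (r <= 0) || (s <= 0) -> knl r s = 0.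
Proof.
move=> rs; suff h n : knl_part n r s = 0.
  rewrite /knl; under eq_fun do rewrite h; under [X in Complex _ (limn X)]eq_fun do rewrite h.
  by rewrite lim_cst.
rewrite /knl_part big1// => j _; case/orP: rs => h.
  by rewrite hd_le0// mul0r.
by rewrite [hf (w j) s]hd_le0// rmorph0 mulr0.
Qed.

Lemma hd_sum n (c : nat -> R[i]) (x : nat -> H) r :
  hf (\sum_(j < n) c j *: x j) r = \sum_(j < n) c j * hf (x j) r.
Proof.
elim: n => [|n IH]; first by rewrite !big_ord0 -[0](subrr 0) hdHB subrr.
by rewrite !big_ord_recr /= addrC hdHE IH addrC.
Qed.

(** A acts as the integral operator with kernel [knl]: the partial sums of the expansion of A
    converge in mean square to A f, and pointwise to the integral by dominated convergence. *)
Lemma lift_knl x : {ae leb, forall r, hf (lift A x) r = cint leb (fun s => knl r s * hf x s)}.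
Proof.
apply: (L2_lim_pointwise (Auw x)); apply: aeW => r.
have iD : leb.-integrable setT (EFin \o (fun s => V r * W s + normc_sq (hf x s))).
  have := integrableD measurableT (integrableZl measurableT (V r) iW) (SQ_L1 (SQH x)).
  by apply: eq_integrable => // s _; rewrite /= EFinD EFinM.
have mx := (SQH x).1.
have mkn n : cmeasurable [set: RT] (fun s : RT => knl_part n r s).
  exact: (cmeasurable_comp (pair1_measurable (r : RT)) (knl_part_measurable n)).
have [||||_] := @dominated_cint _ _ RT leb (fun n s => knl_part n r s * hf x s)
    (fun s => knl r s * hf x s) _ _ iD.
- by move=> n; exact: cmeasurableM.
- by move=> s; rewrite addr_ge0 ?normc_sq_ge0// mulr_ge0 ?V_ge0 ?W_ge0.
- move=> n s; rewrite normc_sqM.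
  have := knl_part_bound n r s; have := normc_sq_ge0 (knl_part n r s).
  have := normc_sq_ge0 (hf x s); move: (V r * W s) => a; nra.
- move=> s; have := knl_cvg r s; rewrite /cvg0c => h.
  under eq_fun do rewrite -mulrBl normc_sqM.
  by rewrite -(mul0r (normc_sq (hf x s))); apply: cvgM => //; exact: cvg_cst.
apply: cvg0c_eq => n; congr (normc_sq (_ - _)); rewrite (hd_sum n (fun j => b x (w j))).
have i j : cintegrable leb (fun s => hf x s * (hf (w j) s)^*).
  by apply: SQ_mul; [exact: SQH|exact/SQJ/SQH].
have [_ h] := @cint_sum _ _ RT leb n (fun j s => hf (u j) r * (hf x s * (hf (w j) s)^*))
  (fun j => cintegrableZ _ (i j)).
transitivity (cint leb (fun s => \sum_(j < n) hf (u j) r * (hf x s * (hf (w j) s)^*))).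
  apply: eq_cint => s; rewrite /knl_part mulr_suml; apply: eq_bigr => j _.
  by rewrite -mulrA [hf x s * _]mulrC.
rewrite h; apply: eq_bigr => j _; rewrite cintZ// -ip_cint; exact: mulrC.
Qed.

Lemma knl_Dinv f : L2 f -> L2 (Dinv f) -> bounded_operator A ->
  {ae leb, forall r, hd (A (Dinv f)) r = cint leb (fun s => (rt s)%:C * knl r s * hd f s)}.
Proof.
move=> f2 Df2 Abd; have := lift_knl (toH (Dinv f)) => h.
apply: (@ae_imp _ _ RT leb _ _ h) => r; rewrite liftE// toHK// => ->.
by apply: eq_cint => s; rewrite hd_Dinv mulrCA mulrA.
Qed.

(** The kernel of A D^-1. *)
Definition knlD (r s : R) : R[i] := (rt s)%:C * knl r s.

Lemma knlD_measurable : cmeasurable [set: RT * RT] (fun p : RT * RT => knlD p.1 p.2).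
Proof.
apply: cmeasurableM; last exact: knl_measurable.
by apply: cmeasurableR; exact: measurableT_comp measurable_rt measurable_snd.
Qed.

Lemma knlD_slice_measurable r : cmeasurable [set: RT] (fun s : RT => knlD r s).
Proof. exact: (cmeasurable_comp (pair1_measurable (r : RT)) knlD_measurable). Qed.

Lemma knlD_le0 r s : s <= 0 -> knlD r s = 0.
Proof. by move=> s0; rewrite /knlD knl_eq0 ?mulr0// s0 orbT. Qed.

Definition row_norm r := (\int[leb]_s (normc_sq (knlD r s))%:E)%E.

(** The squared Hilbert-Schmidt norm of A D^-1; each of the three conditions amounts to its
    finiteness. *)
Definition knl_norm := (\int[leb]_r row_norm r)%E.

Lemma row_norm_ge0 r : (0 <= row_norm r)%E.
Proof. by apply: integral_ge0 => s _; rewrite lee_fin normc_sq_ge0. Qed.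

Lemma measurable_row_normD : measurable_fun [set: RT] row_norm.
Proof. exact: measurable_row_norm knlD_measurable. Qed.

Lemma SQ_knlD r : (row_norm r < +oo)%E -> SQ (knlD r).
Proof. by move=> h; split => //; exact: knlD_slice_measurable. Qed.

Section FiniteNorm.
Hypothesis Kfin : (knl_norm < +oo)%E.
Hypothesis Abd : bounded_operator A.
Variable e : nat -> R -> R[i].
Hypothesis eON : orthonormal_basis e.

(** Integration against [knlD], set to 0 on the null set of rows that are not square
    integrable. *)
Definition ext_val x (r : R) : R[i] :=
  if (row_norm r < +oo)%E then b x (row_vec knlD r) else 0.

Lemma ae_row_norm : {ae leb, forall r, (row_norm r < +oo)%E}.
Proof.
have iS : leb.-integrable setT row_norm.
  apply/integrableP; split; first exact: measurable_row_normD.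
  by under eq_integral do rewrite gee0_abs ?row_norm_ge0//.
have h := integrable_ae measurableT iS.
apply: (@ae_imp _ _ RT leb _ _ h) => r /(_ I).
by rewrite ge0_fin_numE ?row_norm_ge0.
Qed.

Lemma ext_val_cint x r : (row_norm r < +oo)%E ->
  ext_val x r = cint leb (fun s => knlD r s * hf x s).
Proof. by move=> h; rewrite /ext_val h ip_row_vec//; [exact: knlD_le0|exact: SQ_knlD]. Qed.

Lemma ext_val_norm_le x : cmeasurable [set: RT] (ext_val x) ->
  (\int[leb]_r (normc_sq (ext_val x r))%:E <= (qn b x)%:E * knl_norm)%E.
Proof.
move=> me; rewrite -ge0_integralZl//; last 3 first.
- exact: measurable_row_normD.
- by move=> r _; exact: row_norm_ge0.
- by rewrite lee_fin qn_ge0.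
apply: ge0_le_integral => //.
- by move=> r _; rewrite lee_fin normc_sq_ge0.
- exact: emeasurable_normc_sq.
- by apply: emeasurable_funM => //; exact: measurable_row_normD.
- move=> r _; rewrite /ext_val; case: ifPn => [h|_]; last first.
    by rewrite normc_sq0 mule_ge0 ?lee_fin ?qn_ge0 ?row_norm_ge0.
  rewrite -[row_norm r](qn_row_vec _ (SQ_knlD h)); last exact: knlD_le0.
  by rewrite -EFinM lee_fin CauchySchwarz.
Qed.

Lemma SQ_ext_val x : SQ (ext_val x).
Proof.
have mc : cmeasurable [set: RT] (fun r : RT => cint leb (fun s => knlD r s * hf x s)).
  have mG : cmeasurable [set: RT * RT] (fun p : RT * RT => knlD p.1 p.2 * hf x p.2).
    apply: cmeasurableM; first exact: knlD_measurable.
    exact: (cmeasurable_comp measurable_snd (SQH x).1).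
  split.
    exact: (@measurable_Rintegral _ _ RT _ RT leb _ mG.1).
  exact: (@measurable_Rintegral _ _ RT _ RT leb _ mG.2).
have me : cmeasurable [set: RT] (ext_val x).
  rewrite (_ : ext_val x = fun r : RT => if (row_norm r < +oo)%E then
      cint leb (fun s => knlD r s * hf x s) else 0).
    apply: (cmeasurable_ifT _ mc); last exact: cmeasurable_cst.
    by apply: measurable_fun_lte => //; exact: measurable_row_normD.
  apply/funext => r; case: ifPn => h; first exact: ext_val_cint.
  by rewrite /ext_val (negbTE h).
split => //; apply: (le_lt_trans (ext_val_norm_le me)).
by rewrite lte_mul_pinfty ?lee_fin ?qn_ge0.
Qed.

Definition ext_op : operator R := fun f => dh (ext_val (toH f)).

Lemma hd_ext_op f r : hd (ext_op f) r = ext_val (toH f) r.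
Proof.
have [r0|r0] := leP r 0; last by rewrite hd_dh.
rewrite hd_le0//; case: (boolP (row_norm r < +oo)%E) => h; last by rewrite /ext_val (negbTE h).
rewrite ext_val_cint// /cint; apply/esym/complexP => /=;
  under eq_Rintegral do rewrite /knlD knl_eq0 ?r0// mulr0 mul0r /=;
  by rewrite /Rintegral integral0.
Qed.

Lemma hf_ext_op x r : hf (lift ext_op x) r = ext_val x r.
Proof.
rewrite liftH toHK; first by rewrite hd_ext_op HfunK.
by apply: L2_dh; exact: SQ_ext_val.
Qed.

Lemma ext_op_Hilbert_Schmidt : Hilbert_Schmidt ext_op.
Proof.
have L2e f : L2 f -> L2 (ext_op f) by move=> _; apply: L2_dh; exact: SQ_ext_val.
have K0 : (0 <= knl_norm)%E by apply: integral_ge0 => r _; exact: row_norm_ge0.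
have Bbd : bounded_operator ext_op.
  apply: (@operator_bounded _ _ (fine knl_norm)) => // [a x y z|x].
    rewrite -ip_linear; apply: ip_eq_null; apply/qn_ae; apply: aeW => r.
    rewrite hdHB hdHE !hf_ext_op /ext_val; case: ifP => _; last by rewrite mulr0 addr0 subrr.
    by rewrite ip_linear subrr.
  rewrite -lee_fin EFinM fineK ?ge0_fin_numE// qnHE muleC.
  under eq_integral do rewrite hf_ext_op.
  by apply: ext_val_norm_le; exact: (SQ_ext_val x).1.
split => //; exists e; split => //; have eH := onbH eON; have [e2 _ _] := eON.
have E n : norm2 (ext_op (e n)) ^+ 2 = qn b (lift ext_op (toH (e n))).
  by rewrite liftH toHK// norm2_sq//; exact: L2e.
under eq_eseriesr do rewrite E.
rewrite (@Hilbert_Schmidt_norm knlD (fun n => toH (e n)) (fun n => lift ext_op (toH (e n))))//.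
- exact: knlD_measurable.
- exact: knlD_le0.
- by have h := ae_row_norm; apply: (@ae_imp _ _ RT leb _ _ h) => r; exact: SQ_knlD.
- move=> n; have h := ae_row_norm; apply: (@ae_imp _ _ RT leb _ _ h) => r hr.
  by rewrite hf_ext_op ext_val_cint.
Qed.

Lemma ext_op_extends f : dom_Dinv f -> L2eq (ext_op f) (A (Dinv f)).
Proof.
move=> [f2 Df2]; apply/L2eq_hd; have h1 := ae_row_norm; have h2 := knl_Dinv f2 Df2 Abd.
apply: (@ae_imp2 _ _ RT leb _ _ _ h1 h2) => r hr ->.
by rewrite hd_ext_op ext_val_cint// toHK.
Qed.

End FiniteNorm.

(** * From admissibility to a square-integrable kernel *)

Lemma knl_norm_cvg :
  (\int[leb]_r \int[leb]_s (normc_sq (if window N s then knlD r s else 0%R))%:E)%E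
    @[N --> \oo] --> knl_norm.
Proof.
pose I N r := (\int[leb]_s (normc_sq (if window N s then knlD r s else 0%R))%:E)%E.
have mk N : cmeasurable [set: RT * RT]
    (fun p : RT * RT => if window N p.2 then knlD p.1 p.2 else 0).
  apply: (cmeasurable_ifT _ knlD_measurable); last exact: cmeasurable_cst.
  exact: measurableT_comp (measurable_window N) measurable_snd.
have mono N M r s : (N <= M)%N -> normc_sq (if window N s then knlD r s else 0%R) <=
    normc_sq (if window M s then knlD r s else 0%R).
  move=> NM; case: ifP => [h|_]; first by rewrite (window_mono NM h).
  by rewrite normc_sq0 normc_sq_ge0.
have ms N r : measurable_fun [set: RT]
    (fun s => (normc_sq (if window N s then knlD r s else 0%R))%:E).
  apply: emeasurable_normc_sq.
  exact: (cmeasurable_comp (pair1_measurable (r : RT)) (mk N)).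
have rowE r : row_norm r = limn (I ^~ r).
  rewrite /I -monotone_convergence//.
  - apply: eq_integral => s _; apply/esym/cvg_lim => //.
    have [s0|/window_exhausts [N wN]] := leP s 0.
      rewrite knlD_le0//; under eq_fun do rewrite if_same; exact: cvg_cst.
    apply: cvg_near_cst; exists N => // M /= NM.
    by rewrite (window_mono NM wN).
  - by move=> N s _; rewrite lee_fin normc_sq_ge0.
  - by move=> s _ N M NM; rewrite lee_fin; exact: mono.
rewrite /knl_norm; under eq_integral do rewrite rowE.
apply: (@cvg_monotone_convergence _ RT) => //.
- by move=> N; exact: (measurable_row_norm (mk N)).
- by move=> N r _; apply: integral_ge0 => s _; rewrite lee_fin normc_sq_ge0.
- move=> r _ N M NM; apply: ge0_le_integral => //.
  + by move=> s _; rewrite lee_fin normc_sq_ge0.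
  + by move=> s _; rewrite lee_fin; exact: mono.
Qed.

Definition cutH N (x : H) : H := toH (cut N (Hfun x)).

Lemma hf_cutH N x r : hf (cutH N x) r = if window N r then hf x r else 0.
Proof. by rewrite /cutH toHK ?hd_cut//; exact/L2_cut/HfunP. Qed.

Lemma cutH_sym N x y : b (cutH N x) y = b x (cutH N y).
Proof.
rewrite !ip_cint; apply: eq_cint => r; rewrite !hf_cutH.
by case: ifP => _ //; rewrite rmorph0 mulr0 mul0r.
Qed.

Lemma cutH_contract N x : qn b (cutH N x) <= qn b x.
Proof.
rewrite -lee_fin !qnHE; apply: ge0_le_integral => //.
- by move=> r _; rewrite lee_fin normc_sq_ge0.
- exact: measurable_SQH.
- exact: measurable_SQH.
- move=> r _; rewrite lee_fin hf_cutH; case: ifP => // _.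
  by rewrite normc_sq0 normc_sq_ge0.
Qed.

(** If T extends D^-1 A^* A D^-1 then <T x, x> = |A D^-1 x|^2 for x supported in a window; the
    compressions of T to the windows have bounded traces, and these are the Hilbert-Schmidt
    norms of the truncated kernels. *)
Lemma admissible_knl_norm : bounded_operator A ->
  admissible (fun f => adjoint A (A f)) -> (knl_norm < +oo)%E.
Proof.
move=> Abd [_ _ _ _ [T [Ttr TD]]]; have [Tbd _] := Ttr.
have [e [a [c [eON asum csum Tac]]]] := trace_class_rank_one Ttr.
have eH := onbH eON; have Astar := adjoint_bounded eH Abd.
have [K hK] := compressed_trace_bounded eH asum csum Tac.
pose F N n := lift A (toH (Dinv (cut N (e n)))).
have e2 n : L2 (e n) by case: eON.
have FE N n : complex.Re (b (lift T (cutH N (toH (e n)))) (cutH N (toH (e n)))) = qn b (F N n).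
  rewrite /cutH toHK//; set f := cut N (e n).
  have f2 : L2 f by exact: L2_cut.
  have fD : dom_Dinv f by exact: cut_dom.
  have g2 : L2 (A (Dinv f)) by exact/(bounded_L2 Abd)/L2_Dinv_cut.
  have s2 : L2 (adjoint A (A (Dinv f))) by exact: (bounded_L2 Astar).
  have T2 : L2 (T f) by exact: (bounded_L2 Tbd).
  have d2 : L2 (Dinv (adjoint A (A (Dinv f)))).
    by apply: (L2_ae _ T2); [exact: cmeasurable_Dinv|exact/L2eq_sym/TD].
  have h0 := TD _ fD; move/(L2eqE T2 d2): h0 => h0.
  rewrite -(lift_toH T f2) (ip_eq_null _ h0) -innerE//.
  rewrite (@eq_inner _ _ _ (adjoint A (A (Dinv f))) (Dinv f)); last first.
    by move=> r; rewrite !hd_Dinv mulJR.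
  rewrite innerE//; last exact: L2_Dinv_cut.
  rewrite (lift_toH _ g2) -(lift_adjoint_r eH Abd) (lift_toH A) //.
  exact: L2_Dinv_cut.
apply: (@le_lt_trans _ _ K%:E); last by rewrite ltry.
rewrite -(cvg_lim _ knl_norm_cvg)//; apply: lime_le; first exact: cvgP knl_norm_cvg.
apply: nearW => N; pose k r s := if window N s then knlD r s else 0.
rewrite -(@Hilbert_Schmidt_norm k (fun n => toH (e n)) (F N))//.
- apply: nneseries_le_EFin => [n|m]; first exact: qn_ge0.
  have := hK (cutH N) (cutH_sym N) (cutH_contract N) m.
  by under eq_bigr do rewrite FE.
- apply: (cmeasurable_ifT _ knlD_measurable); last exact: cmeasurable_cst.
  exact: measurableT_comp (measurable_window N) measurable_snd.
- by move=> r s s0; rewrite /k knlD_le0// if_same.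
- apply: aeW => r; split.
    apply: (cmeasurable_ifT (measurable_window N) (knlD_slice_measurable r)).
    exact: cmeasurable_cst.
  have /integrableP[_] := integrableZl measurableT (N.+1%:R * V r) iW.
  apply: le_lt_trans; apply: ge0_le_integral => //.
  + by move=> s _; rewrite lee_fin normc_sq_ge0.
  + apply: emeasurable_normc_sq.
    apply: (cmeasurable_ifT (measurable_window N) (knlD_slice_measurable r)).
    exact: cmeasurable_cst.
  + by apply: measurableT_comp => //; exact: measurable_int (integrableZl measurableT (N.+1%:R * V r) iW).
  + move=> s _; rewrite gee0_abs -EFinM lee_fin; last by rewrite !mulr_ge0 ?V_ge0 ?W_ge0.
    rewrite /k; case: ifP => wN; last by rewrite normc_sq0 !mulr_ge0 ?V_ge0 ?W_ge0.
    rewrite /knlD normc_sqM normc_sqR -[leRHS]mulrA; apply: ler_pM.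
    * exact: sqr_ge0.
    * exact: normc_sq_ge0.
    * exact: rt_window.
    * exact: knl_bound.
- move=> n; have h := knl_Dinv (L2_cut N (e2 n)) (L2_Dinv_cut N (e2 n)) Abd.
  apply: (@ae_imp _ _ RT leb _ _ h) => r hr.
  rewrite /F liftE// toHK; last exact: L2_Dinv_cut.
  rewrite hr; apply: eq_cint => s; rewrite hd_cut toHK// /k /knlD.
  by case: ifP => _; rewrite ?mulr0 ?mul0r.
Qed.

(** * The trace formula *)

(** At fixed a, the Fourier transform of this function is x |-> tr (A U(x, a)). *)
Definition dilated (a s : R) : R[i] := (Num.sqrt a)%:C * knl (a * s) s.

(** |dilated a s| is at most the geometric mean of a V(a s) and W(s). *)
Lemma dilated_dominated a : 0 < a ->
  leb.-integrable setT (EFin \o (fun s => a * V (a * s) + W s)).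
Proof.
move=> a0; have iaV : leb.-integrable setT (fun s => (a * V (a * s))%:E).
  have mV : measurable_fun [set: RT] (fun s => (V s)%:E) by exact: measurable_int iV.
  have mVa : measurable_fun [set: RT] (fun s : RT => (V (a * s))%:E).
    by apply: (measurableT_comp mV); exact: measurable_scale.
  apply/integrableP; split.
    by under eq_fun do rewrite EFinM; exact: emeasurable_funM.
  under eq_integral do rewrite gee0_abs ?lee_fin ?mulr_ge0 ?V_ge0 ?(ltW a0)// EFinM.
  rewrite ge0_integralZl//; last 2 first.
  - by move=> s _; rewrite lee_fin V_ge0.
  - by rewrite lee_fin ltW.
  rewrite (integral_scale a0 mV); last by move=> s; rewrite lee_fin V_ge0.
  have /integrableP[_] := iV.
  by under eq_integral do rewrite /= ger0_norm ?V_ge0//.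
have := integrableD measurableT iaV iW.
by apply: eq_integrable => // s _; rewrite /= EFinD.
Qed.

(** Each term <U(x, a) u_j, w_j> is an integral of u_j(a s) conj(w_j(s)); the partial sums of the
    kernel converge under the integral by domination. *)
Lemma FW_cvg x a : 0 < a -> cvg0c (fun n =>
  cint leb (fun s => expi (2 * pi * x * s) * dilated a s) -
  \sum_(j < n) b (lift (U (x, a)) (u j)) (w j)).
Proof.
move=> a0; pose f n s := expi (2 * pi * x * s) * ((Num.sqrt a)%:C * knl_part n (a * s) s).
have mexp : cmeasurable [set: RT] (fun s : RT => expi (2 * pi * x * s)).
  by apply: measurable_expi; exact: measurable_funM.
have mpair : measurable_fun [set: RT] (fun s : RT => (a * s : RT, s)).
  by apply: measurable_fun_pair => //; exact: measurable_scale.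
have [||||_] := @dominated_cint _ _ RT leb f
  (fun s => expi (2 * pi * x * s) * dilated a s) _ _ (dilated_dominated a0).
- move=> n; apply: cmeasurableM => //; apply: cmeasurableM; first exact: cmeasurable_cst.
  exact: (cmeasurable_comp mpair (knl_part_measurable n)).
- by move=> s; rewrite addr_ge0 ?mulr_ge0 ?V_ge0 ?W_ge0 ?ltW.
- move=> n s; rewrite /f !normc_sqM normc_sq_expi mul1r normc_sqR sqr_sqrtr ?(ltW a0)//.
  have := knl_part_bound n (a * s) s; have := V_ge0 (a * s); have := W_ge0 s.
  move: (V (a * s)) (W s) (normc_sq _) => v w' q w0 v0 qvw.
  have t0 := mulr_ge0 (ltW a0) v0; have := ler_wpM2l (ltW a0) qvw; rewrite mulrA.
  by move: (a * v) t0 (a * q) => t t0 q'; have := mulr_ge0 t0 w0; nra.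
- move=> s; have := knl_cvg (a * s) s; rewrite /cvg0c => h.
  under eq_fun do rewrite /f /dilated -mulrBr -mulrBr !normc_sqM normc_sq_expi mul1r.
  by rewrite -(mulr0 (normc_sq (Num.sqrt a)%:C)); apply: cvgM => //; exact: cvg_cst.
apply: cvg0c_eq => n; congr (normc_sq (_ - _)).
have hU j s : hf (lift (U (x, a)) (u j)) s =
    expi (2 * pi * x * s) * ((Num.sqrt a)%:C * hf (u j) (a * s)).
  by rewrite liftH toHK ?hd_U//; exact: (U_norm x a0 (HfunP _)).1.
have i j : cintegrable leb (fun s => hf (lift (U (x, a)) (u j)) s * (hf (w j) s)^*).
  by apply: SQ_mul; [exact: SQH|exact/SQJ/SQH].
under eq_bigr do rewrite ip_cint.
have [_ <-] := @cint_sum _ _ RT leb n (fun j s => hf (lift (U (x, a)) (u j)) s * (hf (w j) s)^*) i.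
apply: eq_cint => s; rewrite /f /knl_part !mulr_sumr; apply: eq_bigr => j _.
by rewrite hU !mulrA.
Qed.

Hypothesis usum : summable_sq b u.
Hypothesis wsum : summable_sq b w.

Lemma FW_Dinv_cint (e : nat -> R -> R[i]) x a : orthonormal_basis e -> bounded_operator A -> 0 < a ->
  FW_Dinv A (x, a) = cint leb (fun s => expi (2 * pi * x * s) * dilated a s).
Proof.
move=> eON Abd a0; apply: (trace_eq eON) => e' e'ON; have eH := onbH e'ON.
have Ubd := U_bounded x a0; have AUbd := comp_bounded Abd Ubd.
have Ule y : qn b (lift (U (x, a)) y) <= qn b y by rewrite qn_U.
have := trace_cvg (@H_complete R) eH usum wsum Auw (U_wlinear x a0) Ule (FW_cvg x a0).
apply: cvg0c_eq => n; congr (normc_sq (_ - _)); apply: eq_bigr => k _.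
have e2 j : L2 (e' j) by case: e'ON.
rewrite innerE//; last exact: (bounded_L2 AUbd).
by rewrite -(lift_comp _ Ubd) liftH toHK.
Qed.

Lemma dilated_L1 a : 0 < a -> cintegrable leb (dilated a).
Proof.
move=> a0; have mpair : measurable_fun [set: RT] (fun s : RT => (a * s : RT, s)).
  by apply: measurable_fun_pair => //; exact: measurable_scale.
apply: (@cintegrable_le _ _ RT leb _ _ _ (dilated_dominated a0)).
- apply: cmeasurableM; first exact: cmeasurable_cst.
  exact: (cmeasurable_comp mpair knl_measurable).
- move=> s; rewrite /dilated normc_sqM normc_sqR sqr_sqrtr ?(ltW a0)//.
  have := knl_bound (a * s) s; have := V_ge0 (a * s); have := W_ge0 s.
  move: (V (a * s)) (W s) (normc_sq _) => v w' q w0 v0 qvw.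
  have t0 := mulr_ge0 (ltW a0) v0; have := ler_wpM2l (ltW a0) qvw; rewrite mulrA.
  by move: (a * v) t0 (a * q) => t t0 q'; have := mulr_ge0 t0 w0; nra.
- by move=> s; rewrite addr_ge0 ?mulr_ge0 ?V_ge0 ?W_ge0 ?(ltW a0).
Qed.

(** Plancherel on each fibre of fixed dilation. *)
Lemma FW_fibre a : 0 < a ->
  (\int[leb]_x (normc_sq (cint leb (fun s => expi (2 * pi * x * s) * dilated a s)))%:E =
   a%:E * \int[leb]_s (normc_sq (knl (a * s) s))%:E)%E.
Proof.
move=> a0; have [i1 i2] := dilated_L1 a0.
under eq_integral do rewrite (normc_sq_cint_expi _ (dilated_L1 a0)).
rewrite (plancherel i1 i2).
have mpair : measurable_fun [set: RT] (fun s : RT => (a * s : RT, s)).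
  by apply: measurable_fun_pair => //; exact: measurable_scale.
rewrite -ge0_integralZl//; last 3 first.
- apply: emeasurable_normc_sq.
  exact: (cmeasurable_comp mpair knl_measurable).
- by move=> s _; rewrite lee_fin normc_sq_ge0.
- by rewrite lee_fin ltW.
apply: eq_integral => s _; rewrite -EFinM; congr EFin.
rewrite -[LHS]/(normc_sq (dilated a s)) /dilated normc_sqM normc_sqR.
by rewrite sqr_sqrtr ?(ltW a0).
Qed.

(** Equal to the trace on Aff, and jointly measurable by construction. *)
Definition FW_fun (p : R * R) : R[i] :=
  cint leb (fun s => expi (2 * pi * p.1 * s) * dilated p.2 s).

Lemma FW_fun_measurable : cmeasurable [set: RT * RT] FW_fun.
Proof.
have mG : cmeasurable [set: (RT * RT) * RT]
    (fun q : (RT * RT) * RT => expi (2 * pi * q.1.1 * q.2) * dilated q.1.2 q.2).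
  have m11 : measurable_fun [set: (RT * RT) * RT] (fun q => q.1.1 : RT).
    exact: (measurableT_comp measurable_fst measurable_fst).
  have m12 : measurable_fun [set: (RT * RT) * RT] (fun q => q.1.2 : RT).
    exact: (measurableT_comp measurable_snd measurable_fst).
  have m2 : measurable_fun [set: (RT * RT) * RT] (fun q => q.2 : RT) by exact: measurable_snd.
  apply: cmeasurableM.
    by apply: measurable_expi; apply: measurable_funM => //; exact: measurable_funM.
  apply: cmeasurableM.
    by apply: cmeasurableR; exact: measurableT_comp measurable_sqrt m12.
  have mp : measurable_fun [set: (RT * RT) * RT] (fun q => (q.1.2 * q.2 : RT, q.2)).
    by apply: measurable_fun_pair => //; exact: measurable_funM.
  exact: (cmeasurable_comp mp knl_measurable).
split.
  exact: (@measurable_Rintegral _ _ (RT * RT)%type _ RT leb _ mG.1).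
exact: (@measurable_Rintegral _ _ (RT * RT)%type _ RT leb _ mG.2).
Qed.

Lemma in_Aff (p : R * R) : (p \in (Aff : set (R * R))) = (0 < p.2).
Proof.
rewrite -in_Rplus; apply/idP/idP => [/set_mem[_ h]|/set_mem h]; first exact: mem_set.
by apply: mem_set.
Qed.

(** Plancherel in x, then the change of variable r = a s in the dilation variable a. *)
Lemma FW_fun_norm :
  (\int[(leb \x leb)%E]_(p in Aff) (p.2^-1 * normc_sq (FW_fun p))%:E = knl_norm)%E.
Proof.
pose f (p : RT * RT) := (rt p.2 ^+ 2 * normc_sq (FW_fun p))%:E.
have mrt2 : measurable_fun [set: RT * RT] (fun p => rt p.2 ^+ 2).
  by apply: measurable_funX; exact: (measurableT_comp measurable_rt measurable_snd).
have mf : measurable_fun [set: RT * RT] f.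
  apply/measurable_EFinP; apply: measurable_funM => //.
  exact: measurable_normc_sq FW_fun_measurable.
have f0 p : (0 <= f p)%E by rewrite lee_fin mulr_ge0 ?sqr_ge0 ?normc_sq_ge0.
have -> : (\int[(leb \x leb)%E]_(p in Aff) (p.2^-1 * normc_sq (FW_fun p))%:E =
    \int[(leb \x leb)%E]_p f p)%E.
  rewrite integral_mkcond; apply: eq_integral => p _; rewrite patchE in_Aff /f.
  by case: ltP => p0; [rewrite rt_sq|rewrite rt_le0// expr0n mul0r].
have FT := @fubini_tonelli2 _ _ RT RT R leb leb f mf f0.
rewrite FT.
pose g (p : RT * RT) := (normc_sq (knl (p.1 * p.2) p.2))%:E.
have mg : measurable_fun [set: RT * RT] g.
  apply: emeasurable_normc_sq.
  have mp : measurable_fun [set: RT * RT] (fun p => (p.1 * p.2 : RT, p.2)).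
    by apply: measurable_fun_pair => //; apply: measurable_funM.
  exact: (cmeasurable_comp mp knl_measurable).
have g0 p : (0 <= g p)%E by rewrite lee_fin normc_sq_ge0.
have fibre (a : R) : (\int[leb]_x f (x, a) = \int[leb]_s g (a, s))%E.
  rewrite /f /g /=; have [a0|a0] := leP a 0.
    rewrite rt_le0// expr0n; under eq_integral do rewrite mul0r.
    rewrite integral0; apply/esym; under eq_integral => s _.
      rewrite knl_eq0 ?normc_sq0; last first.
        by have [s0|s0] := leP s 0; rewrite ?orbT// orbF mulr_le0_ge0// ltW.
      over.
    by rewrite integral0.
  under eq_integral do rewrite EFinM; rewrite ge0_integralZl//; last 3 first.
  - apply: emeasurable_normc_sq.
    exact: (cmeasurable_comp (pair2_measurable (a : RT)) FW_fun_measurable).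
  - by move=> x _; rewrite lee_fin normc_sq_ge0.
  - by rewrite lee_fin sqr_ge0.
  rewrite /FW_fun /= FW_fibre// muleA -EFinM rt_sq// mulVf ?mul1e//; exact: lt0r_neq0.
transitivity (\int[leb]_a \int[leb]_s g (a, s))%E.
  by apply: eq_integral => a _; exact: fibre.
exact: dilation_norm knl_measurable knl_eq0.
Qed.

Lemma FW_square_integrable (e : nat -> R -> R[i]) : orthonormal_basis e -> bounded_operator A ->
  L2r_Aff (FW_Dinv A) <-> (knl_norm < +oo)%E.
Proof.
move=> eON Abd; have FWE p : 0 < p.2 -> FW_Dinv A p = FW_fun p.
  by case: p => x a /= a0; rewrite (FW_Dinv_cint x eON Abd a0).
have E : (\int[(leb \x leb)%E]_(p in Aff) (p.2^-1 * normc_sq (FW_Dinv A p))%:E = knl_norm)%E.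
  rewrite -FW_fun_norm; apply: eq_integral => p; rewrite in_Aff => p0.
  by rewrite FWE.
have mFW : cmeasurable (Aff : set (RT * RT)) (FW_Dinv A).
  split.
    apply: (@eq_measurable_fun _ _ (RT * RT)%type RT _ (fun p => complex.Re (FW_fun p))).
      by move=> p; rewrite in_Aff => p0; rewrite FWE.
    exact: measurable_funTS FW_fun_measurable.1.
  apply: (@eq_measurable_fun _ _ (RT * RT)%type RT _ (fun p => complex.Im (FW_fun p))).
    by move=> p; rewrite in_Aff => p0; rewrite FWE.
  exact: measurable_funTS FW_fun_measurable.2.
by split=> [[_]|h]; [rewrite E|split; rewrite ?E].
Qed.

End RankOneKernel.
End Kernel.

Theorem theorem7 (R : realType) (A : operator R)
    (A_trace_class : trace_class A) (A_nonzero : nonzero_operator A) :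
  (L2r_Aff (FW_Dinv A) <->
   exists B : operator R, Hilbert_Schmidt B /\
     forall f, dom_Dinv f -> L2eq (B f) (A (Dinv f)))
  /\
  ((exists B : operator R, Hilbert_Schmidt B /\
     forall f, dom_Dinv f -> L2eq (B f) (A (Dinv f))) <->
   admissible (fun f => adjoint A (A f))).
Proof.
have [Abd _] := A_trace_class.
have [e [u0 [w0 [eON u0s w0s Auw0]]]] := trace_class_rank_one A_trace_class.
have [u [V [uu0 iV uV]]] := patch_summable u0s.
have [w [W [ww0 iW wW]]] := patch_summable w0s.
have Auw := rank_one_sum_patch Auw0 uu0 ww0.
have us : summable_sq ipH u.
  by move: u0s; rewrite /summable_sq; under eq_eseriesr do rewrite -(qn_eq_null (uu0 _)).
have ws : summable_sq ipH w.
  by move: w0s; rewrite /summable_sq; under eq_eseriesr do rewrite -(qn_eq_null (ww0 _)).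
have FWK := FW_square_integrable iV iW uV wW Auw us ws eON Abd.
have ext_of_norm : (knl_norm u w < +oo)%E -> exists B : operator R, Hilbert_Schmidt B /\
    forall f, dom_Dinv f -> L2eq (B f) (A (Dinv f)).
  move=> Kfin; exists (ext_op u w); split.
    exact: (ext_op_Hilbert_Schmidt uV wW Kfin eON).
  exact: (ext_op_extends iW uV wW Auw Kfin Abd).
have adm_of_ext := HS_extension_admissible A_trace_class A_nonzero.
have norm_of_adm := admissible_knl_norm iW uV wW Auw Abd.
split; split.
- by move/FWK; exact: ext_of_norm.
- by move/adm_of_ext/norm_of_adm/FWK.
- exact: adm_of_ext.
- by move/norm_of_adm; exact: ext_of_norm.
Qed.
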